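(* Let $L$ be a language on a finite alphabet $\mathcal A$ and let $\mathcal F\subset\mathcal A$. Then $L$ is a grouped coding of an $\mathcal F$-flipped affine interval exchange transformation (the transformation being decreasing on the coding interval of $e$ exactly when $e\in\mathcal F$) if and only if $L$ satisfies an $\mathcal F$-flipped order condition and there exist a splitting $\hat L$ of $L$, on an alphabet $\hat{\mathcal A}$, and real numbers $\theta_e$, $e\in\hat{\mathcal A}$, such that for each non recurrent sequence $z\in X_{\hat L}$, $$\sum_{n\ge 0}\exp\Big(\sum_{j=0}^n\theta_{z_j}\Big)<+\infty\quad\text{and}\quad \sum_{n>0}\exp\Big(-\sum_{j=-n}^{-1}\theta_{z_j}\Big)<+\infty .$$
   Context: Language: a language $L$ over a finite alphabet $\mathcal A$ is a collection of sets $L_n$ ($n\ge 0$) of words of length $n$ over $\mathcal A$, with $L_0=\{\text{empty word}\}$, that is factorial (all factors of words of $L$ are in $L$) and extendable (for each $v\in L$ there are letters $a,b$ with $av\in L$, $vb\in L$). It is assumed that every letter is used, $L_1=\mathcal A$. For $w\in L$, $A(w)=\{x: xw\in L\}$ and $D(w)=\{x: wx\in L\}$; $w$ is bispecial if $\#A(w)>1$ and $\#D(w)>1$ (this includes the empty word if $\#L_1>1$). $X_L\subset\mathcal A^{\mathbb Z}$ is the set of bi-infinite sequences all of whose finite factors are in $L$. A sequence $x\in\mathcal A^{\mathbb Z}$ is recurrent if every factor $w$ of $x$ occurs in $x$ at positions tending to $+\infty$ and at positions tending to $-\infty$. Order condition: $L$ satisfies an $\mathcal F$-flipped order condition ($\mathcal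 F\subset\mathcal A$ possibly empty) if there exist two (total) orders $<_A$ and $<_D$ on $\mathcal A$ such that for every bispecial word $w$, whenever $awc$ and $bwd$ are in $L$ with letters $a\ne b$, $c\ne d$, then $a<_A b$ if and only if $c<_{D,w}d$, where $<_{D,w}$ is $<_D$ if the number of occurrences in $w$ of letters of $\mathcal F$ is even, and the reverse of $<_D$ if this number is odd. Splitting: suppose $L$ satisfies an $\mathcal F$-flipped order condition with orders $<_A,<_D$. A language $\hat L$ is a splitting of $L$ if its letters are $e_i$, $e\in\mathcal A$, $1\le i\le k_e$, forming the set $\hat{\mathcal A}$, such that $L=\phi(\hat L)$, where $\phi(e_i)=e$ is extended to words as a morphism for concatenation, and $\hat L$ satisfies an $\hat{\mathcal F}$-flipped order condition where - $\hat{\mathcal F}$ is the set of all $e_i$ with $e\in\mathcal F$; - if $e\notin\mathcal F$, then $e_1,\dots,e_{k_e}$ are consecutive and ordered in the same way by the orders $<_A$ and $<_D$ of $\hat L$; - if $e\in\mathcal F$, then $e_1,\dots,e_{k_e}$ are consecutive and ordered in opposite ways by the orders $<_A$ and $<_D$ of $\hat L$; - for $e\neq e'$, if $e<_A e'$ (resp. $e<_D e'$) in $L$, then $e_i<_A e'_j$ (resp. $e_i<_D e'_j$) in $\hat L$ for all $i,j$. Interval exchange: an $\mathcal F$-flipped generalized interval exchange transformation is a map $T$ defined on a disjoint union of nonempty open intervals $I_e$, $e\in\mathcal A$ (the defining intervals), whose closures have union $[0,1]$, continuous and strictly increasing on $I_e$ for $e\notin\mathcal F$, continuous and strictly decreasing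 on $I_e$ for $e\in\mathcal F$, such that the $TI_e$ are disjoint open intervals whose closures have union $[0,1]$. It is affine if its restriction to each $I_e$ is an affine map. The defining intervals are part of the data. Grouped coding: $L$ is a grouped coding of a flipped affine interval exchange transformation $T$ if there are open intervals $\tilde I_e$, $e\in\tilde{\mathcal A}$ (here $\tilde{\mathcal A}$ is the alphabet of $L$), such that each $\tilde I_e$ is a disjoint union of defining intervals of $T$ (plus the intermediate endpoints), $T$ extends by continuity to a continuous monotone map on each $\tilde I_e$, and $L$ is the language generated by (the set of finite factors of) the trajectories $(x_n)_{n\in\mathbb Z}$, $x_n=e$ if $T^nx\in\tilde I_e$. *)

(* Defs.v *)
From HB Require Import structures.
From mathcomp Require Import all_boot all_order all_algebra.
From mathcomp Require Import all_classical all_reals all_analysis.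
Set Implicit Arguments.
Unset Strict Implicit.
Unset Printing Implicit Defensive.
Import Order.TTheory GRing.Theory Num.Theory.
Import numFieldNormedType.Exports.
Local Open Scope classical_set_scope.
Local Open Scope ring_scope.

(** A graded language [(L_n)_n] is the set of its words, [L_n] being the set of
    those of size [n]. *)
Definition is_language (A : finType) (L : set (seq A)) : Prop :=
  [/\ L [::],
      forall v w : seq A, infix v w -> L w -> L v,
      forall v : seq A, L v -> exists a b : A, L (a :: v) /\ L (rcons v b)
    & forall a : A, L [:: a]].

Definition arrivals (A : finType) (L : set (seq A)) (w : seq A) : {set A} :=
  [set x | `[< L (x :: w) >]]%SET.

Definition departures (A : finType) (L : set (seq A)) (w : seq A) : {set A} :=
  [set x | `[< L (rcons w x) >]]%SET.

Definition bispecial (A : finType) (L : set (seq A)) (w : seq A) : Prop :=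
  [/\ L w, (1 < #|arrivals L w|)%N & (1 < #|departures L w|)%N].

Definition factor_at (A : Type) (x : int -> A) (i : int) (n : nat) : seq A :=
  mkseq (fun j : nat => x (i + j%:Z)) n.

Definition bi_infinite (A : finType) (L : set (seq A)) : set (int -> A) :=
  [set x | forall (i : int) (n : nat), L (factor_at x i n)].

Definition recurrent (A : Type) (x : int -> A) : Prop :=
  forall (i : int) (n : nat) (N : int),
    (exists2 j : int, N <= j & factor_at x j n = factor_at x i n) /\
    (exists2 j : int, j <= N & factor_at x j n = factor_at x i n).

Definition strict_total_order (A : eqType) (lt : rel A) : Prop :=
  [/\ irreflexive lt, transitive lt
    & forall x y : A, x != y -> lt x y || lt y x].

(** The order [<_{D,w}]. *)
Definition flip_order (A : finType) (F : {set A}) (ltD : rel A) (w : seq A) :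
    rel A :=
  fun c d => if odd (count (mem F) w) then ltD d c else ltD c d.

Definition flipped_order_condition (A : finType) (F : {set A})
    (L : set (seq A)) (ltA ltD : rel A) : Prop :=
  [/\ strict_total_order ltA, strict_total_order ltD
    & forall w : seq A, bispecial L w ->
      forall a b c d : A, a != b -> c != d ->
        L (a :: rcons w c) -> L (b :: rcons w d) ->
        (ltA a b <-> flip_order F ltD w c d)].

(** The letter [e_i], [1 <= i <= k e], is the dependent pair of
    [e] and the ordinal [i - 1] of ['I_(k e)], so that [phi] is [tag]. *)
Definition split_alphabet (A : finType) (k : A -> nat) : finType :=
  {e : A & 'I_(k e)}.

Definition split_letter (A : finType) (k : A -> nat) (x : split_alphabet k) :
    A := tag x.

Definition consecutive_fibres (A : finType) (k : A -> nat)
    (lt : rel (split_alphabet k)) : Prop :=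
  forall x y z : split_alphabet k, split_letter x = split_letter z ->
    lt x y -> lt y z -> split_letter y = split_letter x.

Definition is_splitting (A : finType) (F : {set A}) (L : set (seq A))
    (ltA ltD : rel A) (k : A -> nat) (hL : set (seq (split_alphabet k))) :
    Prop :=
  [/\ is_language hL,
      L = [set map (@split_letter A k) v | v in hL]
    & exists hltA hltD : rel (split_alphabet k),
      [/\ flipped_order_condition
            [set x : split_alphabet k | split_letter x \in F]%SET hL hltA hltD,
          consecutive_fibres hltA /\ consecutive_fibres hltD,
          forall x y : split_alphabet k, split_letter x = split_letter y ->
            split_letter x \notin F -> hltA x y = hltD x y,
          forall x y : split_alphabet k, split_letter x = split_letter y ->
            split_letter x \in F -> hltA x y = hltD y x
        & forall x y : split_alphabet k, split_letter x != split_letter y ->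
            (ltA (split_letter x) (split_letter y) -> hltA x y) /\
            (ltD (split_letter x) (split_letter y) -> hltD x y)]].

Definition open_interval (R : realType) (J : set R) : Prop :=
  exists a b : R, a < b /\ J = [set` `]a, b[].

Definition interval_partition (R : realType) (B : finType) (I : B -> set R) :
    Prop :=
  [/\ forall e : B, open_interval (I e), trivIset setT I
    & \bigcup_e closure (I e) = [set` `[0, 1]]].

Definition flip_monotone (R : realType) (flip : bool) (J : set R)
    (f : R -> R) : Prop :=
  forall x y : R, J x -> J y -> x < y -> if flip then f y < f x else f x < f y.

(** The map, defined on the union of the [I e], is given as a total function
    [T], of which only the values on these intervals are constrained or used. *)
Definition flipped_giet (R : realType) (B : finType) (G : {set B})
    (I : B -> set R) (T : R -> R) : Prop :=
  [/\ interval_partition I,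
      forall e : B, {within I e, continuous T},
      forall e : B, flip_monotone (e \in G) (I e) T
    & interval_partition (fun e : B => T @` I e)].

Definition affine_on (R : realType) (J : set R) (f : R -> R) : Prop :=
  exists a b : R, forall x : R, J x -> f x = a * x + b.

Definition flipped_affine_iet (R : realType) (B : finType) (G : {set B})
    (I : B -> set R) (T : R -> R) : Prop :=
  flipped_giet G I T /\ forall e : B, affine_on (I e) T.

(** The two-sided orbit [S^n (y 0)] is given as [y : int -> R], which avoids an
    inverse of [S]; [x] is its coding by the [J e]. *)
Definition trajectory (R : realType) (A : finType) (J : A -> set R)
    (S : R -> R) (y : int -> R) (x : int -> A) : Prop :=
  forall n : int, y (n + 1) = S (y n) /\ J (x n) (y n).

(** [g b] is the letter whose coding interval contains the defining interval
    [I b].  The second and third clauses express that [J e] is the union of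
    the [I b], [g b = e], and of endpoints of these; [S] is the extension of
    [T] by continuity to the [J e]. *)
Definition flipped_grouped_coding (R : realType) (A : finType) (F : {set A})
    (L : set (seq A)) (B : finType) (I : B -> set R) (T : R -> R) : Prop :=
  exists (J : A -> set R) (g : B -> A) (S : R -> R),
    [/\ (forall e : A, open_interval (J e)) /\ trivIset setT J,
        forall e : A, \bigcup_(b in [set b | g b = e]) I b `<=` J e,
        forall e : A, J e `<=` \bigcup_(b in [set b | g b = e]) closure (I b),
        [/\ forall (b : B) (t : R), I b t -> S t = T t,
            forall e : A, {within J e, continuous S}
          & forall e : A, flip_monotone (e \in F) (J e) S]
      & L = [set w | exists (y : int -> R) (x : int -> A) (i : int) (n : nat),
                trajectory J S y x /\ w = factor_at x i n]].

(* Main.v *)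
(** The bridge between both sides is a conformal mass: a function [lam] on words,
    the length of a cylinder, with [lam w = sum_c lam (w c)] and
    [lam w = sum_a exp (theta a) lam (a w)].

    From left to right, [lam] is the length of the cylinders of the exchange and
    [theta] the logarithm of its slopes.  By the order condition, the words that
    can be extended by two given letters on the same side are nested; so along a
    non recurrent [z] the masses of the cylinders of [z] stop decreasing, and
    the images of such a cylinder form a Rokhlin tower of total mass at most 1.
    This bounds both series.

    From right to left, the two series make the orbit of a non recurrent
    sequence the support of a finite atomic conformal mass.  A word that occurs
    in recurrent sequences only occurs in them with bounded gaps, hence has
    positive mass for some shift invariant mean.  Long words tell these two
    cases apart, so that a countable convex combination of those masses charges
    all words and is conformal for slopes depending on a bounded number of
    letters.  Tiling [0, 1] by the words of each length, ordered
    lexicographically with flips, turns the shift into the required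
    exchange; that it does is again the order condition. *)
Require Import Defs.
From HB Require Import structures.
From mathcomp Require Import all_boot all_order all_algebra.
From mathcomp Require Import all_classical all_reals all_analysis.
From mathcomp Require Import measurable_realfun.
From mathcomp Require Import zify lra ring.
Set Implicit Arguments.
Unset Strict Implicit.
Unset Printing Implicit Defensive.
Import Order.TTheory GRing.Theory Num.Theory.
Import numFieldNormedType.Exports.
Local Open Scope classical_set_scope.
Local Open Scope ring_scope.

(** * Words and the order condition *)

Section Words.
Variable E : finType.
Implicit Types (L : set (seq E)) (u v w : seq E).

(** Only the values of a mass on words are ever used, so averages taken to the limit along an
    ultrafilter serve as well as measures. The obstacle is that the masses to be combined have
    different slopes: [exp(theta_{z_0})] at the atoms of a non recurrent [z], but 1 for a shift
    invariant mean. Their convex combination is conformal only if all of them obey one scale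
    function of a block of bounded length, and this is what the separation of long words supplies: a
    block of length [n0] tells to which regime it belongs. The price is that slopes depend on [n0]
    letters, so the exchange is affine only on the tiles of the words of length [n0] of the
    splitting; these tiles become the defining intervals, and [L] comes out as a grouped coding.
    Languages are generated by two-sided trajectories, whereas an exchange is unconstrained at the
    endpoints of its intervals. The points whose orbit breaks off there are countably many, so every
    nonempty open subset of [[0, 1]] contains a point with a full orbit. *)

Definition factorial_lang L := forall v w, infix v w -> L w -> L v.

(** What remains of the order condition once orders and flips are forgotten. This symmetric form
    passes to reversed words, so that sequences whose past fails to recur reduce to those whose
    future does. *)
Definition crossing_free L := forall (a b c d : E) w, a != b -> c != d ->
  L (a :: rcons w c) -> L (a :: rcons w d) ->
  L (b :: rcons w c) -> L (b :: rcons w d) -> False.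

Lemma crossing_free_rev L :
  crossing_free L -> crossing_free [set w | L (rev w)].
Proof.
move=> cfL a b c d w ab cd /=; rewrite !rev_cons !rev_rcons !rcons_cons.
by move=> h1 h2 h3 h4; apply: (cfL c d a b (rev w)).
Qed.

Lemma factorial_rev L : factorial_lang L -> factorial_lang [set w | L (rev w)].
Proof. by move=> fL v w vw /=; apply: fL; rewrite infix_rev. Qed.

Lemma prefix_or_differ u v : (size u <= size v)%N ->
  u = take (size u) v \/
  exists w a b u' v', [/\ a != b, u = w ++ a :: u' & v = w ++ b :: v'].
Proof.
elim: u v => [|a u IH] [|b v] //=; [by left|by left|].
rewrite ltnS => /IH.
have [->|ab _] := eqVneq a b; last by right; exists [::], a, b, u, v.
move=> [<-|[w [a' [b' [u' [v' [ab -> ->]]]]]]]; first by left.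
by right; exists (b :: w), a', b', u', v'.
Qed.

(** At the first place where [u] and [v] differ, after a common prefix [w], the letters [c], [c']
    before and [a], [b] after [w] would form a crossing. *)
Lemma left_special_prefix L (c c' : E) u v :
  factorial_lang L -> crossing_free L -> c != c' ->
  L (c :: u) -> L (c' :: u) -> L (c :: v) -> L (c' :: v) ->
  (size u <= size v)%N -> u = take (size u) v.
Proof.
move=> fL cfL cc' cu c'u cv c'v /prefix_or_differ[//|].
move=> [w [a [b [u' [v' [ab uE vE]]]]]]; exfalso.
have ext (d x : E) s t : s = w ++ x :: t -> L (d :: s) -> L (d :: rcons w x).
  move=> ->; apply: fL; apply/infixP; exists [::], t.
  by rewrite /= -cat_rcons.
by apply: (cfL c c' a b w) => //; [apply: ext uE _|apply: ext vE _|
  apply: ext uE _|apply: ext vE _].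
Qed.

Lemma right_special_suffix L (c c' : E) u v :
  factorial_lang L -> crossing_free L -> c != c' ->
  L (rcons u c) -> L (rcons u c') -> L (rcons v c) -> L (rcons v c') ->
  (size u <= size v)%N -> u = drop (size v - size u) v.
Proof.
move=> fL cfL cc' uc uc' vc vc' uv.
have := @left_special_prefix _ c c' (rev u) (rev v) (factorial_rev fL)
  (crossing_free_rev cfL) cc'.
rewrite /= !rev_cons !revK !size_rev => /(_ uc uc' vc vc' uv).
by move=> /(congr1 rev); rewrite revK take_rev revK.
Qed.

Lemma flip_order_total (F : {set E}) (lt : rel E) w :
  strict_total_order lt -> strict_total_order (flip_order F lt w).
Proof.
rewrite /flip_order => -[irr tr tot]; case: (odd _); split => //.
- by move=> x y z /= xy yz; exact: tr yz xy.
- by move=> x y xy; rewrite orbC tot.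
Qed.

Lemma strict_total_asym (lt : rel E) : strict_total_order lt ->
  forall x y, lt x y -> lt y x -> False.
Proof. by move=> [irr tr _] x y xy yx; have := tr _ _ _ xy yx; rewrite irr. Qed.

(** Two words that differ at both ends around [w] already make [w] bispecial. *)
Lemma order_condition_pair (F : {set E}) L ltA ltD :
  factorial_lang L -> flipped_order_condition F L ltA ltD ->
  forall w a b c d, a != b -> c != d ->
    L (a :: rcons w c) -> L (b :: rcons w d) ->
    (ltA a b <-> flip_order F ltD w c d).
Proof.
move=> fL [_ _ oc] w a b c d ab cd awc bwd; apply: oc => //.
have aw : L (a :: w).
  by apply: fL awc; apply/infixP; exists [::], [:: c]; rewrite /= cats1.
have bw : L (b :: w).
  by apply: fL bwd; apply/infixP; exists [::], [:: d]; rewrite /= cats1.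
have wc : L (rcons w c).
  by apply: fL awc; apply/infixP; exists [:: a], [::]; rewrite /= cats0.
have wd : L (rcons w d).
  by apply: fL bwd; apply/infixP; exists [:: b], [::]; rewrite /= cats0.
split; first by apply: fL aw; apply/infixP; exists [:: a], [::]; rewrite /= cats0.
- apply/card_gt1P; exists a, b; split => //; rewrite inE; exact/asboolP.
- apply/card_gt1P; exists c, d; split => //; rewrite inE; exact/asboolP.
Qed.

(** Four crossing extensions would make [a < b] equivalent both to [c < d] and to [d < c] in the
    order attached to [w]. *)
Lemma order_condition_crossing_free (F : {set E}) L ltA ltD :
  factorial_lang L -> flipped_order_condition F L ltA ltD -> crossing_free L.
Proof.
move=> fL oc a b c d w ab cd ac ad bc bd.
have [tA tD _] := oc.
have h1 := order_condition_pair fL oc ab cd ac bd.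
have dc : d != c by rewrite eq_sym.
have h2 := order_condition_pair fL oc ab dc ad bc.
have tf := flip_order_total F w tD.
have asym := strict_total_asym tf.
have [_ _ /(_ _ _ cd) /orP[f|f]] := tf.
- by apply: (asym _ _ f); apply/h2/h1.
- by apply: (asym _ _ f); apply/h1/h2.
Qed.

End Words.

Section Factors.
Variable E : Type.
Implicit Types (z : int -> E) (i j : int) (n m : nat).

Lemma size_factor_at z i n : size (factor_at z i n) = n.
Proof. by rewrite /factor_at size_mkseq. Qed.

Lemma factor_at0 z i : factor_at z i 0 = [::].
Proof. by []. Qed.

Lemma nth_factor_at x0 z i n k : (k < n)%N ->
  nth x0 (factor_at z i n) k = z (i + k%:Z).
Proof. by move=> kn; rewrite nth_mkseq. Qed.

Lemma factor_atD z i n m :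
  factor_at z i (n + m) = factor_at z i n ++ factor_at z (i + n%:Z) m.
Proof.
rewrite /factor_at /mkseq iotaD map_cat; congr (_ ++ _).
rewrite add0n -[in LHS](addn0 n) iotaDl -map_comp; apply: eq_map => k /=.
by rewrite PoszD addrA.
Qed.

Lemma factor_atS z i n : factor_at z i n.+1 = z i :: factor_at z (i + 1) n.
Proof. by rewrite -add1n factor_atD /= addr0. Qed.

Lemma factor_atSr z i n :
  factor_at z i n.+1 = rcons (factor_at z i n) (z (i + n%:Z)).
Proof. by rewrite -addn1 factor_atD -cats1 {2}/factor_at /mkseq /= addr0. Qed.

Lemma take_factor_at z i n k : (k <= n)%N ->
  take k (factor_at z i n) = factor_at z i k.
Proof.
move=> kn; rewrite -(subnKC kn) factor_atD take_size_cat //.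
exact: size_factor_at.
Qed.

Lemma drop_factor_at z i n k : (k <= n)%N ->
  drop k (factor_at z i n) = factor_at z (i + k%:Z) (n - k).
Proof.
move=> kn; rewrite -{1}(subnKC kn) factor_atD drop_size_cat //.
exact: size_factor_at.
Qed.

Lemma eq_factor_at z z' i i' n :
  (forall k, (k < n)%N -> z (i + k%:Z) = z' (i' + k%:Z)) <->
  factor_at z i n = factor_at z' i' n.
Proof.
split=> [h|].
  by apply/eq_in_map => k; rewrite mem_iota add0n => /andP[_ /h].
move=> h k kn; have := congr1 (nth (z i) ^~ k) h.
by rewrite !nth_mkseq.
Qed.

Lemma factor_at_rev z i n :
  rev (factor_at (fun j => z (- 1 - j)) i n) = factor_at z (- i - n%:Z) n.
Proof.
elim: n i => [//|n IH] i.
rewrite factor_atS rev_cons IH factor_atSr; congr rcons; last congr z; last by lia.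
congr factor_at; lia.
Qed.

End Factors.

Lemma infix_factor_at (E : eqType) (z : int -> E) (i : int) n k m :
  (k + m <= n)%N -> infix (factor_at z (i + k%:Z) m) (factor_at z i n).
Proof.
move=> kmn; apply/infixP.
exists (factor_at z i k), (factor_at z (i + k%:Z + m%:Z) (n - (k + m))).
by rewrite catA -factor_atD -addrA -PoszD -factor_atD subnKC.
Qed.

(** * Summability along non recurrent sequences *)

Section WordSums.
Variables (R : realType) (E : finType).
Implicit Types (u v w x : seq E) (F : seq E -> R).

Fixpoint words n : seq (seq E) :=
  if n is n'.+1 then [seq a :: w | a <- index_enum E, w <- words n']
  else [:: [::]].

Lemma size_words n w : w \in words n -> size w = n.
Proof.
elim: n w => [|n IH] w /=; first by rewrite inE => /eqP ->.
by move=> /allpairsP[[a v] /= [_ /IH <- ->]].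
Qed.

Lemma sum_wordsS n F :
  \sum_(w <- words n.+1) F w = \sum_a \sum_(w <- words n) F (a :: w).
Proof. by rewrite /= big_allpairs_dep. Qed.

Lemma sum_wordsD n m F : \sum_(w <- words (n + m)) F w =
  \sum_(w <- words n) \sum_(v <- words m) F (w ++ v).
Proof.
elim: n F => [|n IH] F; first by rewrite /= big_seq1.
by rewrite addSn !sum_wordsS; apply: eq_bigr => a _; rewrite IH.
Qed.

Lemma sum_words_pick x F :
  \sum_(w <- words (size x)) (if w == x then F w else 0) = F x.
Proof.
elim: x F => [|a x IH] F; first by rewrite /= big_seq1 eqxx.
rewrite /= sum_wordsS (bigD1 a) //= [X in _ + X]big1 ?addr0.
  by rewrite -[RHS](IH (fun w => F (a :: w))); apply: eq_bigr => w _;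
    rewrite eqseq_cons eqxx.
by move=> b ba; apply: big1 => w _; rewrite eqseq_cons (negPf ba).
Qed.

End WordSums.

Section Mass.
Variables (R : realType) (E : finType) (theta : E -> R) (lam : seq E -> R).
Implicit Types (u v w x : seq E).

Definition conformal_mass :=
  [/\ forall u, 0 <= lam u,
      forall u, lam u = \sum_c lam (rcons u c),
      forall u, lam u = \sum_a expR (theta a) * lam (a :: u)
    & lam [::] = 1].

Hypothesis cm : conformal_mass.

Definition weight w : R := expR (\sum_(a <- w) theta a).

Lemma weight_cat u v : weight (u ++ v) = weight u * weight v.
Proof. by rewrite /weight big_cat expRD. Qed.

Lemma weight_cons a v : weight (a :: v) = expR (theta a) * weight v.
Proof. by rewrite /weight big_cons expRD. Qed.

Lemma mass_extend_right n u : lam u = \sum_(q <- words E n) lam (u ++ q).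
Proof.
have [_ lr _ _] := cm.
elim: n u => [|n IH] u; first by rewrite /= big_seq1 cats0.
rewrite sum_wordsS lr; apply: eq_bigr => c _; rewrite IH.
by apply: eq_bigr => q _; rewrite cat_rcons.
Qed.

Lemma mass_extend_left n u :
  lam u = \sum_(p <- words E n) weight p * lam (p ++ u).
Proof.
have [_ _ ll _] := cm.
elim: n u => [|n IH] u.
  by rewrite /= big_seq1 /weight big_nil expR0 mul1r.
rewrite sum_wordsS exchange_big /= IH; apply: eq_bigr => p _.
rewrite ll mulr_sumr; apply: eq_bigr => a _.
by rewrite weight_cons mulrCA mulrA.
Qed.

(* The images of the cylinder of [x] under the first [J] iterates are disjoint:
   a Rokhlin tower. *)
Lemma tower_mass_le1 x J : (J <= size x)%N ->
  (forall d, (0 < d <= J)%N -> take (size x - d) x <> drop d x) ->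
  \sum_(j < J.+1) weight (take j x) * lam x <= 1.
Proof.
move=> Jx noov; have [l0 _ _ l1] := cm.
(* [m W] is the mass of the [J]-th image of the cylinder of [W]; these images fill the space. *)
pose m W := weight (take J W) * lam W.
have total : \sum_(W <- words E (J + size x)) m W = 1.
  rewrite -l1 (mass_extend_left J) sum_wordsD; apply: eq_big_seq => w wJ.
  rewrite cats0 [in RHS](mass_extend_right (size x)) mulr_sumr.
  by apply: eq_bigr => q _; rewrite /m take_size_cat ?(size_words wJ).
(* [x] is read in [W] at offset [J - j]: the [J]-th image of the cylinder of [W] lies in level [j]
   of the tower. *)
pose mt j W := take (size x) (drop (J - j) W) == x.
have level (j : 'I_J.+1) : weight (take j x) * lam x =
    \sum_(W <- words E (J + size x)) (if mt j W then m W else 0).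
  have jJ : (j <= J)%N by rewrite -ltnS.
  have -> : (J + size x = (J - j) + (size x + j))%N by lia.
  rewrite sum_wordsD [in LHS](mass_extend_left (J - j)) mulr_sumr.
  apply: eq_big_seq => w wJ; rewrite sum_wordsD.
  pose G y := \sum_(q <- words E j) weight w * weight (take j y) *
     lam (w ++ y ++ q).
  transitivity (G x).
    rewrite /G -mulr_sumr (mass_extend_right j (w ++ x)) mulrCA -mulrA.
    by congr (_ * (_ * _)); apply: eq_bigr => q _; rewrite catA.
  rewrite -[LHS]sum_words_pick; apply: eq_big_seq => y yx.
  have sy := size_words yx; have sw := size_words wJ.
  have mtE q : mt j (w ++ y ++ q) = (y == x).
    by rewrite /mt drop_size_cat // take_size_cat.
  case: ifP => yE.
    apply: eq_bigr => q _; rewrite mtE yE /m.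
    rewrite take_cat sw ltnNge leq_subr /= subKn // takel_cat ?weight_cat //.
    by rewrite sy (leq_trans jJ).
  symmetry; apply: big1 => q _.
  by rewrite mtE yE.
under eq_bigr do rewrite level.
rewrite exchange_big /= -total; apply: ler_sum => W _.
have m0 : 0 <= m W by rewrite mulr_ge0 ?expR_ge0.
have [/existsP[j0 j0W]|] := boolP [exists j : 'I_J.+1, mt j W]; last first.
  by rewrite negb_exists => /forallP no; rewrite big1 // => j _;
    rewrite (negPf (no j)).
rewrite (bigD1 j0) //= j0W big1 ?addr0 // => j jj0; case: ifP => // jW.
(* A [W] in two levels contains two copies of [x] shifted by [i' - i], hence an overlap of [x] with
   itself, against [noov]. *)
have ov (i i' : 'I_J.+1) : (i < i')%N -> mt i W -> mt i' W -> False.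
  move=> ii' /eqP iW /eqP i'W; have i'J : (i' <= J)%N by rewrite -ltnS.
  apply: (noov (i' - i)%N); first by lia.
  rewrite -{3}i'W -{2}iW take_takel ?leq_subr // -[drop _ (take _ _)]
    (_ : take (size x - (i' - i)) (drop (i' - i) (drop (J - i') W)) = _).
    by rewrite drop_drop; congr (take _ (drop _ _)); lia.
  by rewrite take_drop subnK //; lia.
exfalso; have [lt|lt|eq] := ltngtP j j0; [exact: ov lt jW j0W|exact: ov lt j0W jW|].
by move: jj0; rewrite -val_eqE /= eq eqxx.
Qed.

End Mass.

Lemma bounded_of_at_most_one (X : finType) (P : X -> nat -> Prop) :
  (forall x m m', (m < m')%N -> P x m -> P x m' -> False) ->
  exists M, forall x m, P x m -> (m < M)%N.
Proof.
move=> uP.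
have : forall x, exists M, forall m, P x m -> (m <= M)%N.
  move=> x; have [[m Pm]|no] := pselect (exists m, P x m).
    exists m => m' Pm'; rewrite leqNgt; apply/negP => mm'.
    exact: uP mm' Pm Pm'.
  by exists 0%N => m Pm; exfalso; apply: no; exists m.
move=> /choice[f fP]; exists (\max_x f x).+1 => x m /fP mf.
by rewrite ltnS (leq_trans mf) // leq_bigmax.
Qed.

Lemma eventually_all_finite (X : finType) (P : X -> nat -> Prop) :
  (forall x n n', (n <= n')%N -> P x n -> P x n') ->
  (forall x, exists n, P x n) -> exists n, forall x, P x n.
Proof.
move=> mP /choice[f fP]; exists (\max_x f x) => x.
by apply: mP (fP x); rewrite leq_bigmax.
Qed.

(** * Sequences in which some factor occurs for the last time, at [p0] *)

Section ForwardNonrecurrent.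
Variables (R : realType) (E : finType) (theta : E -> R) (lam : seq E -> R).
Variable L : set (seq E).
Hypotheses (cm : conformal_mass theta lam) (fL : factorial_lang L)
  (cfL : crossing_free L) (lamL : forall u, L u <-> 0 < lam u).
Variables (z : int -> E) (p0 : int) (l : nat) (m : int -> R).
Hypotheses (zL : bi_infinite L z)
  (last_occ : forall j, p0 < j -> factor_at z j l <> factor_at z p0 l)
  (m_gt0 : forall i, 0 < m i)
  (mS : forall i, m (i + 1) = expR (theta (z i)) * m i).

Lemma lam0 u : ~ L u -> lam u = 0.
Proof.
move=> Lu; apply/eqP; have [l0 _ _ _] := cm; rewrite eq_le l0 andbT leNgt.
by apply/negP => /lamL.
Qed.

(** Suppose that the rays of [z] from [- K] and [- K'] are both preceded by [a'] in [z] and could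
    both be preceded by another letter [a]. By nestedness the rays coincide, and the marked factor
    at [p0] comes back [K' - K] places later. So each pair of letters spoils at most one [K]. As [L]
    is factorial and the alphabet finite, one length [n0] then rules out all [a] for a given [K]. *)
Lemma left_special_bounded : exists m1 : nat, - m1%:Z <= p0 /\
  forall K, (m1 <= K)%N -> exists n0, forall n, (n0 <= n)%N ->
    forall a, a != z (- K%:Z - 1) -> ~ L (a :: factor_at z (- K%:Z) n).
Proof.
pose P (x : E * E) (K : nat) := [/\ - K%:Z <= p0, x.1 != x.2,
  z (- K%:Z - 1) = x.2 & forall n, L (x.1 :: factor_at z (- K%:Z) n)].
have [|M PM] := @bounded_of_at_most_one _ P.
  move=> [a a'] K K' KK' [/= Kp aa' za' La] [/= Kp' _ za'' La'].
  have per (n : nat) : factor_at z (- K%:Z) n = factor_at z (- K'%:Z) n.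
    have La2 (k : nat) : z (- k%:Z - 1) = a' -> L (a' :: factor_at z (- k%:Z) n).
      move=> <-; have := zL (- k%:Z - 1) n.+1; rewrite factor_atS.
      by congr (L (_ :: factor_at _ _ _)); lia.
    have := left_special_prefix fL cfL aa' (La n) (La2 K za') (La' n)
      (La2 K' za'').
    by rewrite !size_factor_at take_factor_at // => ->.
  pose k0 := absz (p0 + K'%:Z)%R.
  apply: (@last_occ (p0 + (K' - K)%N%:Z)); first by lia.
  have := per (k0 + l)%N; rewrite !factor_atD => /eqP.
  rewrite eqseq_cat ?size_factor_at // => /andP[_ /eqP e].
  have -> : p0 + (K' - K)%N%:Z = - K%:Z + k0%:Z by rewrite /k0; lia.
  by rewrite e; congr factor_at; rewrite /k0; lia.
exists (maxn M (absz p0)); split; first by lia.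
move=> K MK.
have [||n0 n0P] := @eventually_all_finite _ (fun a n => a != z (- K%:Z - 1) ->
  ~ L (a :: factor_at z (- K%:Z) n)).
- move=> a n n' nn' h az /= Ln'; apply: (h az); apply: fL Ln'.
  apply/infixP; exists [::], (factor_at z (- K%:Z + n%:Z) (n' - n)).
  by rewrite /= -factor_atD subnKC.
- move=> a; have [->|az] := eqVneq a (z (- K%:Z - 1)); first by exists 0%N.
  apply: contrapT => no; suff /PM : P (a, z (- K%:Z - 1)) K by lia.
  split => //=; first by lia.
  by move=> n; apply: contrapT => nL; apply: no; exists n.
exists n0 => n nn0 a az Ln; apply: (n0P a az); apply: fL Ln.
apply/infixP; exists [::], (factor_at z (- K%:Z + n0%:Z) (n - n0)).
by rewrite /= -factor_atD subnKC.
Qed.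

(** Prefixes of the ray from [- K] that can be continued by the same two letters are suffixes of one
    another; two of them containing the marked factor would repeat it to the right of [p0]. *)
Lemma right_special_bounded (K : nat) : - K%:Z <= p0 ->
  exists n0, forall n, (n0 <= n)%N ->
    forall c, c != z (- K%:Z + n%:Z) -> ~ L (rcons (factor_at z (- K%:Z) n) c).
Proof.
move=> Kp.
pose P (x : E * E) (n : nat) := [/\ p0 + K%:Z + l%:Z <= n%:Z, x.1 != x.2,
  z (- K%:Z + n%:Z) = x.2 & L (rcons (factor_at z (- K%:Z) n) x.1)].
have [|M PM] := @bounded_of_at_most_one _ P.
  move=> [c c'] n n' nn' [/= Kn cc' zc' Lc] [/= Kn' _ zc'' Lc'].
  have Lz (k : nat) : z (- K%:Z + k%:Z) = c' ->
      L (rcons (factor_at z (- K%:Z) k) c').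
    by move=> <-; rewrite -factor_atSr; apply: zL.
  have := right_special_suffix fL cfL cc' Lc (Lz _ zc') Lc' (Lz _ zc'').
  rewrite !size_factor_at drop_factor_at ?leq_subr // subKn; last by lia.
  move=> /(_ (ltnW nn')) per.
  pose k0 := absz (p0 + K%:Z)%R.
  apply: (@last_occ (p0 + (n' - n)%N%:Z)); first by lia.
  move: per; have -> : n = (k0 + (l + (n - k0 - l)))%N by rewrite /k0; lia.
  rewrite !factor_atD => /eqP.
  rewrite eqseq_cat ?size_factor_at // => /andP[_].
  rewrite eqseq_cat ?size_factor_at // => /andP[/eqP e _].
  rewrite (_ : factor_at z p0 l = factor_at z (- K%:Z + k0%:Z) l); last first.
    by congr factor_at; rewrite /k0; lia.
  by rewrite e; congr factor_at; rewrite /k0; lia.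
exists (maxn M (absz (p0 + K%:Z + l%:Z)%R)) => n Mn c cz Lc.
suff /PM : P (c, z (- K%:Z + n%:Z)) n by lia.
by split => //=; lia.
Qed.

(** Beyond the last branching on the right the cylinders keep their mass. Without branching on the
    left, the sum over preceding letters has a single term, which scales the limit exactly as [m] is
    scaled. Hence one constant [M] for all [K]: [M * m (- K)] is the mass left on the ray of [z]
    from [- K]. *)
Lemma mass_eventually : exists (m1 : nat) (M : R), [/\ - m1%:Z <= p0, 0 < M &
  forall K, (m1 <= K)%N -> exists n0, forall n, (n0 <= n)%N ->
    lam (factor_at z (- K%:Z) n) = M * m (- K%:Z)].
Proof.
have [l0 lr ll l1] := cm.
have [m1 [m1p LS]] := left_special_bounded.
have [n1 RS] := right_special_bounded m1p.
pose c := lam (factor_at z (- m1%:Z) n1).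
have c0 : 0 < c by apply/lamL/zL.
exists m1, (c / m (- m1%:Z)); split => //; first by rewrite divr_gt0.
move=> K /subnKC <-; elim: (K - m1)%N => [|d [n0 IH]].
  exists n1 => n; rewrite addn0 divfK ?gt_eqF // => /subnKC <-.
  elim: (n - n1)%N => [|k IH]; first by rewrite addn0.
  rewrite -{}IH addnS [RHS]lr (bigD1 (z (- m1%:Z + (n1 + k)%N%:Z))) //=.
  rewrite -factor_atSr big1 ?addr0 // => a az; apply: lam0; apply: RS => //.
  by rewrite leq_addr.
have [n2 n2P] := LS (m1 + d)%N (leq_addr _ _).
exists (maxn n0 n2).+1 => -[//|n]; rewrite ltnS geq_max => /andP[nn0 nn2].
have := IH n nn0; rewrite ll (bigD1 (z (- (m1 + d)%N%:Z - 1))) //=.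
rewrite big1 ?addr0; last by move=> a az; rewrite (lam0 (n2P n nn2 a az)) mulr0.
have -> : - (m1 + d)%N%:Z = - (m1 + d.+1)%N%:Z + 1 by lia.
rewrite mS addrK -factor_atS mulrCA.
by move=> /mulfI; apply; rewrite gt_eqF ?expR_gt0.
Qed.

(** The tower over a long cylinder of the ray from [- K] has levels of mass [M * m (- K + j)], of
    sum at most 1; hence the bound [M^-1], independent of [K]. *)
Lemma forward_nonrecurrent_summable : exists (C : R) (K0 : nat),
  forall K, (K0 <= K)%N -> \sum_(j < (2 * K).+1) m (- K%:Z + j%:Z) <= C.
Proof.
have [m1 [M [m1p M0 massE]]] := mass_eventually.
exists (M^-1), m1 => K m1K; have [n0 n0P] := massE K m1K.
(* Room for the stable range [n0], for the marked factor at offset [p0 + K], and for shifts by up to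
   [2 * K]: an overlap of [x] with itself would then show the marked factor to the right of [p0]. *)
pose n := (n0 + (absz (p0 + K%:Z)%R) + l + 2 * K)%N.
pose x := factor_at z (- K%:Z) n.
have xE : lam x = M * m (- K%:Z) by apply: n0P; rewrite /n; lia.
have wE (j : nat) : weight theta (factor_at z (- K%:Z) j) =
    m (- K%:Z + j%:Z) / m (- K%:Z).
  elim: j => [|j IH].
    by rewrite addr0 divff ?gt_eqF // /weight big_nil expR0.
  rewrite factor_atSr -cats1 weight_cat IH /weight big_seq1.
  have -> : - K%:Z + j.+1%:Z = - K%:Z + j%:Z + 1 by lia.
  by rewrite mS mulrC mulrA.
have noov d : (0 < d <= 2 * K)%N -> take (size x - d) x <> drop d x.
  move=> d0; rewrite /x size_factor_at take_factor_at ?leq_subr //.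
  rewrite drop_factor_at; last by rewrite /n; lia.
  pose k0 := absz (p0 + K%:Z)%R.
  have -> : (n - d = k0 + (l + (n - d - k0 - l)))%N by rewrite /k0 /n; lia.
  rewrite !factor_atD => /eqP.
  rewrite eqseq_cat ?size_factor_at // => /andP[_].
  rewrite eqseq_cat ?size_factor_at // => /andP[/eqP e _].
  apply: (@last_occ (p0 + d%:Z)); first by lia.
  rewrite (_ : factor_at z p0 l = factor_at z (- K%:Z + k0%:Z) l); last first.
    by congr factor_at; rewrite /k0; lia.
  by rewrite e; congr factor_at; rewrite /k0; lia.
have Jx : (2 * K <= size x)%N by rewrite size_factor_at /n; lia.
rewrite -(ler_pM2r M0) mulVf ?gt_eqF //.
apply: le_trans (tower_mass_le1 cm Jx noov); rewrite mulr_suml xE.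
apply: ler_sum => j _; rewrite take_factor_at; last first.
  by have := ltn_ord j; rewrite /n; lia.
by rewrite wE mulrCA divfK ?gt_eqF // mulrC.
Qed.

End ForwardNonrecurrent.

Section OrbitMass.
Variables (R : realType) (E : Type) (theta : E -> R) (z : int -> E).

(** The solution of [m (i + 1) = exp(theta (z i)) * m i] with [m 0 = 1]. Its values at positive and
    at negative positions are exactly the terms of the two series. *)
Definition orbit_mass (i : int) : R := match i with
  | Posz n => expR (\sum_(0 <= j < n) theta (z j%:Z))
  | Negz n => expR (- \sum_(1 <= j < n.+2) theta (z (- j%:Z))) end.

Lemma orbit_mass_gt0 i : 0 < orbit_mass i.
Proof. by case: i => n; rewrite expR_gt0. Qed.

Lemma orbit_massS i : orbit_mass (i + 1) = expR (theta (z i)) * orbit_mass i.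
Proof.
case: i => n.
  by rewrite -PoszD addn1 /orbit_mass big_nat_recr //= expRD mulrC.
rewrite /orbit_mass NegzE; case: n => [|n].
  by rewrite (_ : - 1%:Z + 1 = 0%:Z) // big_nat1 big_geq // -expRD addrN.
rewrite (_ : - n.+2%:Z + 1 = Negz n); last by rewrite NegzE; lia.
by rewrite [in RHS]big_nat_recr //= opprD expRD mulrC -mulrA -expRD addNr
  expR0 mulr1.
Qed.

End OrbitMass.

Section NonrecurrentSummable.
Variables (R : realType) (E : finType) (theta : E -> R) (lam : seq E -> R).
Variable L : set (seq E).
Hypotheses (cm : conformal_mass theta lam) (fL : factorial_lang L)
  (cfL : crossing_free L) (lamL : forall u, L u <-> 0 < lam u).

(** Mass of the image of the cylinder of [rev u] under [size u] iterates: a conformal mass for the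
    inverse transformation, with words reversed and slopes inverted. *)
Definition rev_mass u := weight theta u * lam (rev u).

Lemma conformal_mass_rev : conformal_mass (fun a => - theta a) rev_mass.
Proof.
have [l0 lr ll l1] := cm; split.
- by move=> u; rewrite mulr_ge0 ?expR_ge0.
- move=> u; rewrite /rev_mass ll mulr_sumr; apply: eq_bigr => c _.
  by rewrite rev_rcons -cats1 weight_cat {3}/weight big_seq1 mulrA.
- move=> u; rewrite /rev_mass lr mulr_sumr; apply: eq_bigr => c _.
  by rewrite rev_cons weight_cons !mulrA -expRD addNr expR0 mul1r.
- by rewrite /rev_mass /weight big_nil expR0 mul1r.
Qed.

Lemma last_occurrence (z : int -> E) (i : int) n (N : int) :
  (forall j, N <= j -> factor_at z j n <> factor_at z i n) ->
  exists p0, forall j, p0 < j -> factor_at z j n <> factor_at z p0 n.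
Proof.
move=> noN.
pose P k := factor_at z (i + k%:Z) n == factor_at z i n.
have P0 : exists k, P k by exists 0%N; rewrite /P addr0.
have Pb k : P k -> (k <= absz (N - i)%R)%N.
  move=> /eqP Pk; rewrite leqNgt; apply/negP => kN; apply: noN Pk; lia.
case: (ex_maxnP P0 Pb) => k /eqP Pk kmax; exists (i + k%:Z) => j kj.
rewrite Pk => /eqP Pj; have := kmax (absz (j - i)%R).
rewrite /P (_ : i + (absz (j - i)%R)%:Z = j); last by lia.
by move=> /(_ Pj); lia.
Qed.

Lemma nonrecurrent_summable (z : int -> E) (m : int -> R) :
  bi_infinite L z -> ~ recurrent z ->
  (forall i, 0 < m i) -> (forall i, m (i + 1) = expR (theta (z i)) * m i) ->
  exists (C : R) (K0 : nat),
    forall K, (K0 <= K)%N -> \sum_(j < (2 * K).+1) m (- K%:Z + j%:Z) <= C.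
Proof.
move=> zL nr m0 mS.
have [[i [n [N noN]]]|[i [n [N noN]]]] :
    (exists i n (N : int), forall j, N <= j -> factor_at z j n <> factor_at z i n) \/
    (exists i n (N : int), forall j, j <= N -> factor_at z j n <> factor_at z i n).
  apply: contrapT => /not_orP[h1 h2]; apply: nr => i n N; split.
    apply: contrapT => h; apply: h1; exists i, n, N => j Nj e; apply: h.
    by exists j.
  apply: contrapT => h; apply: h2; exists i, n, N => j Nj e; apply: h.
  by exists j.
- have [p0 last] := last_occurrence noN.
  exact: (forward_nonrecurrent_summable cm fL cfL lamL zL last m0 mS).
(* A factor is absent far to the left: reflecting positions and passing to [rev_mass] reduce this to
   the previous case, with [m (- i)] as orbit mass of [z']. *)
pose z' := fun j : int => z (- 1 - j).
have z'E j k : factor_at z' j k = rev (factor_at z (- j - k%:Z) k).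
  by rewrite -factor_at_rev revK.
have [p0 last] : exists p0, forall j, p0 < j ->
    factor_at z' j n <> factor_at z' p0 n.
  apply: (@last_occurrence z' (- i - n%:Z) n (- N - n%:Z)) => j Nj.
  rewrite !z'E => /(congr1 rev); rewrite !revK => h.
  apply: (noN (- j - n%:Z)); first by lia.
  by rewrite h; congr factor_at; lia.
have lamL' u : L (rev u) <-> 0 < rev_mass u.
  by rewrite lamL /rev_mass pmulr_rgt0 // expR_gt0.
have zL' : bi_infinite [set w | L (rev w)] z'.
  by move=> j k /=; rewrite z'E revK; apply: zL.
have mS' i' : m (- (i' + 1)) = expR (- theta (z' i')) * m (- i').
  rewrite (_ : - i' = - (i' + 1) + 1); last by lia.
  rewrite mS mulrA /z' (_ : - 1 - i' = - (i' + 1)); last by lia.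
  by rewrite -expRD addNr expR0 mul1r.
have [C [K0 CP]] := forward_nonrecurrent_summable conformal_mass_rev
  (factorial_rev fL) (crossing_free_rev cfL) lamL' zL' last
  (fun i => m0 (- i)) mS'.
exists C, K0 => K /CP; apply: le_trans; rewrite (reindex_inj rev_ord_inj) /=.
apply: ler_sum => j _; rewrite le_eqVlt; apply/orP; left; apply/eqP; congr m.
by have := ltn_ord j; lia.
Qed.

Lemma nonrecurrent_series (z : int -> E) :
  bi_infinite L z -> ~ recurrent z ->
  (\sum_(0 <= n <oo)
     (expR (\sum_(0 <= j < n.+1) theta (z j%:Z)))%:E < +oo)%E /\
  (\sum_(1 <= n <oo)
     (expR (- \sum_(1 <= j < n.+1) theta (z (- j%:Z))))%:E < +oo)%E.
Proof.
move=> zL nr.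
pose m := orbit_mass theta z.
have m0 : forall i, 0 < m i := orbit_mass_gt0 theta z.
have mS := orbit_massS theta z : forall i, m (i + 1) = expR (theta (z i)) * m i.
have [C [K0 CP]] := nonrecurrent_summable zL nr m0 mS.
have bnd (f : nat -> R) k : (forall n, 0 <= f n) ->
    (forall K, \sum_(k <= n < K) f n <= C) ->
    (\sum_(k <= n <oo) (f n)%:E < +oo)%E.
  move=> f0 fC; apply: (@le_lt_trans _ _ C%:E); last by rewrite ltry.
  apply: lime_le.
    by apply: is_cvg_ereal_nneg_natsum_cond => n _ _; rewrite lee_fin.
  by apply: nearW => K; rewrite sumEFin lee_fin.
split; apply: bnd => [n|K]; rewrite ?expR_ge0 //.
(* The partial sum is a slice of the symmetric window of half-width [K0 + K], to which the bound
   applies. *)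
- apply: le_trans (CP (K0 + K)%N (leq_addr _ _)).
  rewrite -[leRHS](big_mkord xpredT (fun j => m (- (K0 + K)%N%:Z + j%:Z))).
  rewrite [leRHS](@big_cat_nat _ _ _ (K0 + K).+1) //=; last by lia.
  rewrite [X in _ <= _ + X](@big_cat_nat _ _ _ (K0 + K + K).+1) //=; try lia.
  rewrite addrCA -[leLHS]addr0 lerD //; last first.
    by rewrite addr_ge0 // sumr_ge0 // => j _; rewrite ltW.
  rewrite -{1}[(K0 + K).+1]add0n big_addn.
  rewrite (_ : ((K0 + K + K).+1 - (K0 + K).+1 = K)%N); last by lia.
  apply: ler_sum => n _; rewrite (_ : _ + _ = Posz n.+1) //; lia.
- case: K => [|K]; first by rewrite big_geq // (le_trans _ (CP K0 (leqnn _))) //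
    sumr_ge0 // => j _; rewrite ltW.
  apply: le_trans (CP (K0 + K)%N (leq_addr _ _)).
  rewrite -[leRHS](big_mkord xpredT (fun j => m (- (K0 + K)%N%:Z + j%:Z))).
  rewrite [leRHS](@big_cat_nat _ _ _ (K0 + K)) //=; last by lia.
  rewrite [X in _ <= X + _](@big_cat_nat _ _ _ K0) //=; try lia.
  rewrite -addrA addrCA -[leLHS]addr0 lerD //; last first.
    by rewrite addr_ge0 // sumr_ge0 // => j _; rewrite ltW.
  rewrite -{1}(add0n K0) big_addn addnC addnK big_add1 /= big_nat_rev /=.
  rewrite !big_nat; apply: ler_sum => n nK.
  rewrite (_ : - _ + _ = Negz (0 + K - n.+1)%N) // NegzE; lia.
Qed.

End NonrecurrentSummable.

(** * Intervals, cylinders and full orbits *)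

Section Intervals.
Variable R : realType.
Implicit Types (a b : R) (U X : set R).

Lemma itvoo_near (a b t e : R) : a < b -> a <= t -> t <= b -> 0 < e ->
  exists2 x, a < x < b & `|t - x| < e.
Proof.
move=> ab at_ tb e0; pose d := Num.min (e / 2) ((b - a) / 3).
have d0 : 0 < d by rewrite lt_min; apply/andP; split; lra.
have de : d <= e / 2 by rewrite ge_min lexx.
have db : d <= (b - a) / 3 by rewrite ge_min lexx orbT.
have [tm|tm] := leP t ((a + b) / 2).
  exists (t + d); first by apply/andP; split; lra.
  by rewrite opprD addNKr normrN gtr0_norm //; lra.
exists (t - d); first by apply/andP; split; lra.
by rewrite opprB addrCA subrr addr0 gtr0_norm //; lra.
Qed.

Lemma closure_itvoo a b : a < b -> closure [set` `]a, b[] = [set` `[a, b]].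
Proof.
move=> ab; apply/seteqP; split; first exact: itv_closure.
move=> t /=; rewrite in_itv /= => /andP[at_ tb] B /nbhs_ballP[e /= e0 eB].
have [x xab tx] := itvoo_near ab at_ tb e0; exists x; split; last exact: eB.
by rewrite /= in_itv.
Qed.

Lemma itvoo_sub a b U : open U -> U a -> exists2 e, 0 < e &
  [set` `]a - e, a + e[] `<=` U.
Proof.
move=> oU Ua; have /nbhs_ballP[e /= e0 eU] : nbhs a U by exact: open_nbhs_nbhs.
by exists e => // x; rewrite -ball_itv => /eU.
Qed.

Lemma itvoo_avoid a b U : a < b -> countable U ->
  exists2 x, [set` `]a, b[] x & ~ U x.
Proof.
move=> ab cU; apply: contrapT => no.
have sub : [set` `]a, b[] `<=` U.
  by move=> x xab; apply: contrapT => nU; apply: no; exists x.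
have := countable_lebesgue_measure0 (sub_countable (subset_card_le sub) cU).
by rewrite lebesgue_measure_itv /= lte_fin ab -EFinD; case; lra.
Qed.

Lemma disjoint_itv_lt (E : eqType) (J : E -> set R) (p : E -> R) (x y : E) s t :
  (forall e, is_interval (J e)) -> trivIset setT J -> (forall e, J e (p e)) ->
  x != y -> J x s -> J y t -> (s < t) = (p x < p y).
Proof.
move=> iJ tJ Jp xy.
have half (x' y' : E) s' t' : x' != y' -> J x' s' -> J y' t' -> s' < t' ->
    p x' < p y'.
  move=> xy' Js Jt st.
  have ne r : J x' r -> J y' r -> False.
    by move=> h h'; move/eqP: xy'; apply; apply: tJ => //; exists r.
  rewrite ltNge; apply/negP => pyx.
  have [h|h] := leP (p y') s'.
    apply: (ne s') => //; apply: (iJ y' (p y') t') => //; apply/andP; split => //.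
    exact: ltW.
  have [h'|h'] := leP t' (p x').
    apply: (ne t') => //; apply: (iJ x' s' (p x')) => //; apply/andP; split => //.
    exact: ltW.
  apply: (ne (p y')) => //; apply: (iJ x' s' (p x')) => //.
  by apply/andP; split => //; exact: ltW.
move=> Js Jt; apply/idP/idP; first exact: half.
move=> pxy; have [//|ts|st] := ltgtP s t.
  have := half y x t s; rewrite eq_sym => /(_ xy Jt Js ts) pyx.
  by have := lt_trans pxy pyx; rewrite ltxx.
by move/eqP: xy; case; apply: tJ => //; exists s; split => //; rewrite st.
Qed.

Lemma strict_total_order_pull (E : eqType) (p : E -> R) : injective p ->
  strict_total_order (fun x y => p x < p y).
Proof.
move=> ip; split; first by move=> x; rewrite ltxx.
- by move=> x y z; apply: lt_trans.
- by move=> x y xy; rewrite -neq_lt (inj_eq ip).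
Qed.

Lemma trivIset_inj (E : eqType) (J : E -> set R) (p : E -> R) :
  trivIset setT J -> (forall e, J e (p e)) -> injective p.
Proof. by move=> tJ Jp x y e; apply: tJ => //; exists (p x); split => //; rewrite e. Qed.

End Intervals.

Section Cylinders.
Variables (R : realType) (E : finType) (J : E -> set R) (S : R -> R).
Implicit Types (w : seq E) (t : R).

Fixpoint cyl w : set R :=
  if w is a :: w' then J a `&` S @^-1` (cyl w') else setT.

Lemma cyl_rcons w c t : cyl (rcons w c) t <-> cyl w t /\ J c (iter (size w) S t).
Proof.
elim: w t => [|a w IH] t /=; first by split=> [[]|[]].
have -> : S (iter (size w) S t) = iter (size w) S (S t) by rewrite -iterSr.
by split=> [[Ja /IH[h1 h2]]|[[Ja h1] h2]]; split => //; apply/IH.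
Qed.

Lemma cyl_open w : (forall e, open (J e)) ->
  (forall e, {within J e, continuous S}) -> open (cyl w).
Proof.
move=> oJ cS; elim: w => [|a w IH]; first exact: openT.
rewrite openE => x /= [Jx Sx]; apply: filterI; first exact: open_nbhs_nbhs.
have cSx : {for x, continuous S}.
  by have := cS a; rewrite continuous_open_subspace // => /(_ x); apply; rewrite inE.
by apply: cSx; exact: open_nbhs_nbhs.
Qed.

Lemma trajectory_cyl y x i n : trajectory J S y x ->
  cyl (factor_at x i n) (y i).
Proof.
move=> tr; elim: n i => [//|n IH] i; rewrite factor_atS /=.
have [yS Jy] := tr i; split => //; by rewrite /= -yS.
Qed.

Lemma cyl_trajectory_eq y x w i : trivIset setT J -> trajectory J S y x ->
  cyl w (y i) -> w = factor_at x i (size w).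
Proof.
move=> tJ tr; elim: w i => [//|a w IH] i /= [Ja Sw].
have [yS Jy] := tr i.
rewrite factor_atS; congr (_ :: _); last by apply: IH; rewrite yS.
by apply: tJ => //; exists (y i).
Qed.

Variable F : {set E}.
Hypothesis mS : forall e, flip_monotone (e \in F) (J e) S.

Lemma cyl_monotone w s t : cyl w s -> cyl w t -> s < t ->
  if odd (count (mem F) w) then iter (size w) S t < iter (size w) S s
  else iter (size w) S s < iter (size w) S t.
Proof.
elim: w s t => [//|a w IH] s t [Js Ss] [Jt St] st.
have := mS Js Jt st.
have -> : odd (count (mem F) (a :: w)) = (a \in F) (+) odd (count (mem F) w).
  by rewrite /= oddD oddb.
rewrite [size _]/= !iterSr.
case: (a \in F) => /= h; last exact: IH.
by have := IH _ _ St Ss h; case: (odd _).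
Qed.

Lemma flip_monotone_inj e s t : J e s -> J e t -> S s = S t -> s = t.
Proof.
move=> Js Jt; have [st|ts|//] := ltgtP s t => Sst.
  by have := mS Js Jt st; rewrite Sst; case: ifP; rewrite ltxx.
by have := mS Jt Js ts; rewrite Sst; case: ifP; rewrite ltxx.
Qed.

(** Take [s] in the cylinder of [a w c] and [t] in that of [b w d]. Then [S s] and [S t] both lie in
    the cylinder of [w], ordered like [a] and [b]. The [size w] further steps keep or reverse this
    order according to the parity of flips in [w], and lead into the intervals of [c] and [d]. *)
Lemma coding_order_condition (L : set (seq E)) (p q : E -> R) :
  (forall e, is_interval (J e)) -> trivIset setT J -> (forall e, J e (p e)) ->
  (forall e, is_interval (S @` J e)) -> trivIset setT (fun e => S @` J e) ->
  (forall e, (S @` J e) (q e)) ->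
  (forall w, L w -> exists t, cyl w t) ->
  flipped_order_condition F L (fun x y => q x < q y) (fun x y => p x < p y).
Proof.
move=> iJ tJ Jp iSJ tSJ Sq Lc; split.
- exact/strict_total_order_pull/(trivIset_inj tSJ).
- exact/strict_total_order_pull/(trivIset_inj tJ).
move=> w _ a b c d ab cd /Lc[s [Jas /cyl_rcons[ws Jc]]].
move=> /Lc[t [Jbt /cyl_rcons[wt Jd]]].
have Sa : (S @` J a) (S s) by exists s.
have Sb : (S @` J b) (S t) by exists t.
rewrite -(disjoint_itv_lt iSJ tSJ Sq ab Sa Sb) /flip_order.
rewrite -(disjoint_itv_lt iJ tJ Jp cd Jc Jd).
have dc : d != c by rewrite eq_sym.
rewrite -(disjoint_itv_lt iJ tJ Jp dc Jd Jc).
have [st|ts|e] := ltgtP (S s) (S t).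
- by have := cyl_monotone ws wt st; case: (odd _) => ->.
- have := cyl_monotone wt ws ts.
  by case: (odd _) => h; split=> // h'; have := lt_trans h h'; rewrite ltxx.
- by move/eqP: ab; case; apply: tSJ => //; exists (S s); split => //; rewrite e.
Qed.

End Cylinders.

(** * Points with a full two-sided orbit *)

Section Orbits.
Variables (R : realType) (B : finType) (I : B -> set R) (T : R -> R).
Hypotheses (pI : interval_partition I)
  (pT : interval_partition (fun e => T @` I e))
  (injT : forall e s t, I e s -> I e t -> T s = T t -> s = t).

Lemma partition_compl_countable (X : B -> set R) : interval_partition X ->
  countable [set t | t \in `[0, 1] /\ forall e, ~ X e t].
Proof.
move=> [oX _ cX]; have /choice[ab abP] : forall e, exists ab : R * R,
    ab.1 < ab.2 /\ X e = [set` `]ab.1, ab.2[].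
  by move=> e; have [a [b [? ?]]] := oX e; exists (a, b).
apply: (@sub_countable _ _ _
  (\bigcup_(e in [set: B]) [set (ab e).1] `|` \bigcup_(e in [set: B]) [set (ab e).2])).
  apply: subset_card_le => t [t01 nX].
  have : (\bigcup_e closure (X e)) t by rewrite cX.
  move=> [e _]; have [lt Xe] := abP e; rewrite Xe closure_itvoo //= in_itv /=.
  have := nX e; rewrite Xe /= in_itv /= => /negP.
  rewrite negb_and -!leNgt => /orP[] h /andP[h1 h2]; [left|right]; exists e => //=;
    by apply/le_anti/andP.
have -> : \bigcup_e [set (ab e).1] `|` \bigcup_e [set (ab e).2] =
    \bigcup_(i in [set: B * bool])
       [set if i.2 then (ab i.1).1 else (ab i.1).2].
  apply/seteqP; split=> [t [[e _ /= ->]|[e _ /= ->]]|t [[e [|]] _ /= ->]].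
  - by exists (e, true).
  - by exists (e, false).
  - by left; exists e.
  - by right; exists e.
by apply: bigcup_countable => // i _; exact: countable1.
Qed.

Lemma partition_sub01 (X : B -> set R) e t : interval_partition X ->
  X e t -> t \in `[0, 1].
Proof.
move=> [_ _ cX] Xt; suff : [set` `[0 : R, 1]] t by [].
by rewrite -cX; exists e => //; exact: subset_closure.
Qed.

Definition full_orbit (y : int -> R) :=
  forall n : int, y (n + 1) = T (y n) /\ exists e, I e (y n).

(** An orbit breaks off in the future at a point outside all [I e], or in the past at a point
    outside all images. Both sets of points are countable, and so is the set of points led there in
    finitely many steps. *)
Lemma bad_countable :
  countable [set t | t \in `[0, 1] /\ ~ exists2 y, full_orbit y & y 0 = t].
Proof.
have [_ tI _] := pI; have [_ tT _] := pT.
(* [g] inverts [T] on the union of the images; elsewhere its values are junk. *)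
have /choice[g gP] : forall s, exists t,
    (exists e, (T @` I e) s) -> (exists e, I e t) /\ T t = s.
  move=> s; have [[e [t It <-]]|no] := pselect (exists e, (T @` I e) s).
    by exists t => _; split => //; exists e.
  by exists s.
have gT e t : I e t -> g (T t) = t.
  move=> It; have [|[e' Ie' Tg]] := gP (T t); first by exists e, t.
  have ee' : e = e' by apply: tT => //; exists (T t); split; [exists t|exists (g (T t))].
  by apply: (injT (e := e)) => //; rewrite ee'.
pose C1 := [set t | t \in `[0, 1] /\ forall e, ~ I e t].
pose C2 := [set t | t \in `[0, 1] /\ forall e, ~ (T @` I e) t].
apply: (@sub_countable _ _ _ (\bigcup_(i in [set: nat * bool])
  (if i.2 then iter i.1 g @` C1 else iter i.1 T @` C2))); last first.
  apply: bigcup_countable => // -[n [|]] _ /=.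
    apply: sub_countable (partition_compl_countable pI); exact: card_image_le.
  apply: sub_countable (partition_compl_countable pT); exact: card_image_le.
apply: subset_card_le => t [t01 nt]; apply: contrapT => nC; apply: nt.
have fwd n : (exists e, I e (iter n T t)) /\ iter n.+1 g (iter n.+1 T t) = t.
  elim: n => [|n [[e Ie] IH]].
    have [e Ie] : exists e, I e t.
      apply: contrapT => no; apply: nC; exists (0%N, true) => //=.
      by exists t => //; split=> // e Ie; apply: no; exists e.
    by split; [exists e|exact: gT Ie].
  have T01 : iter n.+1 T t \in `[0, 1].
    by apply: (partition_sub01 (e := e) pT); exists (iter n T t).
  have [e' Ie'] : exists e, I e (iter n.+1 T t).
    apply: contrapT => no; apply: nC; exists (n.+1, true) => //=.
    by exists (iter n.+1 T t) => //; split=> // e' Ie'; apply: no; exists e'.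
  split; first by exists e'.
  by rewrite iterSr [iter n.+2 T t]iterS (gT _ _ Ie').
have bwd n : (exists e, I e (iter n g t)) /\ T (iter n.+1 g t) = iter n g t /\
    (exists e, I e (iter n.+1 g t)) /\ iter n.+1 T (iter n.+1 g t) = t.
  elim: n => [|n [_ [_ [[e Ie] IH]]]].
    have [e Te] : exists e, (T @` I e) t.
      apply: contrapT => no; apply: nC; exists (0%N, false) => //=.
      by exists t => //; split=> // e Ie; apply: no; exists e.
    have [|Ig Tg] := gP t; first by exists e.
    by split; [have [] := fwd 0%N|].
  have g01 := partition_sub01 pI Ie.
  have [e' Te'] : exists e, (T @` I e) (iter n.+1 g t).
    apply: contrapT => no; apply: nC; exists (n.+1, false) => //=.
    by exists (iter n.+1 g t) => //; split=> // e' Ie'; apply: no; exists e'.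
  have [|Ig Tg] := gP (iter n.+1 g t); first by exists e'.
  split; first by exists e.
  by split=> //; split=> //; rewrite iterSr [iter n.+2 g t]iterS Tg.
exists (fun i : int => match i with Posz n => iter n T t
  | Negz n => iter n.+1 g t end) => //.
move=> [n|n].
  by rewrite -PoszD addn1; split => //; have [] := fwd n.
split; last by have [_ [_ []]] := bwd n.
case: n => [|n].
  by have [_ [Tg _]] := bwd 0%N; rewrite (_ : Negz 0 + 1 = 0).
rewrite (_ : Negz n.+1 + 1 = Negz n); last by rewrite !NegzE; lia.
by have [_ [Tg _]] := bwd n.+1; rewrite Tg.
Qed.

Lemma full_orbit_dense (U : set R) t : open U -> U `<=` [set` `[0, 1]] -> U t ->
  exists2 y, full_orbit y & U (y 0).
Proof.
move=> oU U01 Ut; have [e e0 eU] := itvoo_sub 0 oU Ut.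
have [|x xt nx] := itvoo_avoid _ bad_countable (a := t - e) (b := t + e).
  by lra.
have Ux := eU _ xt.
apply: contrapT => no; apply: nx; split; first exact: U01.
by move=> [y fy y0]; apply: no; exists y => //; rewrite y0.
Qed.

Lemma full_orbit_code y : full_orbit y -> exists x, trajectory I T y x.
Proof.
move=> fy; have /choice[x xP] : forall n, exists e, I e (y n).
  by move=> n; have [] := fy n.
by exists x => n; split; [have [] := fy n|].
Qed.

End Orbits.

(** * From affine interval exchanges to splittings *)

Section AffineMeasure.
Variable R : realType.
Implicit Types (a b l r : R).
Local Notation mu := (@lebesgue_measure R).

(** The bounds [l'], [r'] may come in the wrong order, which covers empty intersections. *)
Lemma affine_preimage_itvoo a b l r (al be : R) : al != 0 ->
  exists l' r', [set` `]a, b[] `&` (fun x => al * x + be) @^-1` [set` `]l, r[] =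
    [set` `]l', r'[].
Proof.
move=> al0; have [n0|p0] : al < 0 \/ 0 < al by apply/orP; rewrite -neq_lt.
  exists (Num.max a ((r - be) / al)), (Num.min b ((l - be) / al)).
  apply/seteqP; split => x /=; rewrite !in_itv /= gt_max lt_min
    ltr_ndivrMr // ltr_ndivlMr // [x * _]mulrC.
    by move=> [/andP[-> ->] /andP[h1 h2]]; apply/andP; split; lra.
  move=> /andP[/andP[-> h1] /andP[-> h2]]; split => //; apply/andP; split; lra.
exists (Num.max a ((l - be) / al)), (Num.min b ((r - be) / al)).
apply/seteqP; split => x /=; rewrite !in_itv /= gt_max lt_min
  ltr_pdivrMr // ltr_pdivlMr // [x * _]mulrC.
  by move=> [/andP[-> ->] /andP[h1 h2]]; apply/andP; split; lra.
move=> /andP[/andP[-> h1] /andP[-> h2]]; split => //; apply/andP; split; lra.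
Qed.

Lemma affine_image_itvoo l r (al be : R) : al != 0 ->
  (fun x => al * x + be) @` [set` `]l, r[] =
    if al < 0 then [set` `]al * r + be, al * l + be[]
    else [set` `]al * l + be, al * r + be[].
Proof.
move=> al0; have Ey y : al * ((y - be) / al) + be = y.
  by rewrite mulrC divfK // subrK.
case: ltP => [n0|]; last first.
  rewrite le_eqVlt eq_sym (negPf al0) /= => p0.
  apply/seteqP; split => [_ [x /= + <-]|y /=]; rewrite !in_itv /=.
    by move=> /andP[h1 h2]; rewrite !ltrD2r !ltr_pM2l // h1 h2.
  move=> /andP[h1 h2]; exists ((y - be) / al) => //=; rewrite in_itv /=.
  by rewrite ltr_pdivlMr // ltr_pdivrMr //; apply/andP; split; lra.
apply/seteqP; split => [_ [x /= + <-]|y /=]; rewrite !in_itv /=.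
  by move=> /andP[h1 h2]; rewrite !ltrD2r !ltr_nM2l // h1 h2.
move=> /andP[h1 h2]; exists ((y - be) / al) => //=; rewrite in_itv /=.
by rewrite ltr_ndivlMr // ltr_ndivrMr //; apply/andP; split; lra.
Qed.

Lemma measure_affine_image l r (al be : R) : al != 0 ->
  mu ((fun x => al * x + be) @` [set` `]l, r[]) = (`|al|%:E * mu [set` `]l, r[])%E.
Proof.
move=> al0; rewrite affine_image_itvoo //; case: ltP => [n0|].
  rewrite !lebesgue_measure_itv /= !lte_fin ltrD2r ltr_nM2l //.
  case: ifP => _; last by rewrite mule0.
  by rewrite -!EFinB -EFinM ltr0_norm //; congr EFin; lra.
rewrite le_eqVlt eq_sym (negPf al0) /= => p0.
rewrite !lebesgue_measure_itv /= !lte_fin ltrD2r ltr_pM2l //.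
case: ifP => _; last by rewrite mule0.
by rewrite -!EFinB -EFinM gtr0_norm //; congr EFin; lra.
Qed.

Lemma measure_countable_cover (B : finType) (Y : set R) (X : B -> set R) :
  measurable Y -> (forall c, measurable (X c)) -> (forall c, X c `<=` Y) ->
  trivIset setT X -> countable (Y `\` \bigcup_c X c) ->
  mu Y = (\sum_c mu (X c))%E.
Proof.
move=> mY mX XY tX cYX.
have mU : measurable (\bigcup_(c in [set: B]) X c).
  by apply: fin_bigcup_measurable => //; exact: finite_finset.
rewrite (measureDI mu mY mU) [X in (X + _)%E](_ : _ = 0%E) ?add0e; last first.
  exact: countable_lebesgue_measure0 cYX.
rewrite setIidr; last by move=> t [c _ /XY].
have fB : finite_set [set: B] by exact: finite_finset.
have mX' c : [set: B] c -> measurable (X c) by [].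
rewrite (measure_fin_bigcup mu fB tX mX').
rewrite (@fsbigE _ _ _ _ _ (index_enum B)) ?index_enum_uniq //; last first.
  by move=> c _; rewrite mem_index_enum.
by apply: eq_bigl => c; apply/mem_set.
Qed.

End AffineMeasure.

(** * Lengths of the cylinders of an affine exchange *)

Section CodingLanguage.
Variables (R : realType) (E : finType) (I : E -> set R) (T : R -> R).
Variable G : {set E}.
Hypothesis aT : flipped_affine_iet G I T.
Local Notation mu := (@lebesgue_measure R).

Definition coding_language : set (seq E) :=
  [set w | exists (y : int -> R) (x : int -> E) (i : int) (n : nat),
    trajectory I T y x /\ w = factor_at x i n].

Let pI : interval_partition I. Proof. by have [[]] := aT. Qed.
Let pT : interval_partition (fun e => T @` I e). Proof. by have [[]] := aT. Qed.
Let cT e : {within I e, continuous T}. Proof. by have [[]] := aT. Qed.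
Let mT e : flip_monotone (e \in G) (I e) T. Proof. by have [[]] := aT. Qed.
Let tI : trivIset setT I. Proof. by have [] := pI. Qed.
Let tT : trivIset setT (fun e => T @` I e). Proof. by have [] := pT. Qed.

Lemma iet_injective e s t : I e s -> I e t -> T s = T t -> s = t.
Proof. exact: (flip_monotone_inj (F := G) mT). Qed.

Lemma open_interval_open (X : set R) : open_interval X -> open X.
Proof. by move=> [a [b [_ ->]]]; exact: itv_open. Qed.

Lemma open_interval_nonempty (X : set R) : open_interval X -> exists t, X t.
Proof.
move=> [a [b [ab ->]]]; exists ((a + b) / 2) => /=; rewrite in_itv /=.
by apply/andP; split; lra.
Qed.

Lemma open_interval_is_interval (X : set R) : open_interval X -> is_interval X.
Proof. by move=> [a [b [_ ->]]]; exact: interval_is_interval. Qed.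

Lemma iet_open e : open (I e).
Proof. by apply: open_interval_open; have [] := pI. Qed.

Lemma full_orbit_in e (U : set R) t : open U -> U `<=` I e -> U t ->
  exists y x, trajectory I T y x /\ U (y 0).
Proof.
move=> oU UI Ut; have U01 : U `<=` [set` `[0, 1]].
  by move=> s /UI Is; exact: partition_sub01 pI Is.
have [y fy Uy] := full_orbit_dense pI pT iet_injective oU U01 Ut.
by have [x tx] := full_orbit_code fy; exists y, x.
Qed.

(** Any point will do, even one whose orbit breaks off later: the cylinder is open, so it also
    contains a point with a full orbit. *)
Lemma cyl_coding w t : w != [::] -> cyl I T w t -> coding_language w.
Proof.
case: w => // a w _ cw.
have [||y [x [tr Uy]]] := @full_orbit_in a (cyl I T (a :: w)) t _ _ cw.
- by apply: cyl_open => //; exact: iet_open.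
- by move=> s [].
by exists y, x, 0, (size (a :: w)); split=> //; exact: cyl_trajectory_eq Uy.
Qed.

Lemma coding_cyl w : coding_language w -> exists t, cyl I T w t.
Proof. by move=> [y [x [i [n [tr ->]]]]]; exists (y i); exact: trajectory_cyl. Qed.

Lemma coding_is_language : is_language coding_language.
Proof.
have iet_pt e : exists t, I e t.
  by apply: open_interval_nonempty; have [] := pI.
split.
- have [e _] : (\bigcup_e closure (I e)) 0.
    by have [_ _ ->] := pI; rewrite /= in_itv /= lexx ler01.
  move=> _; have [t It] := iet_pt e.
  have [y [x [tr _]]] := full_orbit_in (@iet_open e) (@subset_refl _ _) It.
  by exists y, x, 0, 0%N.
- move=> v w /infixP[p [s ->]] [y [x [i [n [tr e]]]]].
  exists y, x, (i + (size p)%:Z), (size v); split=> //.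
  have sn : (size p + (size v + size s))%N = n.
    by have := congr1 size e; rewrite size_factor_at !size_cat.
  move: e; rewrite -sn !factor_atD => /eqP.
  rewrite eqseq_cat ?size_factor_at // => /andP[_].
  by rewrite eqseq_cat ?size_factor_at // => /andP[/eqP].
- move=> v [y [x [i [n [tr ->]]]]]; exists (x (i - 1)), (x (i + n%:Z)); split.
    by exists y, x, (i - 1), n.+1; rewrite factor_atS subrK.
  by exists y, x, i, n.+1; rewrite factor_atSr.
- by move=> a; have [t It] := iet_pt a; apply: (@cyl_coding _ t).
Qed.

Lemma iet_slopes : exists al be : E -> R, (forall e, al e != 0) /\
  forall e t, I e t -> T t = al e * t + be e.
Proof.
have [_ af] := aT; have /choice[al /choice[be Tab]] := af.
exists al, be; split => // e; apply/eqP => al0.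
have [oI _ _] := pI; have [a [b [ab Ie]]] := oI e.
have I1 : I e ((2 * a + b) / 3) by rewrite Ie /= in_itv /=; apply/andP; split; lra.
have I2 : I e ((a + 2 * b) / 3) by rewrite Ie /= in_itv /=; apply/andP; split; lra.
have := iet_injective I1 I2; rewrite !(Tab e) // al0 !mul0r => /(_ erefl); lra.
Qed.

Lemma cyl_cons_itv u a : exists l r, cyl I T (a :: u) = [set` `]l, r[].
Proof.
have [al [be [al0 Tab]]] := iet_slopes.
have [oI _ _] := pI.
elim: u a => [|b u IH] a; have [l [r [lr Ie]]] := oI a.
  by exists l, r; rewrite /= preimage_setT setIT.
have [l' [r' e']] := IH b.
have [l2 [r2 e2]] := affine_preimage_itvoo l r l' r' (be a) (al0 a).
exists l2, r2; rewrite -e2 -Ie -e'; apply/seteqP; split=> t [It].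
  rewrite -[(T @^-1` _) t]/(cyl I T (b :: u) (T t)) (Tab a t It) => h.
  by split.
move=> h; split => //.
by rewrite -[(T @^-1` _) t]/(cyl I T (b :: u) (T t)) (Tab a t It).
Qed.

(** The intersection matters for the empty word, whose cylinder is the whole line. *)
Definition cyl_length u : R := fine (mu ([set` `[0 : R, 1]] `&` cyl I T u)).

Lemma measurable_cyl01 u : measurable ([set` `[0 : R, 1]] `&` cyl I T u).
Proof.
apply: measurableI; first exact: measurable_itv.
by apply: open_measurable; apply: (@cyl_open _ _ I T u (@iet_open) cT).
Qed.

Lemma cyl_lengthE u : mu ([set` `[0 : R, 1]] `&` cyl I T u) = (cyl_length u)%:E.
Proof.
rewrite fineK // ge0_fin_numE ?measure_ge0 //.
apply: (@le_lt_trans _ _ (mu [set` `[0 : R, 1]])).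
  by apply: le_measure; rewrite ?inE //; exact: measurable_cyl01.
by rewrite lebesgue_measure_itv /= lte_fin ltr01 -EFinB ltry.
Qed.

Lemma cyl01_cons a u :
  [set` `[0 : R, 1]] `&` cyl I T (a :: u) = cyl I T (a :: u).
Proof. by apply/setIidr => t [It _]; exact: partition_sub01 pI It. Qed.

Lemma full_orbit_iter y n : full_orbit I T y -> y n%:Z = iter n T (y 0).
Proof.
by move=> fy; elim: n => //= n <-; rewrite -addn1 PoszD; have [] := fy n%:Z.
Qed.

(** Right additivity: a point of the cylinder of [u] that lies in no longer cylinder has no full
    orbit. Conformality: up to countably many points, the images of the intervals [I a] cut the
    cylinder of [u] into the affine images of the cylinders of the words [a :: u]. *)
Lemma cyl_length_conformal : exists theta, conformal_mass theta cyl_length.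
Proof.
have [al [be [al0 Tab]]] := iet_slopes.
exists (fun e => ln `|al e|); split.
- by move=> u; rewrite fine_ge0 // measure_ge0.
- move=> u; apply: EFin_inj; rewrite -sumEFin -cyl_lengthE.
  under eq_bigr do rewrite -cyl_lengthE.
  apply: measure_countable_cover.
  + exact: measurable_cyl01.
  + by move=> c; exact: measurable_cyl01.
  + by move=> c t [t01 /cyl_rcons[]].
  + move=> c c' _ _ [t [[_ /cyl_rcons[_ h]] [_ /cyl_rcons[_ h']]]].
    by apply: tI => //; exists (iter (size u) T t).
  + apply: sub_countable (bad_countable pI pT iet_injective).
    apply: subset_card_le => t [[t01 ut] nt]; split => // -[y fy y0].
    apply: nt; have [_ [e Ie]] := fy (size u)%:Z.
    exists e => //; split=> //; apply/cyl_rcons; split => //.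
    by rewrite -y0 -full_orbit_iter.
- move=> u; apply: EFin_inj; rewrite -sumEFin -cyl_lengthE.
  have oTI a : open (T @` I a) by apply: open_interval_open; have [] := pT.
  have mcu : measurable (cyl I T u).
    by apply: open_measurable; apply: (@cyl_open _ _ I T u (@iet_open) cT).
  rewrite (@measure_countable_cover _ _ _ (fun a => T @` I a `&` cyl I T u)).
  + apply: eq_bigr => a _; rewrite EFinM lnK; last by rewrite posrE normr_gt0.
    rewrite -cyl_lengthE cyl01_cons; have [l [r lr]] := cyl_cons_itv u a.
    rewrite lr -(measure_affine_image l r (be a) (al0 a)) -lr.
    congr (mu _); apply/seteqP; split => [_ [[t It <-] ut]|_ [t [It ut] <-]].
      by exists t => //; rewrite (Tab a).
    by rewrite -(Tab a) //; split => //; exists t.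
  + exact: measurable_cyl01.
  + by move=> a; apply: measurableI => //; exact: open_measurable.
  + move=> a t [Tt ut]; split => //; exact: (partition_sub01 (e := a) pT).
  + by move=> a a' _ _ [t [[h _] [h' _]]]; apply: tT => //; exists t.
  + apply: sub_countable (partition_compl_countable pT).
    apply: subset_card_le => t [[t01 ut] nt]; split => // a Ta.
    by apply: nt; exists a.
- apply: EFin_inj; rewrite -cyl_lengthE setIT lebesgue_measure_itv /=.
  by rewrite lte_fin ltr01 sube0.
Qed.

Lemma coding_cyl_length u : coding_language u <-> 0 < cyl_length u.
Proof.
rewrite -lte_fin -cyl_lengthE; case: u => [|a u].
  split=> _; last by have [] := coding_is_language.
  by rewrite setIT lebesgue_measure_itv /= lte_fin ltr01 sube0 lte_fin ltr01.
rewrite cyl01_cons; split.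
  move=> /coding_cyl[t]; have [l [r ->]] := cyl_cons_itv u a.
  rewrite /= in_itv /= => /andP[lt tr]; have lr := lt_trans lt tr.
  by rewrite lebesgue_measure_itv /= lte_fin lr -EFinB lte_fin subr_gt0.
have [[t]|no] := pselect (exists t, cyl I T (a :: u) t).
  by move=> /cyl_coding h _; apply: h.
rewrite (_ : cyl I T (a :: u) = set0) ?measure0 ?ltxx //.
by apply/seteqP; split => // t h; apply: no; exists t.
Qed.

End CodingLanguage.

Section SplitAlphabet.
Variables (A B : finType) (g : B -> A).

Definition fibre_size (e : A) : nat := #|[set b | g b == e]%SET|.

(** Splittings live on pairs of a letter and an index, whereas defining intervals carry an arbitrary
    finite index type [B]; this bijection relabels [B] along the fibres of [g]. *)
Definition split_to (x : split_alphabet fibre_size) : B :=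
  enum_val (A := [set b | g b == tag x]%SET) (tagged x).

Lemma split_toE x : g (split_to x) = split_letter x.
Proof. by have := enum_valP (tagged x); rewrite inE => /eqP. Qed.

Lemma split_to_inj : injective split_to.
Proof.
move=> x y h; have txy : tag x = tag y.
  by rewrite -[tag x]/(split_letter x) -split_toE h split_toE.
case: x y h txy => e i [e' i'] /= h ee'; case: _ / ee' i' h => i' h.
by congr existT; exact: enum_val_inj h.
Qed.

Lemma split_to_surj b : exists x, split_to x = b.
Proof.
have bg : b \in [set b' | g b' == g b]%SET by rewrite inE.
exists (existT (fun e => 'I_(fibre_size e)) (g b) (enum_rank_in bg b)).
by rewrite /split_to /= enum_rankK_in.
Qed.

Lemma interval_partition_split (R : realType) (I : B -> set R) :
  interval_partition I -> interval_partition (I \o split_to).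
Proof.
move=> [oI tI cI]; split.
- by move=> x; exact: oI.
- by move=> x y _ _ h; apply: split_to_inj; apply: tI.
- rewrite -cI; apply/seteqP; split=> [t [x _ h]|t [b _ h]].
    by exists (split_to x).
  by have [x xb] := split_to_surj b; exists x => //=; rewrite xb.
Qed.

End SplitAlphabet.

(** * Orders and splitting read off a grouped coding *)

Section GroupedCoding.
Variables (R : realType) (A : finType) (F : {set A}) (k : A -> nat).
Local Notation X := (split_alphabet k).
Variables (I : X -> set R) (T S : R -> R) (G : {set X}) (J : A -> set R).
Variable L : set (seq A).
Hypothesis aT : flipped_affine_iet G I T.
Hypotheses (oJ : forall e, open_interval (J e)) (tJ : trivIset setT J)
  (IJ : forall x : X, I x `<=` J (split_letter x))
  (JI : forall e t, J e t -> exists2 x : X, split_letter x = e & closure (I x) t)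
  (ST : forall x t, I x t -> S t = T t)
  (cS : forall e, {within J e, continuous S})
  (mS : forall e, flip_monotone (e \in F) (J e) S)
  (LE : L = coding_language J S).

Let pI : interval_partition I. Proof. by have [[]] := aT. Qed.
Let pT : interval_partition (fun e => T @` I e). Proof. by have [[]] := aT. Qed.
Let tT : trivIset setT (fun e => T @` I e). Proof. by have [] := pT. Qed.
Let iJ e : is_interval (J e). Proof. exact: open_interval_is_interval. Qed.

Let iSJ e : is_interval (S @` J e).
Proof.
apply/connected_intervalP/connected_continuous_connected => //.
exact/connected_intervalP.
Qed.

Let J01 e t : J e t -> t \in `[0, 1].
Proof.
move=> /JI[x _ It]; suff : [set` `[0 : R, 1]] t by [].
by have [_ _ <-] := pI; exists x.
Qed.

Lemma coding_interval_image_nbhs e t : J e t ->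
  exists l r, l < S t < r /\ forall s, l < s < r -> (S @` J e) s.
Proof.
move=> Jt; have [a [b [ab Je]]] := oJ e.
have /andP[at_ tb] : a < t < b by move: Jt; rewrite Je /= in_itv.
have J1 : J e ((a + t) / 2) by rewrite Je /= in_itv /=; apply/andP; split; lra.
have J2 : J e ((t + b) / 2) by rewrite Je /= in_itv /=; apply/andP; split; lra.
have lt1 : (a + t) / 2 < t by lra.
have lt2 : t < (t + b) / 2 by lra.
have S1 : (S @` J e) (S ((a + t) / 2)) by exists ((a + t) / 2).
have S2 : (S @` J e) (S ((t + b) / 2)) by exists ((t + b) / 2).
have := mS J1 Jt lt1; have := mS Jt J2 lt2; case: ifP => _ h2 h1.
  exists (S ((t + b) / 2)), (S ((a + t) / 2)); rewrite h2 h1; split => //.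
  by move=> s /andP[s1 s2]; apply: (iSJ S2 S1); rewrite !ltW.
exists (S ((a + t) / 2)), (S ((t + b) / 2)); rewrite h2 h1; split => //.
by move=> s /andP[s1 s2]; apply: (iSJ S1 S2); rewrite !ltW.
Qed.

(** Two images that meet share a nonempty open interval. Outside the countable set [C], its points
    are values of [T] on defining intervals of both letters, and the images of the defining
    intervals are disjoint. *)
Lemma coding_image_trivIset : trivIset setT (fun e => S @` J e).
Proof.
move=> e e' _ _ [s [[t Jt ts] [t' Jt' ts']]].
have [l [r [/andP[l1 r1] h]]] := coding_interval_image_nbhs Jt.
have [l' [r' [/andP[l2 r2] h']]] := coding_interval_image_nbhs Jt'.
rewrite {}ts in l1 r1; rewrite {}ts' in l2 r2.
pose C := S @` [set u | u \in `[0, 1] /\ forall x, ~ I x u].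
have cC : countable C.
  by apply: sub_countable (partition_compl_countable pI); exact: card_image_le.
have [|u] := @itvoo_avoid _ (Num.max l l') (Num.min r r') C _ cC.
  by rewrite gt_max !lt_min (lt_trans l1 r1) (lt_trans l1 r2) (lt_trans l2 r1)
    (lt_trans l2 r2).
rewrite /= in_itv /= gt_max lt_min => /andP[/andP[lu l'u] /andP[ur ur']] nC.
have hI f v : J f v -> S v = u -> exists2 x, split_letter x = f & (T @` I x) u.
  move=> Jv Sv; have [[x Ix]|no] := pselect (exists x, I x v); last first.
    exfalso; apply: nC; exists v => //; split; first exact: J01 Jv.
    by move=> x Ix; apply: no; exists x.
  exists x; last by exists v => //; rewrite -(ST Ix).
  by apply: tJ => //; exists v; split => //; exact: IJ.
have [|v Jv Sv] := h u; first by rewrite lu ur.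
have [|v' Jv' Sv'] := h' u; first by rewrite l'u ur'.
have [x <- Tx] := hI _ _ Jv Sv; have [x' <- Tx'] := hI _ _ Jv' Sv'.
by congr split_letter; apply: tT => //; exists u.
Qed.

Lemma flip_monotone_split (x : X) :
  flip_monotone (x \in [set x : X | split_letter x \in F]%SET) (I x) T.
Proof.
move=> s t Is It st; rewrite inE -!(@ST x) //.
by apply: (mS (e := split_letter x)) => //; exact: IJ.
Qed.

(** A trajectory of [S] may pass through endpoints of the [I x], where it has no coding by defining
    intervals. The cylinder for [S] of a word read on it is open, and a full orbit of [T] starting
    there spells the same word. *)
Lemma split_language_image :
  L = [set map (@split_letter A k) v | v in coding_language I T].
Proof.
apply/seteqP; split.
  move=> w; rewrite LE => -[y [x [i [n [tr ->]]]]].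
  case: n => [|n].
    by exists [::] => //; have [] := coding_is_language aT.
  have cw := trajectory_cyl i n.+1 tr; set w' := factor_at x i n.+1 in cw *.
  have oc : open (cyl J S w') by apply: cyl_open => // e; exact: open_interval_open.
  have c01 : cyl J S w' `<=` [set` `[0, 1]].
    by move=> s; rewrite /w' factor_atS => -[/J01].
  have [y' fy Uy] := full_orbit_dense pI pT (iet_injective aT) oc c01 cw.
  have [x' tr'] := full_orbit_code fy.
  have trS : trajectory J S y' (@split_letter A k \o x').
    move=> j; have [yS Ix] := tr' j; split; first by rewrite (ST Ix).
    exact: IJ.
  rewrite (cyl_trajectory_eq tJ trS Uy); exists (factor_at x' 0 (size w')).
    by exists y', x', 0, (size w').
  by rewrite /factor_at /mkseq -map_comp.
move=> _ [_ [y [x [i [n [tr ->]]]]] <-]; rewrite LE.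
exists y, (@split_letter A k \o x), i, n; split; last first.
  by rewrite /factor_at /mkseq -map_comp.
move=> j; have [yS Ix] := tr j; split; first by rewrite (ST Ix).
exact: IJ.
Qed.

(** The orders are those of the line: [<_D] on the intervals, [<_A] on their images, for [L] and for
    the splitting alike. Fibres are consecutive because [J e] and its image are convex, and the
    monotonicity of [S] on [J e] compares the two orders within a fibre. *)
Lemma grouped_coding_splitting : is_language L ->
  exists ltA ltD : rel A, flipped_order_condition F L ltA ltD /\
    is_splitting F L ltA ltD (coding_language I T).
Proof.
move=> lL; have tSJ := coding_image_trivIset.
have [oI tI _] := pI; have [oT _ _] := pT.
have /choice[p Jp] e : exists t, J e t by exact: open_interval_nonempty.
have Sq e : (S @` J e) (S (p e)) by exists (p e).
have /choice[p' Ip'] x : exists t, I x t by exact: open_interval_nonempty.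
have Tq x : (T @` I x) (T (p' x)) by exists (p' x).
have iI x : is_interval (I x) by exact: open_interval_is_interval.
have iT x : is_interval (T @` I x) by exact: open_interval_is_interval.
have TJ x t : (T @` I x) t -> (S @` J (split_letter x)) t.
  by move=> [s Is <-]; exists s; [exact: IJ|exact: (@ST x)].
exists (fun x y => S (p x) < S (p y)), (fun x y => p x < p y); split.
  apply: (@coding_order_condition _ _ J S F mS L p (S \o p)) => //.
  by move=> w; rewrite LE => -[y [x [i [n [tr ->]]]]]; exists (y i);
    exact: trajectory_cyl.
split; [exact: (coding_is_language aT)|exact: split_language_image|].
exists (fun x y => T (p' x) < T (p' y)), (fun x y => p' x < p' y); split.
- apply: (coding_order_condition flip_monotone_split iI tI Ip' iT tT Tq).
  exact: coding_cyl.
- split=> x y z xz xy yz; apply: tSJ => //.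
    exists (T (p' y)); split; first exact: TJ.
    apply: (iSJ (TJ x _ (Tq x)) _ (z := T (p' y))).
      by rewrite xz; exact: TJ.
    by rewrite !ltW.
  exists (S (p' y)); split; first by exists (p' y) => //; exact: IJ.
  exists (p' y) => //; apply: (iJ (IJ (Ip' x)) _ (z := p' y)).
    by rewrite xz; exact: IJ.
  by rewrite !ltW.
- move=> x y xy xF; rewrite -!(ST (Ip' _)).
  have Jx := IJ (Ip' x); have Jy := IJ (Ip' y); rewrite -xy in Jy.
  have [pxy|pyx|->] := ltgtP (p' x) (p' y); last by rewrite ltxx.
    by have := mS Jx Jy pxy; rewrite (negPf xF).
  by have := mS Jy Jx pyx; rewrite (negPf xF) => h; rewrite ltNge ltW.
- move=> x y xy xF; rewrite -!(ST (Ip' _)).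
  have Jx := IJ (Ip' x); have Jy := IJ (Ip' y); rewrite -xy in Jy.
  have [pxy|pyx|->] := ltgtP (p' x) (p' y); last by rewrite ltxx.
    by have := mS Jx Jy pxy; rewrite xF => h; rewrite ltNge ltW.
  by have := mS Jy Jx pyx; rewrite xF.
- move=> x y xy; split.
    by rewrite -(disjoint_itv_lt iSJ tSJ Sq xy (TJ _ _ (Tq x)) (TJ _ _ (Tq y))).
  by rewrite -(disjoint_itv_lt iJ tJ Jp xy (IJ (Ip' x)) (IJ (Ip' y))).
Qed.

End GroupedCoding.

Lemma grouped_coding_necessary (R : realType) (A : finType) (L : set (seq A))
    (F : {set A}) (B : finType) (G : {set B}) (I : B -> set R) (T : R -> R) :
  is_language L -> flipped_affine_iet G I T -> flipped_grouped_coding F L I T ->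
  exists ltA ltD : rel A, flipped_order_condition F L ltA ltD /\
    exists (k : A -> nat) (L' : set (seq (split_alphabet k))),
      is_splitting F L ltA ltD L' /\
      exists theta : split_alphabet k -> R,
        forall z : int -> split_alphabet k, bi_infinite L' z -> ~ recurrent z ->
          (\sum_(0 <= n <oo)
             (expR (\sum_(0 <= j < n.+1) theta (z j%:Z)))%:E < +oo)%E /\
          (\sum_(1 <= n <oo)
             (expR (- \sum_(1 <= j < n.+1) theta (z (- j%:Z))))%:E < +oo)%E.
Proof.
move=> lL [[pI cT mT pT] aff] [J [g [S [[oJ tJ] IJ JI [ST cS mS] LE]]]].
pose I' := I \o split_to (g := g).
pose G' : {set split_alphabet (fibre_size g)} := [set x | split_to x \in G]%SET.
have aT : flipped_affine_iet G' I' T.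
  split; last by move=> x; exact: aff.
  split; [exact: interval_partition_split|by move=> x; exact: cT| |].
    by move=> x; rewrite inE; exact: mT.
  exact: (interval_partition_split g pT).
have IJ' x : I' x `<=` J (split_letter x).
  by move=> t It; apply: IJ; exists (split_to x) => //=; exact: split_toE.
have JI' e t : J e t -> exists2 x : split_alphabet (fibre_size g),
    split_letter x = e & closure (I' x) t.
  move=> /JI[b /= be clb]; have [x xb] := split_to_surj g b.
  by exists x; [rewrite -split_toE xb|rewrite /I' /= xb].
have ST' x t : I' x t -> S t = T t by exact: ST.
have [ltA [ltD [oc sp]]] :=
  grouped_coding_splitting aT oJ tJ IJ' JI' ST' cS mS LE lL.
exists ltA, ltD; split=> //; exists (fibre_size g), (coding_language I' T).
split => //; have [theta cm] := cyl_length_conformal aT.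
exists theta => z zL nr; have [[_ fL _ _] _ [hA [hD [oc' _ _ _ _]]]] := sp.
apply: (nonrecurrent_series cm fL _ (coding_cyl_length aT) zL nr).
exact: order_condition_crossing_free oc'.
Qed.

(** * Compactness of a language *)

Section UltraLimits.
Variable U : set_system nat.
Hypotheses (UU : UltraFilter U) (Uoo : \oo `<=` U).

Let PU : ProperFilter U := @ultra_proper _ _ UU.

Lemma ultra_finite (E : finType) (f : nat -> E) : exists a, U [set n | f n = a].
Proof.
apply: contrapT => no.
have : \forall n \near U, forall a, f n <> a.
  apply: (@filter_forall _ _ (fun a n => f n <> a)) => a.
  by have [Ua|//] := in_ultra_setVsetC [set n | f n = a] UU; case: no; exists a.
by move=> /filter_ex[n] /(_ (f n)).
Qed.

Lemma ultra_cvg (R : realType) (f : nat -> R) (C : R) :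
  (forall n, `|f n| <= C) -> cvg (f @ U).
Proof.
move=> fC.
have fU : UltraFilter (f @ U).
  constructor; first exact: fmap_proper_filter.
  move=> G PG sub; apply/seteqP; split=> // A GA.
  have [//|UA] := in_ultra_setVsetC (f @^-1` A) UU.
  have GnA : G (~` A) by apply: sub.
  have : G (A `&` ~` A) by exact: filterI.
  by move=> /filter_ex[x []].
have := @segment_compact R (- C) C; rewrite compact_ultra => /(_ (f @ U) fU) [].
  apply: (@filterS _ U _ setT) filterT => n _ /=.
  by rewrite in_itv /= -ler_norml.
by move=> l [_ fl]; apply/cvg_ex; exists l.
Qed.

End UltraLimits.

Lemma free_ultrafilter : exists U : set_system nat, UltraFilter U /\ \oo `<=` U.
Proof. exact: ultraFilterLemma. Qed.

(** Each coordinate has a limit along a free ultrafilter. A window involves finitely many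
    coordinates, so it agrees with the limit on a set of [n] in the ultrafilter, which is
    unbounded. *)
Lemma int_sequence_compact (E : finType) (x_ : nat -> int -> E) :
  exists x : int -> E, forall m N : nat, exists2 n, (N <= n)%N &
    forall i : int, (absz i <= m)%N -> x_ n i = x i.
Proof.
have [U [UU Uoo]] := free_ultrafilter; have PU := @ultra_proper _ _ UU.
have /choice[x xP] : forall i, exists a, U [set n | x_ n i = a].
  by move=> i; exact: ultra_finite.
exists x => m N.
have : \forall n \near U, (N <= n)%N /\
    forall k : 'I_(2 * m).+1, x_ n (k%:Z - m%:Z) = x (k%:Z - m%:Z).
  apply: filterI; first by apply: Uoo; exact: nbhs_infty_ge.
  by apply: (@filter_forall _ _ (fun (k : 'I_(2 * m).+1) n =>
    x_ n (k%:Z - m%:Z) = x (k%:Z - m%:Z))) => k; exact: xP.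
move=> /filter_ex[n [Nn nx]]; exists n => // i im.
have ki : (absz (i + m%:Z)%R < (2 * m).+1)%N by lia.
have := nx (Ordinal ki); rewrite /= (_ : (absz (i + m%:Z)%R)%:Z - m%:Z = i) //.
lia.
Qed.

Section InvariantMean.
Variable R : realType.
Implicit Types f g : int -> R.

Definition bounded_seq f := exists C : R, forall i, `|f i| <= C.

(** A Banach limit: Cesaro averages over nonnegative positions, taken to the limit along a free
    ultrafilter. The shift changes the [n]-th average by [(f (n + 1) - f 0) / (n + 1)], which tends
    to 0. *)
Lemma invariant_mean : exists mean : (int -> R) -> R,
  [/\ forall f g, bounded_seq f -> bounded_seq g ->
        mean (fun i => f i + g i) = mean f + mean g,
      forall f, bounded_seq f -> (forall i, 0 <= f i) -> 0 <= mean f,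
      mean (fun=> 1) = 1
    & forall f, bounded_seq f -> mean (fun i => f (i + 1)) = mean f].
Proof.
have [U [UU Uoo]] := free_ultrafilter; have PU := @ultra_proper _ _ UU.
pose avg f n := (\sum_(j < n.+1) f j%:Z) / n.+1%:R.
have avgC f (C : R) : (forall i, `|f i| <= C) -> forall n, `|avg f n| <= C.
  move=> fC n; rewrite normrM normfV normr_nat ler_pdivrMr ?ltr0n //.
  rewrite (le_trans (ler_norm_sum _ _ _)) //.
  apply: (@le_trans _ _ (\sum_(j < n.+1) C)); first by apply: ler_sum.
  by rewrite sumr_const card_ord mulr_natr.
have cv f : bounded_seq f -> cvg (avg f @ U).
  by move=> [C /avgC]; apply: ultra_cvg.
exists (fun f => lim (avg f @ U)); split.
- move=> f g bf bg; apply: cvg_lim => //.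
  rewrite (_ : avg _ = (fun n => avg f n + avg g n)).
    by apply: cvgD; exact: cv.
  by apply/funext => n; rewrite /avg big_split mulrDl.
- move=> f bf f0; apply: limr_ge; first exact: cv.
  by apply: (@filterS _ U _ setT) filterT => n _; rewrite divr_ge0 // sumr_ge0.
- rewrite (_ : avg _ = fun=> 1); first by apply: cvg_lim => //; exact: cvg_cst.
  by apply/funext => n; rewrite /avg sumr_const card_ord divff // pnatr_eq0.
- move=> f bf; have [C fC] := bf.
  have d0 : (fun n => (f n.+1%:Z - f 0) / n.+1%:R) @ U --> (0 : R).
    apply: (@cvg_trans _ ((fun n => (f n.+1%:Z - f 0) / n.+1%:R) @ \oo)).
      by move=> A; exact: Uoo.
    apply/cvgr0Pnorm_lt => e e0.
    have := @cvg_harmonic R; move=> /cvgr0Pnorm_lt.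
    have C0 : 0 <= C := le_trans (normr_ge0 _) (fC 0).
    (* [2 * C] bounds the numerator; adding 1 keeps the divisor positive when [C] is 0. *)
    move=> /(_ (e / (2 * C + 1))) h; have {}h := h (divr_gt0 e0 _).
    near=> n; rewrite normrM.
    have : `|@harmonic R n| < e / (2 * C + 1).
      by near: n; apply: h; lra.
    rewrite /harmonic /= => hn.
    apply: (@le_lt_trans _ _ (2 * C * `|n.+1%:R^-1|)).
      rewrite ler_wpM2r // (le_trans (ler_normB _ _)) //.
      by rewrite mulr_natl mulr2n lerD.
    apply: (@le_lt_trans _ _ ((2 * C + 1) * `|n.+1%:R^-1|)).
      by rewrite ler_wpM2r //; lra.
    by rewrite mulrC -ltr_pdivlMr //; lra.
  apply: cvg_lim => //.
  rewrite (_ : avg _ = (fun n => avg f n + (f n.+1%:Z - f 0) / n.+1%:R)).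
    by rewrite -[X in _ --> X]addr0; apply: cvgD => //; exact: cv.
  apply/funext => n; rewrite /avg -mulrDl; congr (_ / _).
  have e : \sum_(i < n) f (i%:Z + 1) = \sum_(i < n) f (lift ord0 i : nat)%:Z.
    by apply: eq_bigr => i _; congr f; rewrite /= /bump; lia.
  rewrite big_ord_recr [in RHS]big_ord_recl e /=.
  rewrite (_ : n%:Z + 1 = n.+1%:Z); last by lia.
  by ring.
Unshelve. all: by end_near. Qed.

End InvariantMean.

(** * Words that occur in non recurrent sequences *)

Section LanguageCompactness.
Variables (E : finType) (L : set (seq E)).
Hypothesis lL : is_language L.

Let fL : factorial_lang L. Proof. by have [] := lL. Qed.

Lemma extend_right w n : L w -> exists2 q, size q = n & L (w ++ q).
Proof.
have [_ _ ext _] := lL; elim: n w => [|n IH] w Lw.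
  by exists [::]; rewrite // cats0.
have [_ [b [_ /IH[q sq Lq]]]] := ext w Lw.
by exists (b :: q); rewrite /= ?sq // -cat_rcons.
Qed.

Lemma extend_left w n : L w -> exists2 p, size p = n & L (p ++ w).
Proof.
have [_ _ ext _] := lL; elim: n w => [|n IH] w Lw; first by exists [::].
have [a [_ [/IH[p sp Lp] _]]] := ext w Lw.
by exists (rcons p a); rewrite ?size_rcons ?sp // cat_rcons.
Qed.

(* The word [w] placed on the integers so that position [0] is that of its
   letter of index [o]; the values outside [w] are junk. *)
Definition place (w : seq E) (o : nat) (a : E) : int -> E :=
  fun i => nth a w (absz (i + o%:Z)).

Lemma factor_place w o a (i : int) n : 0 <= i + o%:Z ->
  (absz (i + o%:Z)%R + n <= size w)%N ->
  factor_at (place w o a) i n = take n (drop (absz (i + o%:Z)%R) w).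
Proof.
move=> io sz; apply: (@eq_from_nth _ a).
  by rewrite size_factor_at size_takel // size_drop; lia.
move=> k; rewrite size_factor_at => kn.
rewrite nth_factor_at // nth_take // nth_drop /place; congr nth; lia.
Qed.

Lemma bi_infinite_limit (x_ : nat -> int -> E) :
  (forall n, L (factor_at (x_ n) (- n%:Z) (2 * n))) ->
  exists2 z, bi_infinite L z & forall m N : nat, exists2 n, (N <= n)%N &
    forall i k, (absz i + k <= m)%N -> factor_at (x_ n) i k = factor_at z i k.
Proof.
move=> Lx; have [z zP] := int_sequence_compact x_.
have zP' m N : exists2 n, (N <= n)%N &
    forall i k, (absz i + k <= m)%N -> factor_at (x_ n) i k = factor_at z i k.
  have [n Nn nz] := zP m N; exists n => // i k ikm.
  by apply/eq_factor_at => j jk; apply: nz; lia.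
exists z => // i k; have [n Nn nz] := zP' (absz i + k)%N (absz i + k)%N.
rewrite -nz //; apply: fL (Lx n).
have := @infix_factor_at E (x_ n) (- n%:Z) (2 * n) (absz (i + n%:Z)%R) k.
rewrite (_ : - n%:Z + (absz (i + n%:Z)%R)%:Z = i); last by lia.
by apply; lia.
Qed.

Lemma take_drop_cat (p v q : seq E) n :
  (n <= size v)%N -> take n (drop (size p) (p ++ v ++ q)) = take n v.
Proof. by move=> nv; rewrite drop_size_cat // takel_cat. Qed.

Lemma word_in_bi_infinite w : L w ->
  exists2 z, bi_infinite L z & factor_at z 0 (size w) = w.
Proof.
move=> Lw; have [a _] : exists a : E, True.
  have [L0 _ ext _] := lL; have [a _] := ext _ L0; by exists a.
have /choice[W WP] n : exists W : seq E * seq E, size W.1 = n /\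
    size W.2 = n /\ L (W.1 ++ w ++ W.2).
  have [q sq Lq] := extend_right n Lw; have [p sp Lp] := extend_left n Lq.
  by exists (p, q).
pose x_ n := place ((W n).1 ++ w ++ (W n).2) n a.
have [n|z zL zP] := @bi_infinite_limit x_.
  have [s1 [s2 LW]] := WP n.
  rewrite factor_place; [|lia|rewrite !size_cat s1 s2; lia].
  rewrite (_ : absz _ = 0%N) ?drop0; last by lia.
  apply: fL LW; apply/infixP; set V := _ ++ _.
  by exists [::], (drop (2 * n) V); rewrite /= cat_take_drop.
exists z => //; have [n Nn nz] := zP (size w) 0%N.
have [s1 [s2 LW]] := WP n; rewrite -nz // factor_place //; last first.
  by rewrite !size_cat s1 s2; lia.
by rewrite (_ : absz _ = size (W n).1) ?take_drop_cat ?take_size //; lia.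
Qed.

Definition nonrecurrent_word (w : seq E) := exists z i,
  [/\ bi_infinite L z, ~ recurrent z & factor_at z i (size w) = w].

Lemma nonrecurrent_word_factor v w :
  infix v w -> nonrecurrent_word w -> nonrecurrent_word v.
Proof.
move=> /infixP[p [q ->]] [z [i [zL nr]]].
rewrite !size_cat !factor_atD => /eqP.
rewrite eqseq_cat ?size_factor_at // => /andP[_].
rewrite eqseq_cat ?size_factor_at // => /andP[/eqP e _].
by exists z, (i + (size p)%:Z).
Qed.

(** Otherwise there are arbitrarily long [v] such that [w] does not come back in [w ++ v]. Extend
    these words to the left and place [w] at position 0: a limit has [w] at 0 and at no positive
    position, so [w] occurs in a non recurrent sequence. *)
Lemma word_recurs_with_bounded_gaps w : L w -> ~ nonrecurrent_word w ->
  exists K, forall v, (K <= size v)%N -> L (w ++ v) ->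
    exists2 j, (0 < j <= size v)%N & take (size w) (drop j (w ++ v)) = w.
Proof.
move=> Lw nw; apply: contrapT => no.
have [a _] : exists a : E, True.
  have [L0 _ ext _] := lL; have [a _] := ext _ L0; by exists a.
have /choice[W WP] n : exists W : seq E * seq E, [/\ size W.1 = n,
    (n <= size W.2)%N, L (W.1 ++ w ++ W.2) &
    forall j, (0 < j <= size W.2)%N ->
      take (size w) (drop j (w ++ W.2)) <> w].
  apply: contrapT => noW; apply: no; exists n => v nv Lv.
  apply: contrapT => noj; apply: noW.
  have [p sp Lp] := extend_left n Lv; exists (p, v); split=> // j jv e.
  by apply: noj; exists j.
pose x_ n := place ((W n).1 ++ w ++ (W n).2) n a.
have [n|z zL zP] := @bi_infinite_limit x_.
  have [s1 s2 LW _] := WP n.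
  rewrite factor_place; [|lia|rewrite !size_cat s1; lia].
  rewrite (_ : absz _ = 0%N) ?drop0; last by lia.
  apply: fL LW; apply/infixP; set V := _ ++ _.
  by exists [::], (drop (2 * n) V); rewrite /= cat_take_drop.
apply: nw; exists z, 0.
have zw : factor_at z 0 (size w) = w.
  have [n Nn nz] := zP (size w) 0%N; have [s1 s2 _ _] := WP n.
  rewrite -nz // factor_place //; last by rewrite !size_cat s1; lia.
  by rewrite (_ : absz _ = size (W n).1) ?take_drop_cat ?take_size //; lia.
split=> // rz; have [[j j1 zj] _] := rz 0 (size w) 1.
rewrite zw in zj.
have [n Nn nz] := zP (absz j + size w)%N (absz j + size w)%N.
have [s1 s2 _ noj] := WP n; apply: (noj (absz j)); first by lia.
move: zj; rewrite -nz // factor_place //; [|lia|rewrite !size_cat s1; lia].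
rewrite (_ : absz (j + n%:Z)%R = (absz j + size (W n).1)%N); last by lia.
by rewrite -drop_drop drop_size_cat.
Qed.

Hypothesis cfL : crossing_free L.

(** Call a word inside if it satisfies [nonrecurrent_word]. A sequence with a factor outside is
    recurrent. If it also has a long factor inside, extending that factor to the right leads to a
    word [u] inside whose continuation by some [c] is outside, while another letter [c'] keeps it
    inside. The crux is that such [u] have bounded length for each pair of letters, since they are
    suffixes of one another. *)
Lemma nonrecurrent_separated : exists n0, forall z, bi_infinite L z ->
  forall i n j l, (n0 <= n)%N -> nonrecurrent_word (factor_at z i n) ->
    nonrecurrent_word (factor_at z j l).
Proof.
pose P (x : E * E) u := [/\ x.1 != x.2, L (rcons u x.1), L (rcons u x.2),
  nonrecurrent_word u & ~ nonrecurrent_word (rcons u x.1)].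
have key (x : E * E) : exists N, forall u, P x u -> (size u < N)%N.
  case: x => c c'; apply: contrapT => no.
  have /choice[u_ uP] n : exists u, (n <= size u)%N /\ P (c, c') u.
    apply: contrapT => noP; apply: no; exists n => u Pu.
    by rewrite ltnNge; apply/negP => nu; apply: noP; exists u.
  have /choice[q_ qP] n : exists q, size q = n /\ L (rcons (u_ n) c ++ q).
    have [_ [_ Lc _ _ _]] := uP n.
    by have [q sq Lq] := extend_right n Lc; exists q.
  (* The letter [c] after [u_ n] sits at position 0, so a limit reads pieces of the [u_ n] at
     negative positions. *)
  pose x_ n := place (u_ n ++ c :: q_ n) (size (u_ n)) c.
  have [n|z zL zP] := @bi_infinite_limit x_.
    have [s1 _] := uP n; have [s2 Lq] := qP n.
    rewrite factor_place; [|lia|by rewrite size_cat /= s2; lia].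
    move: Lq; rewrite cat_rcons; apply: fL; apply/infixP.
    set d := absz _; set W := _ ++ _.
    exists (take d W), (drop (2 * n) (drop d W)).
    by rewrite cat_take_drop cat_take_drop.
  set s := size (u_ 0%N).
  have [_ [/= cc' Lc Lc' Nu nNu]] := uP 0%N.
  have sfx n : (s <= n)%N -> drop (size (u_ n) - s) (u_ n) = u_ 0%N.
    move=> sn; have [s1 [/= _ Lnc Lnc' _ _]] := uP n; symmetry.
    apply: (right_special_suffix fL cfL cc') => //.
    by rewrite -/s; lia.
  have zs : factor_at z (- s%:Z) s.+1 = rcons (u_ 0%N) c.
    have [n sn nz] := zP (2 * s).+1 s; have [s1 _] := uP n.
    rewrite -nz; last by lia.
    rewrite factor_place; [|lia|by rewrite size_cat /=; lia].
    rewrite (_ : absz _ = (size (u_ n) - s)%N); last by lia.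
    have -> : u_ n ++ c :: q_ n =
        take (size (u_ n) - s) (u_ n) ++ (u_ 0%N ++ c :: q_ n).
      by rewrite -{1}(cat_take_drop (size (u_ n) - s) (u_ n)) sfx // catA.
    rewrite drop_size_cat; last by rewrite size_takel // leq_subr.
    by rewrite -cat_rcons take_size_cat // size_rcons.
  (* Either way [u_ 0] followed by [c] is inside, against [nNu]: directly if [z] is not recurrent;
     otherwise it recurs from some position at most [- s - 2], so that its [s + 1] letters end
     before 0 and belong to some [u_ n], which is inside. *)
  have [rz|nrz] := pselect (recurrent z); last first.
    by apply: nNu; exists z, (- s%:Z); rewrite size_rcons.
  have [_ [j js zj]] := rz (- s%:Z) s.+1 (- s%:Z - 2).
  rewrite zs in zj; apply: nNu.
  have [n Nn nz] := zP (absz j + s.+1)%N (absz j).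
  have [s1 [_ _ _ Nun _]] := uP n.
  apply: nonrecurrent_word_factor Nun; rewrite -zj -nz //.
  rewrite factor_place; [|lia|by rewrite size_cat /=; lia].
  set d := absz _; have ds : (d + s.+1 <= size (u_ n))%N by rewrite /d; lia.
  apply/infixP; exists (take d (u_ n)), (drop s.+1 (drop d (u_ n))).
  rewrite drop_cat (_ : (d < size (u_ n))%N); last by lia.
  by rewrite takel_cat ?size_drop ?cat_take_drop ?cat_take_drop //; lia.
have [N NP] := choice key.
exists (\max_x N x) => z zL i n j l Nn Nin; apply: contrapT => Njl.
have rz : recurrent z.
  apply: contrapT => nrz; apply: Njl; exists z, j.
  by rewrite size_factor_at.
have [[j' ij' zj'] _] := rz j l i.
(* The shortest extension that is outside gives [u], on removing its last letter. *)
pose Q k := ~~ `[< nonrecurrent_word (factor_at z i k) >].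
have Qex : exists k, Q k.
  exists (absz (j' - i)%R + l)%N; apply/negP => /asboolP h.
  apply: Njl; rewrite -zj'; apply: nonrecurrent_word_factor h.
  have := @infix_factor_at E z i (absz (j' - i)%R + l) (absz (j' - i)%R) l.
  by rewrite (_ : i + (absz (j' - i)%R)%:Z = j') ?leqnn; [apply|lia].
case: (ex_minnP Qex) => -[|k] Qk kmin.
  move/negP: Qk; apply; apply/asboolP; apply: nonrecurrent_word_factor Nin.
  by rewrite factor_at0 infix0s.
have Nk : nonrecurrent_word (factor_at z i k).
  by apply: contrapT => h; have := kmin k; rewrite ltnn /Q; case: asboolP => // _ /(_ isT).
have nk : (n <= k)%N.
  rewrite leqNgt; apply/negP => kn; move/negP: Qk; apply; apply/asboolP.
  apply: nonrecurrent_word_factor Nin.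
  by have := @infix_factor_at E z i n 0 k.+1; rewrite addr0; apply.
have nNc : ~ nonrecurrent_word (rcons (factor_at z i k) (z (i + k%:Z))).
  by rewrite -factor_atSr => h; move/negP: Qk; apply; apply/asboolP.
have [z' [i' [z'L nrz']]] := Nk; rewrite size_factor_at => e.
pose c' := z' (i' + k%:Z).
have Nc' : nonrecurrent_word (rcons (factor_at z i k) c').
  by exists z', i'; rewrite size_rcons size_factor_at factor_atSr e.
have Pk : P (z (i + k%:Z), c') (factor_at z i k).
  split => //=.
  - by apply/eqP => ec; apply: nNc; rewrite ec.
  - by rewrite -factor_atSr; exact: zL.
  - by rewrite -e -factor_atSr; exact: z'L.
have := NP _ _ Pk; rewrite size_factor_at ltnNge.
by rewrite (leq_trans _ nk) // (leq_trans _ Nn) // leq_bigmax.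
Qed.

End LanguageCompactness.

(** * Conformal masses *)

Section PositiveFunctionals.
Variable R : realType.

(** Additivity is asked only of nonnegative functions with sum at most 1. Banach limits and infinite
    weighted sums both have it, and indicators of occurrences of words stay in this range. *)
Record positive_functional (T : Type) (phi : (T -> R) -> R) : Prop := {
  functionalD : forall f g, (forall t, 0 <= f t) -> (forall t, 0 <= g t) ->
    (forall t, f t + g t <= 1) -> phi (fun t => f t + g t) = phi f + phi g;
  functional_ge0 : forall f, (forall t, 0 <= f t <= 1) -> 0 <= phi f;
  functional1 : phi (fun=> 1) = 1 }.

Lemma functional0 T (phi : (T -> R) -> R) :
  positive_functional phi -> phi (fun=> 0) = 0.
Proof.
move=> pf; have := functionalD pf (f := fun=> 0) (g := fun=> 0) (fun=> lexx _)
  (fun=> lexx _).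
rewrite addr0 => /(_ (fun=> ler01)) /eqP.
by rewrite -subr_eq subrr eq_sym => /eqP.
Qed.

Lemma functional_sum T (phi : (T -> R) -> R) (E : finType) (f : E -> T -> R) :
  positive_functional phi -> (forall a t, 0 <= f a t) ->
  (forall t, \sum_a f a t <= 1) -> phi (fun t => \sum_a f a t) = \sum_a phi (f a).
Proof.
move=> pf f0; elim: (index_enum E) => [|a r IH] f1.
  by rewrite big_nil -[RHS](functional0 pf); congr phi; apply/funext => t;
    rewrite big_nil.
have f1' t : f a t + \sum_(b <- r) f b t <= 1 by have := f1 t; rewrite big_cons.
rewrite big_cons -IH => [|t].
  rewrite -functionalD // => [|t]; last by rewrite sumr_ge0.
  by congr phi; apply/funext => t; rewrite big_cons.
by apply: le_trans (f1' t); rewrite lerDr.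
Qed.

(** One inequality for all positive factors yields the other, through [x^-1]. *)
Lemma esumZl (T : choiceType) (x : R) (f : T -> \bar R) : 0 < x ->
  (forall t, 0 <= f t)%E ->
  \esum_(t in [set: T]) (x%:E * f t)%E = (x%:E * \esum_(t in [set: T]) f t)%E.
Proof.
have half (y : R) (g : T -> \bar R) : 0 < y -> (forall t, 0 <= g t)%E ->
    (\esum_(t in [set: T]) (y%:E * g t) <= y%:E * \esum_(t in [set: T]) g t)%E.
  move=> y0 g0; apply: ge_ereal_sup => _ [X [fX _] <-].
  rewrite -ge0_mule_fsumr // lee_pmul2l ?fin_numE //.
  by apply: esum_ge; exists X.
move=> x0 f0; apply/eqP; rewrite eq_le half //=.
have xf0 t : (0 <= x%:E * f t)%E by rewrite mule_ge0 // lee_fin ltW.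
have xV0 : 0 < x^-1 by rewrite invr_gt0.
have := half x^-1 _ xV0 xf0.
rewrite (eq_esum (b := f)); last first.
  by move=> t _; rewrite muleA -EFinM mulVf ?mul1e // gt_eqF.
move=> h; have x0' : (0 <= x%:E)%E by rewrite lee_fin ltW.
have := lee_wpmul2l x0' h; rewrite muleA -EFinM divff ?mul1e //.
by rewrite gt_eqF.
Qed.

Variables (T : choiceType) (c : T -> R).
Hypotheses (c_ge0 : forall t, 0 <= c t)
  (c_sum1 : \esum_(t in [set: T]) (c t)%:E = 1%E).

Definition wsum (f : T -> R) : R := fine (\esum_(t in [set: T]) (c t * f t)%:E).

Lemma wsumE f : (forall t, 0 <= f t <= 1) ->
  \esum_(t in [set: T]) (c t * f t)%:E = (wsum f)%:E.
Proof.
move=> f01; rewrite fineK // ge0_fin_numE; last first.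
  by apply: esum_ge0 => t _; rewrite lee_fin mulr_ge0 //; have /andP[] := f01 t.
apply: (@le_lt_trans _ _ 1%E); last by rewrite ltry.
rewrite -c_sum1; apply: le_esum => t _; rewrite lee_fin ler_piMr //.
by have /andP[] := f01 t.
Qed.

Lemma wsum_functional : positive_functional wsum.
Proof.
split.
- move=> f g f0 g0 fg1; apply: EFin_inj; rewrite EFinD -!wsumE.
  + rewrite -esumD => [|t _|t _]; rewrite ?lee_fin ?mulr_ge0 //.
    by apply: eq_esum => t _; rewrite mulrDr EFinD.
  + by move=> t; rewrite g0 (le_trans _ (fg1 t)) // lerDr.
  + by move=> t; rewrite f0 (le_trans _ (fg1 t)) // lerDl.
  + by move=> t; rewrite addr_ge0 ?fg1.
- move=> f f01; apply: fine_ge0; apply: esum_ge0 => t _.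
  by rewrite lee_fin mulr_ge0 //; have /andP[] := f01 t.
- by rewrite /wsum; under eq_esum do rewrite mulr1; rewrite c_sum1.
Qed.

Lemma wsum_ge_term f t : (forall t, 0 <= f t <= 1) -> c t * f t <= wsum f.
Proof.
move=> f01; rewrite -lee_fin -wsumE //; apply: esum_ge.
by exists [set t]; [split=> //; exact: finite_set1|rewrite fsbig_set1].
Qed.

Lemma wsumZ (d : T -> R) f x : 0 < x -> (forall t, 0 <= f t <= 1) ->
  (forall t, d t * f t = x * (c t * f t)) ->
  fine (\esum_(t in [set: T]) (d t * f t)%:E) = x * wsum f.
Proof.
move=> x0 f01 dE; under eq_esum do rewrite dE EFinM.
rewrite esumZl // => [|t]; first by rewrite wsumE.
by rewrite lee_fin mulr_ge0 //; have /andP[] := f01 t.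
Qed.

End PositiveFunctionals.

Section MassPairs.
Variables (R : realType) (E : finType) (L : set (seq E)).
Variables (s : seq E -> R) (n0 : nat).
Implicit Types (lam rho : seq E -> R).

(* [lam u] is the mass of the cylinder of [u], and [rho u] that of its image
   under the shift; the former is scaled to the latter by a factor that depends
   only on the first [n0] letters. *)
Record mass_pair lam rho : Prop := {
  lam_ge0 : forall u, 0 <= lam u;
  rho_ge0 : forall u, 0 <= rho u;
  lam_rcons : forall u, lam u = \sum_c lam (rcons u c);
  rho_rcons : forall u, rho u = \sum_c rho (rcons u c);
  lam_cons : forall u, lam u = \sum_a rho (a :: u);
  lam_nil : lam [::] = 1;
  rho_nil : rho [::] = 1;
  lam_support : forall u, 0 < lam u -> L u;
  rho_scale : forall u, (n0 <= size u)%N -> rho u = s (take n0 u) * lam u }.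

Lemma right_additive_le (f : seq E -> R) u : (forall u, 0 <= f u) ->
  (forall u, f u = \sum_c f (rcons u c)) -> f [::] = 1 -> f u <= 1.
Proof.
move=> f0 fr f1; elim/last_ind: u => [|u c IH]; first by rewrite f1.
apply: le_trans IH; rewrite [leRHS]fr (bigD1 c) //= lerDl.
exact: sumr_ge0.
Qed.

(** [Lam] weighs the positions of [z], and [Rho] gives to [i] the weight of [i + 1]. An occurrence
    of [u] at [i + 1] extends to the left by exactly one letter, hence [lam_cons]. All positions
    where a given word of length at least [n0] occurs share the value of [sg], hence [rho_scale]. *)
Lemma mass_pair_of_functionals (z : int -> E) (sg : int -> R)
    (Lam Rho : (int -> R) -> R) :
  bi_infinite L z -> positive_functional Lam -> positive_functional Rho ->
  (forall f, (forall i, 0 <= f i <= 1) -> Rho (fun i => f (i + 1)) = Lam f) ->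
  (forall i, s (factor_at z i n0) = sg i) ->
  (forall i, 0 < sg i) ->
  (forall f x, (forall i, 0 <= f i <= 1) -> (forall i, f i != 0 -> sg i = x) ->
    0 < x -> Rho f = x * Lam f) ->
  mass_pair (fun u => Lam (fun i => (factor_at z i (size u) == u)%:R))
            (fun u => Rho (fun i => (factor_at z i (size u) == u)%:R)).
Proof.
move=> zL pL pR shift ssg sg0 scale.
have b01 (b : bool) : 0 <= b%:R <= (1 : R).
  by case: b; rewrite ?lexx ler01.
have occr u i : (factor_at z i (size u) == u)%:R =
    \sum_c (factor_at z i (size (rcons u c)) == rcons u c)%:R :> R.
  rewrite (bigD1 (z (i + (size u)%:Z))) //= size_rcons factor_atSr.
  rewrite eqseq_rcons eqxx andbT big1 ?addr0 // => c cz.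
  by rewrite size_rcons factor_atSr eqseq_rcons [_ == c]eq_sym (negPf cz) andbF.
have occl u i : (factor_at z (i + 1) (size u) == u)%:R =
    \sum_a (factor_at z i (size (a :: u)) == a :: u)%:R :> R.
  rewrite (bigD1 (z i)) //= factor_atS.
  rewrite eqseq_cons eqxx /= big1 ?addr0 // => c cz.
  by rewrite eqseq_cons [_ == c]eq_sym (negPf cz).
have right (Phi : (int -> R) -> R) : positive_functional Phi -> forall u,
    Phi (fun i => (factor_at z i (size u) == u)%:R) =
    \sum_c Phi (fun i => (factor_at z i (size (rcons u c)) == rcons u c)%:R).
  move=> pP u; rewrite -functional_sum //; last first.
    by move=> i; rewrite -occr; case: (_ == _); rewrite ?lexx ?ler01.
  by congr Phi; apply/funext => i; rewrite occr.
split=> //.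
- by move=> u; apply: functional_ge0 => // i; exact: b01.
- by move=> u; apply: functional_ge0 => // i; exact: b01.
- exact: right.
- exact: right.
- move=> u; rewrite -shift => [|i]; last exact: b01.
  rewrite -functional_sum //; last first.
    by move=> i; rewrite -occl; case: (_ == _); rewrite ?lexx ?ler01.
  by congr Rho; apply/funext => i; rewrite occl.
- by rewrite -[RHS](functional1 pL).
- by rewrite -[RHS](functional1 pR).
- move=> u Lu; apply: contrapT => nLu; move: Lu; rewrite -(functional0 pL).
  rewrite (_ : (fun i => _) = fun=> 0) ?ltxx //; apply/funext => i.
  by case: eqP => // e; case: nLu; rewrite -e; exact: zL.
- move=> u nu; have [[i iu]|no] := pselect (exists i, factor_at z i (size u) = u).
    have su : s (take n0 u) = sg i by rewrite -{1}iu take_factor_at.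
    apply: scale; [|move=> j|by rewrite su].
      by move=> j; exact: b01.
    case: (factor_at z j (size u) =P u) => [ju _|_]; last by rewrite eqxx.
    by rewrite -{1}ju take_factor_at.
  have occ0 : (fun i => (factor_at z i (size u) == u)%:R) = (fun=> 0) :> (int -> R).
    by apply/funext => i; case: eqP => // e; case: no; exists i.
  by rewrite occ0 !functional0 // mulr0.
Qed.

End MassPairs.

(** * One conformal mass that charges every word *)

Section FullMass.
Variables (R : realType) (E : finType) (L : set (seq E)).
Hypotheses (lL : is_language L) (cfL : crossing_free L).

(** Position [i] gets a weight proportional to the orbit mass, whose sum over all positions the two
    series make finite. The shift moves the atom from [i] to [i + 1] and so scales it by
    [exp(theta (z i))]. *)
Lemma atomic_mass_pair (s : seq E -> R) n0 (z : int -> E) (theta : E -> R) :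
  bi_infinite L z ->
  (forall i, s (factor_at z i n0) = expR (theta (z i))) ->
  (\sum_(0 <= n <oo)
     (expR (\sum_(0 <= j < n.+1) theta (z j%:Z)))%:E < +oo)%E ->
  (\sum_(1 <= n <oo)
     (expR (- \sum_(1 <= j < n.+1) theta (z (- j%:Z))))%:E < +oo)%E ->
  exists lam rho, mass_pair L s n0 lam rho /\
    forall i n, 0 < lam (factor_at z i n).
Proof.
move=> zL sz fwd bwd.
pose m := orbit_mass theta z.
have m0 : forall i, 0 < m i := orbit_mass_gt0 theta z.
have mS := orbit_massS theta z : forall i, m (i + 1) = expR (theta (z i)) * m i.
have me0 i : (0 <= (m i)%:E)%E by rewrite lee_fin ltW.
have mfin : (\esum_(i in [set: int]) (m i)%:E < +oo)%E.
  rewrite (esumID (range Posz)) // setTI.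
  rewrite (_ : _ `&` _ = range Negz); last first.
    apply/seteqP; split=> [[n|n] [_ h]|_ [n _ <-]].
    - by case: h; exists n.
    - by exists n.
    - by split=> // -[].
  rewrite !esum_image; [|by move=> ? ? _ _ []..].
  rewrite -!nneseries_esumT //; apply: lte_add_pinfty.
    rewrite nneseries_recl //; apply: lte_add_pinfty; first by rewrite ltry.
    by rewrite -(nneseries_addn 1) //; under eq_eseriesr do rewrite addn1.
  move: bwd; rewrite -(nneseries_addn 1) => [|i].
    by under eq_eseriesr do rewrite addn1.
  by rewrite lee_fin expR_ge0.
pose M := fine (\esum_(i in [set: int]) (m i)%:E).
have ME : \esum_(i in [set: int]) (m i)%:E = M%:E.
  by rewrite fineK // ge0_fin_numE // esum_ge0.
have M0 : 0 < M.
  rewrite -lte_fin -ME; apply: (@lt_le_trans _ _ (m 0)%:E); first by rewrite lte_fin.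
  by apply: esum_ge; exists [set 0]; [split=> //; exact: finite_set1|
    rewrite fsbig_set1].
pose c i := m i / M.
have c0 i : 0 < c i by rewrite divr_gt0.
have c1 : \esum_(i in [set: int]) (c i)%:E = 1%E.
  under eq_esum do rewrite /c mulrC EFinM.
  by rewrite esumZl ?invr_gt0 // ME -EFinM mulVf ?gt_eqF.
pose c' i := c (i + 1).
have sh_bij : set_bij [set: int] [set: int] (fun i => i + 1).
  split=> //; first by move=> x y _ _ /addIr.
  by move=> y _; exists (y - 1) => //; rewrite subrK.
have sh f : \esum_(i in [set: int]) f i =
    \esum_(i in [set: int]) f (i + 1) :> \bar R by exact: reindex_esum.
have c'1 : \esum_(i in [set: int]) (c' i)%:E = 1%E.
  by rewrite -c1 [RHS]sh.
have cge i : 0 <= c i by exact: ltW.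
have c'ge i : 0 <= c' i by rewrite /c' ltW.
exists (fun u => wsum c (fun i => (factor_at z i (size u) == u)%:R)),
  (fun u => wsum c' (fun i => (factor_at z i (size u) == u)%:R)); split.
  apply: (@mass_pair_of_functionals _ _ _ _ _ _ (fun i => expR (theta (z i)))) => //.
  - exact: wsum_functional.
  - exact: wsum_functional.
  - move=> f f01; rewrite /wsum; congr fine.
    by rewrite [RHS]sh.
  - by move=> i; rewrite expR_gt0.
  - move=> f x f01 fx x0; apply: wsumZ => // i.
    have [->|fi] := eqVneq (f i) 0; first by rewrite !mulr0.
    by rewrite /c' /c mS (fx _ fi) !mulrA.
move=> i n; set u := factor_at z i n.
apply: (@lt_le_trans _ _ (c i)) => //.
have := wsum_ge_term cge c1 (f := fun i => (factor_at z i (size u) == u)%:R) i.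
rewrite size_factor_at eqxx mulr1; apply=> j.
by case: (_ == _); rewrite ?lexx ?ler01.
Qed.

(** [Lam] and [Rho] are the same invariant mean, so the scale is 1. Every window of [K] successive
    positions meets an occurrence of [w], hence [K * lam w >= 1]. *)
Lemma recurrent_mass_pair (s : seq E -> R) n0 w :
  L w -> ~ nonrecurrent_word L w ->
  (forall z, bi_infinite L z -> factor_at z 0 (size w) = w ->
     forall i, s (factor_at z i n0) = 1) ->
  exists lam rho, mass_pair L s n0 lam rho /\ 0 < lam w.
Proof.
move=> Lw nw s1; have [z zL zw] := word_in_bi_infinite lL Lw.
have [K KP] := word_recurs_with_bounded_gaps lL Lw nw.
have rz : recurrent z.
  by apply: contrapT => nr; apply: nw; exists z, 0.
have next j : factor_at z j (size w) = w ->
    exists2 j', j < j' <= j + K%:Z & factor_at z j' (size w) = w.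
  move=> jw; have e : w ++ factor_at z (j + (size w)%:Z) K =
      factor_at z j (size w + K) by rewrite factor_atD jw.
  have := KP (factor_at z (j + (size w)%:Z) K); rewrite size_factor_at leqnn e.
  move=> /(_ isT (zL _ _))[d /andP[d0 dK]].
  rewrite drop_factor_at; last by lia.
  rewrite take_factor_at; last by lia.
  by move=> dw; exists (j + d%:Z) => //; lia.
(* Recurrence to the left gives an occurrence at or before [i], from which gaps of at most [K] lead
   past [i]. *)
have dense i : exists2 j : nat, (j < K)%N &
    factor_at z (i + (j%:Z + 1)) (size w) = w.
  have [_ [j0 j0i j0w]] := rz 0 (size w) i; rewrite zw in j0w.
  have loop (d : nat) : exists2 j, j0 + d%:Z < j <= j0 + d%:Z + K%:Z &
      factor_at z j (size w) = w.
    elim: d => [|d [j jd jw]]; first by rewrite addr0; exact: next.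
    have [jd1|jd1] := ltrP (j0 + d.+1%:Z) j.
      by exists j => //; lia.
    by have [j' jj' j'w] := next j jw; exists j' => //; lia.
  have [j ji jw] := loop (absz (i - j0)%R).
  exists (absz (j - i - 1)%R); first by lia.
  by rewrite (_ : i + _ = j) //; lia.
have [mean [mD m_ge0 m1 mS]] := invariant_mean R.
have bseq (f : int -> R) : (forall i, 0 <= f i <= 1) -> bounded_seq f.
  by move=> f01; exists 1 => i; have /andP[f0 f1] := f01 i; rewrite ger0_norm.
have pm : positive_functional mean.
  split=> //.
  - move=> f g f0 g0 fg1; apply: mD; apply: bseq => i.
      by rewrite f0 (le_trans _ (fg1 i)) // lerDl.
    by rewrite g0 (le_trans _ (fg1 i)) // lerDr.
  - move=> f f01; apply: m_ge0; first exact: bseq.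
    by move=> i; have /andP[] := f01 i.
exists (fun u => mean (fun i => (factor_at z i (size u) == u)%:R)),
  (fun u => mean (fun i => (factor_at z i (size u) == u)%:R)); split.
  apply: (@mass_pair_of_functionals _ _ _ _ _ _ (fun=> 1)) => //.
  - by move=> f f01; apply: mS; exact: bseq.
  - exact: s1.
  - move=> f x f01 fx x0; have [[i fi]|no] := pselect (exists i, f i != 0).
      by rewrite -(fx i fi) mul1r.
    rewrite (_ : f = fun=> 0) ?(functional0 pm) ?mulr0 //.
    by apply/funext => i; apply/eqP; rewrite -[_ == _]negbK; apply/negP => fi;
      apply: no; exists i.
pose f (i : int) : R := (factor_at z i (size w) == w)%:R.
have f01 i : 0 <= f i <= 1 by rewrite /f; case: (_ == _); rewrite ?lexx ler01.
rewrite -[X in _ < mean X]/f.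
have msh (j : nat) : mean (fun i => f (i + j%:Z)) = mean f.
  elim: j => [|j <-]; first by congr mean; apply/funext => i; rewrite addr0.
  rewrite -[RHS]mS; last by apply: bseq.
  by congr mean; apply/funext => i; congr f; lia.
have bsum n : bounded_seq (fun i => \sum_(j < n) f (i + (j%:Z + 1))).
  exists n%:R => i; rewrite ger0_norm; last first.
    by apply: sumr_ge0 => j _; have /andP[] := f01 (i + (j%:Z + 1)).
  apply: (@le_trans _ _ (\sum_(j < n) (1 : R))).
    by apply: ler_sum => j _; have /andP[] := f01 (i + (j%:Z + 1)).
  by rewrite sumr_const card_ord.
have msum n : mean (fun i => \sum_(j < n) f (i + (j%:Z + 1))) = n%:R * mean f.
  elim: n => [|n IH].
    by rewrite mul0r -[RHS](functional0 pm); congr mean; apply/funext => i;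
      rewrite big_ord0.
  rewrite -[n.+1]addn1 natrD mulrDl mul1r -IH -[X in _ + X](msh n.+1).
  rewrite -mD //; last by apply: bseq.
  congr mean; apply/funext => i; rewrite addn1 big_ord_recr /=.
  by congr (_ + f _); lia.
have : 1 <= K%:R * mean f.
  rewrite -msum -m1 -subr_ge0.
  pose g (i : int) : R := \sum_(j < K) f (i + (j%:Z + 1)) - 1.
  have gE : mean (fun i => \sum_(j < K) f (i + (j%:Z + 1))) = mean g + mean (fun=> 1).
    rewrite -mD.
    - by congr mean; apply/funext => i; rewrite subrK.
    - have [C CP] := bsum K; exists (C + 1) => i.
      by rewrite (le_trans (ler_normB _ _)) // normr1 lerD2r.
    - by exists 1 => i; rewrite normr1.
  rewrite gE addrK; apply: m_ge0.
    have [C CP] := bsum K; exists (C + 1) => i.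
    by rewrite (le_trans (ler_normB _ _)) // normr1 lerD2r.
  move=> i; rewrite /g subr_ge0; have [j jK jw] := dense i.
  rewrite (bigD1 (Ordinal jK)) //= {1}/f jw eqxx lerDl.
  by apply: sumr_ge0 => k _; have /andP[] := f01 (i + (k%:Z + 1)).
have : 0 <= mean f by apply: m_ge0; [exact: bseq|move=> i; have /andP[] := f01 i].
rewrite le_eqVlt => /orP[/eqP <-|//]; rewrite mulr0.
by move=> h; have := lt_le_trans ltr01 h; rewrite ltxx.
Qed.

Lemma geometric_esum : \esum_(k in [set: nat]) ((2 ^- k.+1 : R)%:E) = 1%E.
Proof.
rewrite -nneseries_esumT; last by move=> k; rewrite lee_fin invr_ge0 exprn_ge0.
rewrite (_ : (fun k => _) = (fun k => (\sum_(0 <= i < k) (2 ^- i.+1 : R))%:E)).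
  apply: cvg_lim => //; apply: cvg_EFin; first exact: nearW.
  rewrite (_ : _ \o _ = fun k => 1 - (2^-1 : R) ^+ k).
    rewrite -[X in _ --> X]subr0; apply: cvgB; first exact: cvg_cst.
    by apply: cvg_expr; rewrite ger0_norm; lra.
  apply/funext => k /=; elim: k => [|k IH]; first by rewrite big_geq // expr0 subrr.
  rewrite big_nat_recr //= IH -exprVn !exprS; lra.
by apply/funext => k; rewrite sumEFin.
Qed.

(** The scale [s] is [exp(theta)] of the first letter on blocks that occur in non recurrent
    sequences, and 1 on the others. A non recurrent sequence has only blocks of the former kind. By
    separation, a sequence through a word absent from all non recurrent ones has only blocks of the
    latter kind, at length [n0]. So all the masses obey the same [s], and so does their combination
    with weights [2 ^- k.+1]. *)
Lemma full_mass_pair (theta : E -> R) :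
  (forall z, bi_infinite L z -> ~ recurrent z ->
    (\sum_(0 <= n <oo)
       (expR (\sum_(0 <= j < n.+1) theta (z j%:Z)))%:E < +oo)%E /\
    (\sum_(1 <= n <oo)
       (expR (- \sum_(1 <= j < n.+1) theta (z (- j%:Z))))%:E < +oo)%E) ->
  exists (s : seq E -> R) n0 lam rho, [/\ (0 < n0)%N, forall b, 0 < s b,
    mass_pair L s n0 lam rho & forall u, L u -> 0 < lam u].
Proof.
move=> thP; have [n1 sep] := nonrecurrent_separated lL cfL.
(* One more than the separation bound, so that a block has a first letter. *)
pose n0 := n1.+1.
pose s (b : seq E) : R := if `[< nonrecurrent_word L b >] then
  (if b is a :: _ then expR (theta a) else 1) else 1.
have one w : L w -> exists lr : (seq E -> R) * (seq E -> R),
    mass_pair L s n0 lr.1 lr.2 /\ 0 < lr.1 w.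
  move=> Lw; have [[z [i [zL nr zw]]]|nw] := pselect (nonrecurrent_word L w).
    have [fwd bwd] := thP z zL nr.
    have [|lam [rho [mp pos]]] := @atomic_mass_pair s n0 z theta zL _ fwd bwd.
      move=> j; rewrite /s; case: asboolP => [_|[]]; first by rewrite factor_atS.
      by exists z, j; rewrite size_factor_at.
    by exists (lam, rho); split=> //=; rewrite -zw.
  have [|lam [rho [mp pos]]] := @recurrent_mass_pair s n0 w Lw nw.
    move=> z zL zw i; rewrite /s; case: asboolP => // Ni; exfalso; apply: nw.
    by rewrite -zw; apply: (sep z zL i n0) => //; exact: leqnSn.
  by exists (lam, rho).
have L0 : L [::] by have [] := lL.
(* Indices that code no word of [L] default to the empty word. *)
pose w_ k : seq E := if unpickle k is Some w then
  (if `[< L w >] then w else [::]) else [::].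
have Lw k : L (w_ k).
  by rewrite /w_; case: unpickle => [w|] //; case: asboolP.
have /choice[lr lrP] k := one (w_ k) (Lw k).
pose c k : R := 2 ^- k.+1.
have c0 k : 0 <= c k by rewrite invr_ge0 exprn_ge0.
have pw := wsum_functional c0 geometric_esum.
pose lam u := wsum c (fun k => (lr k).1 u).
pose rho u := wsum c (fun k => (lr k).2 u).
have l01 u k : 0 <= (lr k).1 u <= 1.
  have [mp _] := lrP k; rewrite (lam_ge0 mp) right_additive_le //.
  - exact: (lam_ge0 mp).
  - exact: (lam_rcons mp).
  - exact: (lam_nil mp).
have r01 u k : 0 <= (lr k).2 u <= 1.
  have [mp _] := lrP k; rewrite (rho_ge0 mp) right_additive_le //.
  - exact: (rho_ge0 mp).
  - exact: (rho_rcons mp).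
  - exact: (rho_nil mp).
have s0 b : 0 < s b by rewrite /s; case: ifP => // _; case: b => // a b; rewrite expR_gt0.
exists s, n0, lam, rho; split=> //; last first.
  move=> u Lu; apply: (@lt_le_trans _ _ (c (pickle u) * (lr (pickle u)).1 u)).
    rewrite mulr_gt0 // ?invr_gt0 ?exprn_gt0 //.
    have [_] := lrP (pickle u); rewrite /w_ pickleK.
    by case: asboolP.
  exact: (wsum_ge_term c0 geometric_esum (f := fun k => (lr k).1 u)).
split.
- by move=> u; apply: (functional_ge0 pw) => k.
- by move=> u; apply: (functional_ge0 pw) => k.
- move=> u; rewrite -functional_sum //.
  + by congr wsum; apply/funext => k; have [mp _] := lrP k; exact: (lam_rcons mp).
  + by move=> a k; have /andP[] := l01 (rcons u a) k.
  + by move=> k; have [mp _] := lrP k; rewrite -(lam_rcons mp); have /andP[] := l01 u k.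
- move=> u; rewrite -functional_sum //.
  + by congr wsum; apply/funext => k; have [mp _] := lrP k; exact: (rho_rcons mp).
  + by move=> a k; have /andP[] := r01 (rcons u a) k.
  + by move=> k; have [mp _] := lrP k; rewrite -(rho_rcons mp); have /andP[] := r01 u k.
- move=> u; rewrite -functional_sum //.
  + by congr wsum; apply/funext => k; have [mp _] := lrP k; exact: (lam_cons mp).
  + by move=> a k; have /andP[] := r01 (a :: u) k.
  + by move=> k; have [mp _] := lrP k; rewrite -(lam_cons mp); have /andP[] := l01 u k.
- rewrite -[RHS](functional1 pw); congr wsum; apply/funext => k.
  by have [mp _] := lrP k; exact: (lam_nil mp).
- rewrite -[RHS](functional1 pw); congr wsum; apply/funext => k.
  by have [mp _] := lrP k; exact: (rho_nil mp).
- move=> u; apply: contraPP => nL; rewrite /lam (_ : (fun k => _) = fun=> 0).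
    by rewrite (functional0 pw) ltxx.
  apply/funext => k; apply/eqP; have /andP[ge0 _] := l01 u k.
  rewrite eq_le ge0 andbT leNgt; apply/negP => gt0; apply: nL.
  by have [mp _] := lrP k; exact: (lam_support mp).
- move=> u nu; rewrite /rho /lam.
  have <- := wsumZ c0 geometric_esum (d := fun k => c k * s (take n0 u)) (s0 _) (l01 u).
    rewrite /wsum; congr fine; apply: eq_esum => k _; congr EFin.
    by have [mp _] := lrP k; rewrite (rho_scale mp nu) mulrA.
  by move=> k; rewrite mulrA [_ * c k]mulrC.
Qed.

End FullMass.

(** * Tilings of the unit interval by words *)

Section Tiles.
Variables (R : realType) (X : finType).
Implicit Types (lt : rel X) (w : X -> R).

(** Left end of the tile of [c] when intervals of lengths [w] are laid side by side from 0 in the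
    order [lt]. *)
Definition below lt w (c : X) : R := \sum_(d | lt d c) w d.

Lemma ler_sum_sub (P Q : pred X) w : (forall d, 0 <= w d) ->
  (forall d, 0 < w d -> P d -> Q d) -> \sum_(d | P d) w d <= \sum_(d | Q d) w d.
Proof.
move=> w0 PQ; rewrite big_mkcond [leRHS]big_mkcond; apply: ler_sum => d _.
case: ifP => Pd; last by case: ifP.
have [wd|wd] := ltP 0 (w d); first by rewrite PQ.
by case: ifP.
Qed.

Lemma below_ge0 lt w c : (forall d, 0 <= w d) -> 0 <= below lt w c.
Proof. by move=> w0; rewrite sumr_ge0. Qed.

Lemma belowS lt w c : strict_total_order lt ->
  below lt w c + w c = \sum_(d | (d == c) || lt d c) w d.
Proof.
move=> [irr _ _]; rewrite [RHS](bigD1 c) ?eqxx //= addrC; congr (_ + _).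
apply: eq_bigl => d; have [->|dc] := eqVneq d c; first by rewrite irr.
by rewrite andbT.
Qed.

Lemma below_compl lt w c : strict_total_order lt ->
  below lt w c + w c + below (fun x y => lt y x) w c = \sum_d w d.
Proof.
move=> to; have [irr tr tot] := to; rewrite (belowS w c to).
rewrite [RHS](bigID (fun d => (d == c) || lt d c)) /=; congr (_ + _).
apply: eq_bigl => d; have [->|dc] := eqVneq d c; first by rewrite irr.
have := tot d c dc; case: (boolP (lt d c)) => //= dc' _.
by apply/negP => cd; exact: (strict_total_asym to dc' cd).
Qed.

Lemma below_le_total lt w c : strict_total_order lt -> (forall d, 0 <= w d) ->
  below lt w c + w c <= \sum_d w d.
Proof.
by move=> to w0; rewrite -(below_compl w c to) lerDl; exact: below_ge0.
Qed.

Lemma below_step lt w c d : strict_total_order lt -> (forall d, 0 <= w d) ->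
  lt c d -> below lt w c + w c <= below lt w d.
Proof.
move=> to w0 cd; have [_ tr _] := to; rewrite belowS //; apply: ler_sum_sub => // e _.
by move=> /orP[/eqP -> //|ec]; exact: tr ec cd.
Qed.

Lemma strict_total_min lt (P : pred X) c0 : strict_total_order lt -> P c0 ->
  exists2 c, P c & forall d, P d -> d != c -> lt c d.
Proof.
move=> to Pc0; have [irr tr tot] := to.
case: (arg_minnP (fun c => #|[set d | lt d c]%SET|) Pc0) => c Pc cmin.
exists c => // d Pd dc; have := tot d c dc; case/orP => // dc'.
have := cmin d Pd; rewrite leqNgt => /negP[]; apply: proper_card.
apply/properP; split.
  by apply/fintype.subsetP => e; rewrite !inE => ed; exact: tr ed dc'.
by exists d; rewrite !inE ?irr.
Qed.

Lemma strict_total_rev lt : strict_total_order lt ->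
  strict_total_order (fun x y => lt y x).
Proof.
move=> [irr tr tot]; split=> [x|y x z xy yz|x y xy]; first exact: irr.
  exact: tr yz xy.
by rewrite orbC tot.
Qed.

(** Positive weight is what will put the word of the tile into the language. The least letter of
    positive weight whose right end reaches [t] does: were its left end beyond [t], the preceding
    letter of positive weight would reach [t] too. *)
Lemma tile_cover lt w t : strict_total_order lt -> (forall d, 0 <= w d) ->
  0 < \sum_d w d -> 0 <= t <= \sum_d w d ->
  exists2 c, 0 < w c & below lt w c <= t <= below lt w c + w c.
Proof.
move=> to w0 W0 /andP[t0 tW]; have [irr tr tot] := to.
have [c0 c0P] : exists c, 0 < w c.
  apply: contrapT => no; move: W0; rewrite big1 ?ltxx // => c _.
  apply/eqP; rewrite eq_le w0 andbT leNgt; apply/negP => wc; apply: no.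
  by exists c.
pose P c := (0 < w c) && (t <= below lt w c + w c).
have [c1 Pc1] : exists c, P c.
  have [c wc cmax] := strict_total_min (P := fun c => 0 < w c)
    (strict_total_rev to) c0P.
  exists c; rewrite /P wc /=; apply: le_trans tW _; rewrite belowS //.
  apply: ler_sum_sub => // d wd _; have [//|dc] := eqVneq d c.
  exact: cmax.
have [c /andP[wc tc] cmin] := strict_total_min to Pc1.
exists c => //; rewrite tc andbT leNgt; apply/negP => tb.
have [d0 d0Q] : exists d, (0 < w d) && lt d c.
  apply: contrapT => no; move: tb; rewrite ltNge => /negP[].
  rewrite /below big1 // => d dc; apply/eqP; rewrite eq_le w0 andbT leNgt.
  by apply/negP => wd; apply: no; exists d; rewrite wd.
have [d /andP[wd dc] dmax] := strict_total_min (P := fun d => (0 < w d) && lt d c)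
  (strict_total_rev to) d0Q.
have Pd : P d.
  rewrite /P wd /=; apply: le_trans (ltW tb) _; rewrite belowS //.
  apply: ler_sum_sub => // e we ec; have [//|ed] := eqVneq e d.
  by apply: dmax => //; rewrite we.
have dnc : d != c by apply/eqP => dc'; move: dc; rewrite dc' irr.
have cd := cmin d Pd dnc.
by have := tr _ _ _ dc cd; rewrite irr.
Qed.

End Tiles.

Section Positions.
Variables (R : realType) (E : finType) (F : {set E}) (ltD : rel E).
Hypothesis toD : strict_total_order ltD.
Implicit Types (m : seq E -> R) (p u v : seq E).

Let toF p : strict_total_order (flip_order F ltD p).
Proof. exact: flip_order_total. Qed.

(** Left end of the tile of [u] in a lexicographic arrangement where letters after the prefix [p]
    are compared by [<_{D,p}], since the iterate along [p] reverses orientation when [p] has an odd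
    number of flips. *)
Fixpoint position_from m p u : R :=
  if u is c :: u' then
    below (flip_order F ltD p) (fun c' => m (rcons p c')) c +
      position_from m (rcons p c) u'
  else 0.

Definition position m u : R := position_from m [::] u.

Lemma position_from_rcons m p u c : position_from m p (rcons u c) =
  position_from m p u +
    below (flip_order F ltD (p ++ u)) (fun c' => m (rcons (p ++ u) c')) c.
Proof.
elim: u p => [|a u IH] p /=; first by rewrite addr0 add0r cats0.
by rewrite IH cat_rcons addrA.
Qed.

Lemma position_rcons m u c : position m (rcons u c) =
  position m u + below (flip_order F ltD u) (fun c' => m (rcons u c')) c.
Proof. exact: position_from_rcons. Qed.

Definition tile_of m u : set R := [set` `]position m u, position m u + m u[].

Variable m : seq E -> R.
Hypotheses (m_ge0 : forall u, 0 <= m u)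
  (mr : forall u, m u = \sum_c m (rcons u c)).

Lemma position_sub u v : position m u <= position m (u ++ v) /\
  position m (u ++ v) + m (u ++ v) <= position m u + m u.
Proof.
elim/last_ind: v => [|v c [IH1 IH2]]; first by rewrite cats0.
rewrite -rcons_cat position_rcons; split.
  by rewrite (le_trans IH1) // lerDl below_ge0.
rewrite (le_trans _ IH2) // -addrA lerD2l [leRHS]mr.
by rewrite (below_le_total (w := fun c' => m (rcons (u ++ v) c'))).
Qed.

Lemma position_ge0 u : 0 <= position m u.
Proof. by have [] := position_sub [::] u. Qed.

Lemma position_le u : position m u + m u <= m [::].
Proof. by have [_] := position_sub [::] u; rewrite add0r. Qed.

Lemma tile_sub u v : tile_of m (u ++ v) `<=` tile_of m u.
Proof.
move=> t; have [h1 h2] := position_sub u v.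
rewrite /tile_of /= !in_itv /= => /andP[t1 t2].
by rewrite (le_lt_trans h1 t1) (lt_le_trans t2 h2).
Qed.

Lemma tile_cover_words u t n : 0 < m u ->
  position m u <= t <= position m u + m u ->
  exists v, [/\ size v = n, 0 < m (u ++ v) &
    position m (u ++ v) <= t <= position m (u ++ v) + m (u ++ v)].
Proof.
move=> mu0 tu; elim: n => [|n [v [sv mv /andP[t1 t2]]]].
  by exists [::]; rewrite cats0.
have := @tile_cover _ _ (flip_order F ltD (u ++ v))
  (fun c => m (rcons (u ++ v) c)) (t - position m (u ++ v)) (toF _).
rewrite -mr => /(_ (fun c => m_ge0 _) mv)[|c mc /andP[t3 t4]].
  by apply/andP; split; lra.
exists (rcons v c); rewrite size_rcons sv -rcons_cat position_rcons; split => //.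
by apply/andP; split; lra.
Qed.

Lemma tile_step u c d t s : flip_order F ltD u c d ->
  t <= position m (rcons u c) + m (rcons u c) -> position m (rcons u d) <= s ->
  t <= s.
Proof.
rewrite !position_rcons => cd tc sd.
have := @below_step _ _ _ (fun c' => m (rcons u c')) c d (toF u) (fun=> m_ge0 _) cd.
move: tc sd; lra.
Qed.

Lemma tile_trivI u v t : size u = size v -> tile_of m u t -> tile_of m v t -> u = v.
Proof.
move=> suv Ku Kv; have [||] := @prefix_or_differ E u v; first by rewrite suv.
  by move=> ->; rewrite suv take_size.
move=> [w [a [b [u' [v' [ab uE vE]]]]]]; exfalso.
have := @tile_sub (rcons w a) u' t; rewrite cat_rcons -uE => /(_ Ku).
have := @tile_sub (rcons w b) v' t; rewrite cat_rcons -vE => /(_ Kv).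
rewrite /tile_of /= !in_itv /= => /andP[b1 b2] /andP[a1 a2].
have [_ _ tot] := toF w; have := tot _ _ ab; case/orP => [lt|lt].
  have := tile_step lt (lexx _) (lexx _).
  by rewrite leNgt (lt_trans b1 a2).
have := tile_step lt (lexx _) (lexx _).
by rewrite leNgt (lt_trans a1 b2).
Qed.

End Positions.

(** * The distribution function of the image mass *)

Section Distribution.
Variables (R : realType) (E : finType) (F : {set E}) (ltD : rel E).
Hypothesis toD : strict_total_order ltD.
Variables (L : set (seq E)) (s : seq E -> R) (n0 : nat) (lam rho : seq E -> R).
Hypotheses (mp : mass_pair L s n0 lam rho) (s0 : forall b, 0 < s b).
Local Notation pos := (position F ltD).

Let lam0 := lam_ge0 mp.
Let rho0 := rho_ge0 mp.
Let lamr := lam_rcons mp.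
Let rhor := rho_rcons mp.

Definition clamp (l x : R) : R := Num.min (Num.max x 0) l.

Lemma clamp_le0 (l x : R) : 0 <= l -> x <= 0 -> clamp l x = 0.
Proof. by move=> l0 x0; rewrite /clamp max_r // min_l. Qed.

Lemma clamp_id (l x : R) : 0 <= x -> x <= l -> clamp l x = x.
Proof. by move=> x0 xl; rewrite /clamp max_l // min_l. Qed.

Lemma clamp_ge (l x : R) : 0 <= l -> l <= x -> clamp l x = l.
Proof. by move=> l0 lx; rewrite /clamp max_l ?min_r // (le_trans l0). Qed.

Lemma clamp_mono (l x y : R) : 0 <= l -> x <= y -> 0 <= clamp l y - clamp l x <= y - x.
Proof.
move=> l0 xy.
have [x0|x0] := leP x 0; have [y0|y0] := leP y 0.
- by rewrite !clamp_le0 // subrr lexx subr_ge0.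
- rewrite (clamp_le0 l0 x0) subr0; have [yl|ly] := leP y l.
    by rewrite (clamp_id (ltW y0) yl); apply/andP; split; lra.
  by rewrite (clamp_ge l0 (ltW ly)); apply/andP; split; lra.
- by have := lt_le_trans x0 (le_trans xy y0); rewrite ltxx.
- have [yl|ly] := leP y l.
    rewrite (clamp_id (ltW y0) yl) (clamp_id (ltW x0) (le_trans xy yl)).
    by apply/andP; split; lra.
  rewrite (clamp_ge l0 (ltW ly)); have [xl|lx] := leP x l.
    by rewrite (clamp_id (ltW x0) xl); apply/andP; split; lra.
  by rewrite (clamp_ge l0 (ltW lx)); apply/andP; split; lra.
Qed.

Definition tile_clamp w t := clamp (lam w) (t - pos lam w).

(* Mass given by [rho] to the part of the tile of [w] to the left of [t]. *)
Fixpoint rho_left n w t : R :=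
  if n is n'.+1 then \sum_c rho_left n' (rcons w c) t
  else s w * tile_clamp w t.

Lemma rho_left_before n w t : t <= pos lam w -> rho_left n w t = 0.
Proof.
elim: n w => [|n IH] w tw /=.
  by rewrite /tile_clamp clamp_le0 ?mulr0 // subr_le0.
rewrite big1 // => c _; apply: IH; apply: le_trans tw _.
by have [] := position_sub F toD lam0 lamr w [:: c]; rewrite cats1.
Qed.

Lemma rho_left_after n w t : (n + size w)%N = n0 ->
  pos lam w + lam w <= t -> rho_left n w t = rho w.
Proof.
elim: n w => [|n IH] w sw tw /=.
  rewrite /tile_clamp clamp_ge //; last by lra.
  by rewrite (rho_scale mp) -?sw ?add0n // take_size.
rewrite [RHS]rhor; apply: eq_bigr => c _; apply: IH.
  by rewrite size_rcons addnS -sw.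
by apply: le_trans _ tw; have [] := position_sub F toD lam0 lamr w [:: c];
  rewrite cats1.
Qed.

(** Among the letters after [w], those before [c] have their whole tile to the left of [t] and
    contribute their [rho]; those after [c] contribute 0. *)
Lemma rho_left_tile n w u t : size u = n -> (n + size w)%N = n0 ->
  pos lam (w ++ u) <= t <= pos lam (w ++ u) + lam (w ++ u) ->
  rho_left n w t = pos rho (w ++ u) - pos rho w +
    s (w ++ u) * (t - pos lam (w ++ u)).
Proof.
elim: n w u => [|n IH] w [|c u] //= su sw.
  rewrite cats0 subrr add0r => /andP[t1 t2].
  by rewrite /tile_clamp clamp_id //; lra.
rewrite -cat_rcons => tu; case: su => su.
have sw' : (n + size (rcons w c))%N = n0 by rewrite size_rcons addnS.
have toW := flip_order_total F w toD.
have [_ _ tot] := toW.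
have /andP[t1 t2] := tu.
have [p1 p2] := position_sub F toD lam0 lamr (rcons w c) u.
rewrite (bigD1 c) //= (IH (rcons w c) u su sw' tu) position_rcons.
rewrite (bigID (fun d => flip_order F ltD w d c)) /=.
rewrite [X in _ + (_ + X)]big1 ?addr0; last first.
  move=> d /andP[dc ndc]; apply: rho_left_before.
  have cd : flip_order F ltD w c d by have := tot d c dc; rewrite (negPf ndc).
  by apply: (tile_step toD lam0 cd _ (lexx _)); lra.
rewrite (_ : \sum_(i | _) _ = below (flip_order F ltD w) (fun c' => rho (rcons w c')) c).
  by ring.
rewrite /below; apply: eq_big => [d|d /andP[dc ldc]].
  have [->|dc] := eqVneq d c; last by [].
  by have [irr _ _] := toW; rewrite irr.
apply: rho_left_after; first by rewrite size_rcons addnS.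
by apply: (tile_step toD lam0 ldc (lexx _)); exact: le_trans p1 t1.
Qed.

Lemma tile_clamp_sum w t : tile_clamp w t = \sum_c tile_clamp (rcons w c) t.
Proof.
have toW := flip_order_total F w toD; have [irr _ tot] := toW.
have sub c := position_sub F toD lam0 lamr w [:: c].
have [tw|tw] := leP t (pos lam w).
  rewrite /tile_clamp clamp_le0 ?subr_le0 // big1 // => c _.
  rewrite clamp_le0 // subr_le0; have := sub c; rewrite cats1 => -[h _].
  exact: le_trans tw h.
have [wt|wt] := leP (pos lam w + lam w) t.
  rewrite /tile_clamp clamp_ge //; last by lra.
  rewrite lamr; apply: eq_bigr => c _; rewrite clamp_ge //.
  have := sub c; rewrite cats1 => -[_ h]; lra.
have lw : 0 < lam w by lra.
have [|v [sv lv tv]] := tile_cover_words (F := F) toD lam0 lamr (t := t) 1 lw.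
  by apply/andP; split; exact: ltW.
case: v sv lv tv => [|c []] // _; rewrite cats1 => lv /andP[t1 t2].
rewrite (bigD1 c) //= (bigID (fun d => flip_order F ltD w d c)) /=.
rewrite [X in _ = _ + (_ + X)]big1 ?addr0; last first.
  move=> d /andP[dc ndc]; rewrite /tile_clamp clamp_le0 // subr_le0.
  have cd : flip_order F ltD w c d by have := tot d c dc; rewrite (negPf ndc).
  exact: (tile_step toD lam0 cd t2 (lexx _)).
rewrite (_ : \sum_(i | _) _ = below (flip_order F ltD w) (fun c' => lam (rcons w c')) c).
  rewrite /tile_clamp !clamp_id // ?position_rcons; first by ring.
  - by move: t1; rewrite position_rcons; lra.
  - by move: t2; rewrite position_rcons; lra.
  - lra.
  - lra.
rewrite /below; apply: eq_big => [d|d /andP[dc ldc]].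
  by have [->|dc] := eqVneq d c; rewrite ?irr.
rewrite /tile_clamp clamp_ge // lerBrDl.
exact: (tile_step toD lam0 ldc (lexx _) t1).
Qed.

Lemma rho_left_bounds n w (lo hi : R) t t' :
  (forall b, size b = n0 -> lo <= s b <= hi) -> (n + size w)%N = n0 -> t <= t' ->
  lo * (tile_clamp w t' - tile_clamp w t) <= rho_left n w t' - rho_left n w t /\
  rho_left n w t' - rho_left n w t <= hi * (tile_clamp w t' - tile_clamp w t).
Proof.
move=> lohi + tt'; elim: n w => [|n IH] w sw /=.
  rewrite -mulrBr; have /andP[l h] := lohi w sw.
  have /andP[c0 _] : 0 <= tile_clamp w t' - tile_clamp w t <= t' - t.
    have := @clamp_mono (lam w) (t - pos lam w) (t' - pos lam w) (lam0 w).
    by rewrite lerD2r => /(_ tt'); rewrite opprB addrA subrK.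
  by rewrite !ler_wpM2r.
rewrite !(tile_clamp_sum w) -!sumrB !mulr_sumr.
by split; apply: ler_sum => c _; have [] := IH (rcons w c);
  rewrite ?size_rcons ?addnS.
Qed.

Lemma slope_bounds : exists lo hi : R, [/\ 0 < lo, 0 < hi &
  forall b, size b = n0 -> lo <= s b <= hi].
Proof.
have bnd (r : seq (seq E)) : exists lo hi : R, [/\ 0 < lo, 0 < hi &
    forall b, b \in r -> lo <= s b <= hi].
  elim: r => [|a r [lo [hi [l0 h0 IH]]]]; first by exists 1, 1.
  exists (Num.min (s a) lo), (Num.max (s a) hi); split.
  - by rewrite lt_min s0.
  - by rewrite lt_max s0.
  - move=> b; rewrite inE => /orP[/eqP ->|/IH/andP[h1 h2]].
      by rewrite ge_min le_max lexx.
    by rewrite ge_min le_max h1 h2 !orbT.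
have [lo [hi [l0 h0 lh]]] := bnd (words E n0); exists lo, hi; split=> // b sb.
apply: lh; rewrite -{}sb; elim: b => //= a b IH.
by apply: allpairs_f => //; exact: mem_index_enum.
Qed.

(** The primitive of the slope. It is affine of slope [s] from the [lam]-tile of a word of length at
    least [n0] onto its [rho]-tile, and its Lipschitz bounds hold across the ends of tiles. *)
Definition rho_distribution t := rho_left n0 [::] t.

(** The density lies between the extreme values of [s] on the finitely many blocks. The lower bound
    is confined to [[0, 1]], outside which the function is constant. *)
Lemma rho_distribution_lipschitz : exists lo hi : R, [/\ 0 < lo, 0 < hi,
  forall t t', t <= t' -> rho_distribution t' - rho_distribution t <= hi * (t' - t),
  forall t t', t <= t' -> 0 <= rho_distribution t' - rho_distribution t
  & forall t t', 0 <= t -> t <= t' -> t' <= 1 ->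
    lo * (t' - t) <= rho_distribution t' - rho_distribution t].
Proof.
have [lo [hi [l0 h0 lh]]] := slope_bounds; exists lo, hi.
have e : (n0 + size (@nil E))%N = n0 by rewrite addn0.
have cl t t' : t <= t' ->
    0 <= tile_clamp [::] t' - tile_clamp [::] t <= t' - t.
  move=> tt'.
  have := @clamp_mono (lam [::]) (t - pos lam [::]) (t' - pos lam [::]) (lam0 _).
  by rewrite lerD2r => /(_ tt'); rewrite opprB addrA subrK.
split=> // t t' => [tt'|tt'|t0 tt' t1].
- have [_ h] := rho_left_bounds lh e tt'; apply: le_trans h _.
  by have /andP[_ h] := cl _ _ tt'; rewrite ler_pM2l.
- have [h _] := rho_left_bounds lh e tt'; apply: le_trans _ h.
  by have /andP[h _] := cl _ _ tt'; rewrite mulr_ge0 // ltW.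
- have [h _] := rho_left_bounds lh e tt'; apply: le_trans _ h.
  rewrite /tile_clamp (lam_nil mp) /position /= !subr0 !clamp_id //.
    exact: le_trans tt' t1.
  exact: le_trans t0 tt'.
Qed.

Lemma position_scale b r : size b = n0 ->
  pos rho (b ++ r) - pos rho b = s b * (pos lam (b ++ r) - pos lam b).
Proof.
move=> sb; elim/last_ind: r => [|r c IH]; first by rewrite cats0 !subrr mulr0.
rewrite -rcons_cat !position_rcons.
set lb := below _ (fun c' => lam _) _.
have -> : below (flip_order F ltD (b ++ r))
    (fun c' => rho (rcons (b ++ r) c')) c = s b * lb.
  rewrite /lb /below mulr_sumr; apply: eq_bigr => d _.
  rewrite (rho_scale mp); last by rewrite size_rcons size_cat; lia.
  by rewrite -cats1 -catA take_size_cat.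
have -> : pos rho (b ++ r) = pos rho b + s b * (pos lam (b ++ r) - pos lam b).
  by rewrite -IH addrC subrK.
by ring.
Qed.

Lemma rho_distribution_tile w t : (n0 <= size w)%N ->
  pos lam w <= t <= pos lam w + lam w ->
  rho_distribution t = pos rho w + s (take n0 w) * (t - pos lam w).
Proof.
move=> nw; rewrite -{1 2 3 4 6}(cat_take_drop n0 w).
set b := take n0 w; set r := drop n0 w.
have sb : size b = n0 by rewrite size_takel.
have [p1 p2] := position_sub F toD lam0 lamr b r => /andP[t1 t2].
rewrite /rho_distribution (@rho_left_tile n0 [::] b) ?addn0 //=; last first.
  by apply/andP; split; lra.
rewrite [pos rho [::]](_ : _ = 0) // subr0; have h := position_scale r sb.
have -> : pos rho (b ++ r) = pos rho b + s b * (pos lam (b ++ r) - pos lam b).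
  by rewrite -h addrC subrK.
by ring.
Qed.

End Distribution.

(** * From conformal masses to affine interval exchanges *)

(** As [hlt] lifts [lt], what precedes [x] consists of the whole fibres before that of [x] and of
    the earlier part of its own. *)
Lemma below_split (R : realType) (X A : finType) (g : X -> A) (hlt : rel X)
    (lt : rel A) (f : X -> R) x :
  strict_total_order hlt -> strict_total_order lt ->
  (forall x y, g x != g y -> lt (g x) (g y) -> hlt x y) ->
  below hlt f x = below lt (fun e => \sum_(y | g y == e) f y) (g x) +
    \sum_(y | (g y == g x) && hlt y x) f y.
Proof.
move=> toh tol comp; have [irr _ tot] := tol.
rewrite /below (bigID (fun y => g y == g x)) /= addrC; congr (_ + _); last first.
  by apply: eq_bigl => y; rewrite andbC.
rewrite [LHS](partition_big g (fun e => lt e (g x))) => [|y /andP[yx gyx]].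
  apply: eq_bigr => e ex; apply: eq_bigl => y.
  have [gye|ne] := eqVneq (g y) e; last by rewrite andbF.
  have enx : e != g x by apply/eqP => h; move: ex; rewrite h irr.
  by rewrite andbT gye enx andbT; apply: comp; rewrite gye.
have := tot _ _ gyx; case/orP => // xy.
have hxy : hlt x y by apply: comp => //; rewrite eq_sym.
by case: (strict_total_asym toh yx hxy).
Qed.

(** * Images of tiles under the shift *)

Section Images.
Variables (R : realType) (E : finType) (F : {set E}) (ltA ltD : rel E).
Variables (L : set (seq E)) (s : seq E -> R) (n0 : nat) (lam rho : seq E -> R).
Hypotheses (lL : is_language L) (oc : flipped_order_condition F L ltA ltD)
  (mp : mass_pair L s n0 lam rho) (s0 : forall b, 0 < s b)
  (Llam : forall u, L u -> 0 < lam u).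
Local Notation pos := (position F ltD).

Let fL : factorial_lang L. Proof. by have [] := lL. Qed.
Let toA : strict_total_order ltA. Proof. by have [] := oc. Qed.
Let toD : strict_total_order ltD. Proof. by have [] := oc. Qed.

Lemma rho_le_cat u v : rho (u ++ v) <= rho u.
Proof.
have rho0 := rho_ge0 mp.
elim/last_ind: v => [|v c IH]; first by rewrite cats0.
rewrite -rcons_cat; apply: le_trans IH; rewrite [leRHS](rho_rcons mp) (bigD1 c) //=.
by rewrite lerDl sumr_ge0.
Qed.

(** Extending [u] by [n0] letters reaches words on which [rho] is a positive multiple of [lam]. *)
Lemma rho_gt0 u : L u <-> 0 < rho u.
Proof.
split=> [Lu|ru].
  have [q sq Lq] := extend_right lL n0 Lu.
  apply: lt_le_trans (rho_le_cat u q); rewrite (rho_scale mp).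
    by rewrite mulr_gt0 // Llam.
  by rewrite size_cat sq leq_addl.
have [q sq rq] : exists2 q, size q = n0 & 0 < rho (u ++ q).
  elim: n0 => [|n [q sq rq]]; first by exists [::]; rewrite ?cats0.
  apply: contrapT => no; move: rq; rewrite (rho_rcons mp) big1 ?ltxx // => c _.
  apply/eqP; rewrite eq_le (rho_ge0 mp) andbT leNgt; apply/negP => rc; apply: no.
  by exists (rcons q c); rewrite ?size_rcons ?sq // -rcons_cat.
apply: (@fL _ (u ++ q)); first by apply/infixP; exists [::], q.
apply: (lam_support mp); move: rq; rewrite (rho_scale mp).
  by rewrite pmulr_rgt0.
by rewrite size_cat sq leq_addl.
Qed.

(* Left endpoint of the image of the tile of [a :: v]. *)
Definition image_position a v : R :=
  below ltA (fun a' => rho [:: a']) a + pos (fun u => rho (a :: u)) v.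

(* The order condition makes the two ways of ordering the pairs [(a, v)],
   by [a] first or by [v] first, agree on the pairs of positive mass. *)
Lemma image_positionE a v : L (a :: v) ->
  image_position a v = pos lam v + below ltA (fun a' => rho (a' :: v)) a.
Proof.
rewrite /image_position; elim/last_ind: v => [|v c IH] Lavc.
  by rewrite /position /= addr0 add0r.
have Lav : L (a :: v).
  by apply: fL Lavc; apply/infixP; exists [::], [:: c]; rewrite /= cats1.
rewrite !position_rcons addrA IH // -!addrA; congr (_ + _).
have toF := flip_order_total F v toD; have [irrF _ totF] := toF.
have [irrA _ totA] := toA.
set lt := flip_order F ltD v in toF irrF totF *.
pose f a' c' := rho (a' :: rcons v c').
(* By the order condition, a pair [(a', c')] that compares with [(a, c)] in opposite ways on the two
   sides carries no mass. *)
have f0 a' c' : a' != a -> c' != c -> ltA a' a != lt c' c -> f a' c' = 0.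
  move=> a'a c'c ne; apply/eqP; rewrite eq_le (rho_ge0 mp) andbT leNgt.
  apply/negP => /rho_gt0 La'c'.
  have := order_condition_pair fL oc a'a c'c La'c' Lavc; rewrite -/lt => h.
  by move/negP: ne; apply; apply/eqP; apply/idP/idP => /h.
(* The middle term collects the pairs with [a' < a] and [c' <= c], and those with [a' = a] and
   [c' < c]; each side of the goal differs from it by pairs without mass. *)
transitivity (\sum_(a' | ltA a' a) (below lt (f a') c + f a' c) +
    below lt (f a) c).
  congr (_ + _); apply: eq_bigr => a' a'a.
  rewrite (rho_rcons mp) -(below_compl _ c toF) -[RHS]addr0; congr (_ + _).
  rewrite /below big1 // => c' cc'; apply: f0.
  - by apply/eqP => h; move: a'a; rewrite h irrA.
  - by apply/eqP => h; move: cc'; rewrite h irrF.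
  - rewrite a'a; apply/negP => /eqP/esym c'c.
    by have := strict_total_asym toF cc' c'c.
rewrite big_split /= addrAC; congr (_ + _).
rewrite /below exchange_big /= -big_split /=; apply: eq_bigr => c' c'c.
rewrite (lam_cons mp) -(below_compl _ a toA) -[LHS]addr0; congr (_ + _).
symmetry; rewrite /below big1 // => a' aa'; apply: f0.
- by apply/eqP => h; move: aa'; rewrite h irrA.
- by apply/eqP => h; move: c'c; rewrite h irrF.
- rewrite c'c; apply/negP => /eqP a'a.
  by have := strict_total_asym toA aa' a'a.
Qed.

(** The image of the tile of [a :: v] lies in the tile of [v]: the exchange will act on tiles as the
    shift. *)
Lemma image_tile_sub a v : L (a :: v) ->
  pos lam v <= image_position a v /\
  image_position a v + rho (a :: v) <= pos lam v + lam v.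
Proof.
move=> Lav; rewrite image_positionE //; split.
  by rewrite lerDl below_ge0 // => a'; exact: (rho_ge0 mp).
rewrite -addrA lerD2l (lam_cons mp).
by apply: (below_le_total (w := fun a' => rho (a' :: v))) => // a';
  exact: (rho_ge0 mp).
Qed.

Lemma image_tile_disjoint a v a' v' t : L (a :: v) -> L (a' :: v') ->
  size v = size v' ->
  image_position a v < t < image_position a v + rho (a :: v) ->
  image_position a' v' < t < image_position a' v' + rho (a' :: v') ->
  a :: v = a' :: v'.
Proof.
move=> Lav Lav' svv' /andP[t1 t2] /andP[t3 t4].
have [h1 h2] := image_tile_sub Lav; have [h3 h4] := image_tile_sub Lav'.
have vv' : v = v'.
  apply: (tile_trivI toD (lam_ge0 mp) (lam_rcons mp) (t := t) (F := F)) => //;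
    by rewrite /tile_of /= in_itv /=; apply/andP; split; lra.
subst v'; congr (_ :: _); apply/eqP; apply: contrapT => /negP ne.
move: t1 t2 t3 t4; rewrite !image_positionE // => t1 t2 t3 t4.
have [_ _ tot] := toA.
have r0 d : 0 <= rho (d :: v) by exact: (rho_ge0 mp).
have := tot _ _ ne; case/orP => lt.
  have := below_step (w := fun d => rho (d :: v)) toA r0 lt.
  by move: t1 t2 t3 t4; lra.
have := below_step (w := fun d => rho (d :: v)) toA r0 lt.
by move: t1 t2 t3 t4; lra.
Qed.

Lemma image_tile_cover n t : n0 = n.+1 -> 0 <= t <= 1 ->
  exists a v, [/\ size v = n, L (a :: v) &
    image_position a v <= t <= image_position a v + rho (a :: v)].
Proof.
move=> n0E t01; have l1 := lam_nil mp.
have [||v [sv lv tv]] := @tile_cover_words _ _ F _ toD lam (lam_ge0 mp)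
  (lam_rcons mp) [::] t n.
- by rewrite l1.
- by rewrite l1 add0r.
move: lv tv; rewrite cat0s => lv /andP[t1 t2].
have r0 d : 0 <= rho (d :: v) by exact: (rho_ge0 mp).
have lE := lam_cons mp v.
have [||a ra /andP[t3 t4]] := @tile_cover _ _ ltA (fun d => rho (d :: v))
  (t - pos lam v) toA r0.
- by rewrite -lE.
- by rewrite -lE; apply/andP; split; lra.
have Lav : L (a :: v) by apply/rho_gt0.
by exists a, v; split=> //; rewrite image_positionE //; apply/andP; split; lra.
Qed.

End Images.

(** * The exchange on the tiles of the splitting *)

Section Exchange.
Variables (R : realType) (A : finType) (F : {set A}) (k : A -> nat).
Local Notation X := (split_alphabet k).
Local Notation phi := (@split_letter A k).
Variables (L : set (seq A)) (L' : set (seq X)).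
Variables (ltA ltD : rel A) (hltA hltD : rel X).
Variables (s : seq X -> R) (n : nat) (lam rho : seq X -> R).
Local Notation hF := [set x : X | split_letter x \in F]%SET.
Hypotheses (lL : is_language L) (toA : strict_total_order ltA)
  (toD : strict_total_order ltD).
Hypotheses (lL' : is_language L') (LE : L = [set map phi v | v in L'])
  (oc : flipped_order_condition hF L' hltA hltD)
  (unflipped : forall x y : X, phi x = phi y -> phi x \notin F ->
     hltA x y = hltD x y)
  (flipped : forall x y : X, phi x = phi y -> phi x \in F ->
     hltA x y = hltD y x)
  (lift_lt : forall x y : X, phi x != phi y ->
     (ltA (phi x) (phi y) -> hltA x y) /\ (ltD (phi x) (phi y) -> hltD x y)).
Hypotheses (mp : mass_pair L' s n.+1 lam rho) (s0 : forall b, 0 < s b)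
  (Llam : forall u, L' u -> 0 < lam u).
Local Notation pos := (position hF hltD).
Local Notation tile := (tile_of hF hltD lam).
Local Notation impos := (image_position hF hltA hltD rho).
Local Notation H := (rho_distribution hF hltD s n.+1 lam).

Let fL' : factorial_lang L'. Proof. by have [] := lL'. Qed.
Let toA' : strict_total_order hltA. Proof. by have [] := oc. Qed.
Let toD' : strict_total_order hltD. Proof. by have [] := oc. Qed.
Let lam0 := lam_ge0 mp.
Let rho0 := rho_ge0 mp.
Let lamr := lam_rcons mp.

Definition letter_mass (m : seq X -> R) (e : A) : R :=
  \sum_(x | phi x == e) m [:: x].

(** A whole fibre of tiles, placed in the order of [A]; it contains the tiles of its fibre because
    [hltD] lifts [ltD]. *)
Definition coding_interval (e : A) : set R :=
  let l := below ltD (letter_mass lam) e in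
  [set` `]l, l + letter_mass lam e[].

Lemma letter_mass_ge0 m e : (forall u, 0 <= m u) -> 0 <= letter_mass m e.
Proof. by move=> m0; rewrite sumr_ge0. Qed.

Lemma letter_mass_gt0 e : 0 < letter_mass lam e.
Proof.
have [_ _ _ /(_ e)] := lL; rewrite LE => -[[|x []] //= L'x [<-]].
rewrite /letter_mass (bigD1 x) //=; apply: ltr_pwDl; first exact: Llam.
by rewrite sumr_ge0.
Qed.

Lemma coding_interval_open e : open_interval (coding_interval e).
Proof.
exists (below ltD (letter_mass lam) e),
  (below ltD (letter_mass lam) e + letter_mass lam e); split => //.
by rewrite ltrDl letter_mass_gt0.
Qed.

Lemma coding_interval_unique e e' t : coding_interval e t ->
  below ltD (letter_mass lam) e' <= t <=
    below ltD (letter_mass lam) e' + letter_mass lam e' -> e = e'.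
Proof.
rewrite /coding_interval /= in_itv /= => /andP[t1 t2] /andP[t3 t4].
apply/eqP; apply: contrapT => /negP ne; have [_ _ tot] := toD.
have lm0 d : 0 <= letter_mass lam d by exact: letter_mass_ge0.
have := tot _ _ ne; case/orP => lt; have := below_step toD lm0 lt.
  by move: t1 t2 t3 t4; lra.
by move: t1 t2 t3 t4; lra.
Qed.

Lemma coding_interval_triv : trivIset setT coding_interval.
Proof.
move=> e e' _ _ [t [Je]]; rewrite /coding_interval /= in_itv /= => /andP[t1 t2].
by apply: coding_interval_unique Je _; rewrite !ltW.
Qed.

Lemma position_letter m (x : X) : pos m [:: x] =
  below ltD (letter_mass m) (phi x) +
    \sum_(y | (phi y == phi x) && hltD y x) m [:: y].
Proof.
rewrite /position /= addr0; apply: (below_split (g := phi)) => //.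
by move=> y z yz; have [] := lift_lt yz.
Qed.

Lemma letter_mass_split m (x : X) (lt : rel X) : strict_total_order lt ->
  letter_mass m (phi x) = \sum_(y | (phi y == phi x) && lt y x) m [:: y] +
    m [:: x] + \sum_(y | (phi y == phi x) && lt x y) m [:: y].
Proof.
move=> to; have [irr _ tot] := to.
rewrite /letter_mass (bigD1 x) //= addrC (bigID (fun y => lt y x)) /=.
rewrite -!addrA; congr (_ + _).
  apply: eq_bigl => y; have [->|yx] := eqVneq y x; first by rewrite irr !andbF.
  by rewrite andbT.
rewrite addrC; congr (_ + _); apply: eq_bigl => y.
have [->|yx] := eqVneq y x; first by rewrite irr !andbF.
rewrite andbT; have := tot _ _ yx.
case: (boolP (lt y x)) => [yx' _|nyx /= ->] //.
have -> : lt x y = false.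
  by apply/negP => xy; exact: (strict_total_asym to xy yx').
by rewrite !andbF.
Qed.

Lemma tile_coding_interval (x : X) v t :
  pos lam (x :: v) <= t <= pos lam (x :: v) + lam (x :: v) ->
  below ltD (letter_mass lam) (phi x) <= t <=
    below ltD (letter_mass lam) (phi x) + letter_mass lam (phi x).
Proof.
have [h1 h2] := position_sub hF toD' lam0 lamr [:: x] v.
move=> /andP[t1 t2]; move: h1 h2; rewrite cat1s position_letter => h1 h2.
have := letter_mass_split lam x toD'.
have h3 : 0 <= \sum_(y | (phi y == phi x) && hltD y x) lam [:: y] by rewrite sumr_ge0.
have h4 : 0 <= \sum_(y | (phi y == phi x) && hltD x y) lam [:: y] by rewrite sumr_ge0.
by move=> h5; apply/andP; split; lra.
Qed.

Lemma tile_in_coding_interval (x : X) v : tile (x :: v) `<=` coding_interval (phi x).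
Proof.
move=> t; have [h1 h2] := position_sub hF toD' lam0 lamr [:: x] v.
rewrite /tile_of /coding_interval /= !in_itv /= => /andP[t1 t2].
move: h1 h2; rewrite cat1s position_letter => h1 h2.
have := letter_mass_split lam x toD'.
have h3 : 0 <= \sum_(y | (phi y == phi x) && hltD y x) lam [:: y] by rewrite sumr_ge0.
have h4 : 0 <= \sum_(y | (phi y == phi x) && hltD x y) lam [:: y] by rewrite sumr_ge0.
by move=> h5; apply/andP; split; lra.
Qed.

(** Both positions are measured from the left end of the fibre of [x]. They agree for a single
    letter, where the two orders coincide on the fibre, and grow alike: as [x] is not flipped, [v]
    and [x :: v] order the next letter in the same way. *)
Lemma image_position_unflipped (x : X) v : phi x \notin F ->
  impos x v - below ltA (letter_mass rho) (phi x) =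
  pos rho (x :: v) - below ltD (letter_mass rho) (phi x).
Proof.
move=> xF; elim/last_ind: v => [|v c IH].
  rewrite position_letter /image_position /position /= addr0.
  rewrite (below_split (g := phi) (lt := ltA)) //; last first.
    by move=> y z yz; have [] := lift_lt yz.
  rewrite ![_ + _ - _]addrAC !subrr !add0r; apply: eq_bigl => y.
  by have [yx|//] := eqVneq (phi y) (phi x); rewrite unflipped // yx.
rewrite -rcons_cons position_rcons /image_position position_rcons addrA.
rewrite -/(impos x v) addrAC IH addrAC; congr (_ + _ - _).
apply: eq_bigl => d; rewrite /flip_order /= inE.
by rewrite (negPf xF).
Qed.

(** A flipped [x] changes the parity, so [v] and [x :: v] order the next letter in opposite ways:
    what lies below on one side lies above on the other. Hence a right end corresponds to a left
    end, measured from opposite ends of the fibre. *)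
Lemma image_position_flipped (x : X) v : phi x \in F ->
  impos x v + rho (x :: v) - below ltA (letter_mass rho) (phi x) =
  letter_mass rho (phi x) -
    (pos rho (x :: v) - below ltD (letter_mass rho) (phi x)).
Proof.
move=> xF; elim/last_ind: v => [|v c IH].
  rewrite position_letter /image_position /position /= addr0.
  rewrite (below_split (g := phi) (lt := ltA)) //; last first.
    by move=> y z yz; have [] := lift_lt yz.
  rewrite (letter_mass_split rho x toA').
  rewrite [X in _ = _ - (_ + X - _)](_ : _ =
    \sum_(y | (phi y == phi x) && hltA x y) rho [:: y]); first by ring.
  apply: eq_bigl => y; have [yx|//] := eqVneq (phi y) (phi x).
  by rewrite (flipped (esym yx)) // .
rewrite -rcons_cons position_rcons /image_position position_rcons addrA.
rewrite -/(impos x v).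
have toV := flip_order_total hF v toD'.
have := rho_rcons mp (x :: v); rewrite -(below_compl _ c toV) => rE.
rewrite [X in _ = _ - (_ + X - _)](_ : _ =
  below (fun y z => flip_order hF hltD v z y) (fun d => rho (x :: rcons v d)) c).
  by move: IH; rewrite rE /=; lra.
apply: eq_bigl => d; rewrite /flip_order /= inE xF add1n /=.
by case: (odd _).
Qed.

(** [H] followed by one translation, or one reflection if [e] is flipped, onto the place of [e] in
    the order [ltA]. One formula for the whole coding interval gives continuity across the ends of
    tiles. *)
Definition exchange_branch (e : A) (t : R) : R :=
  let l := below ltA (letter_mass rho) e in
  let h := H t - below ltD (letter_mass rho) e in
  if e \in F then l + letter_mass rho e - h else l + h.

Definition exchange (t : R) : R :=
  if [pick e | `[< coding_interval e t >]] is Some e then exchange_branch e t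
  else 0.

Lemma exchange_coding e t : coding_interval e t ->
  exchange t = exchange_branch e t.
Proof.
move=> Je; rewrite /exchange; case: pickP => [e' /asboolP Je'|/(_ e)].
  by rewrite (@coding_interval_triv e e') //; exists t.
by move=> /asboolP.
Qed.

Definition slope (w : seq X) : R :=
  if w is x :: _ then (if phi x \in F then - s (take n.+1 w) else s (take n.+1 w))
  else 1.

Definition intercept (w : seq X) : R :=
  if w is x :: v then
    (if phi x \in F then impos x v + rho w + s (take n.+1 w) * pos lam w
     else impos x v - s (take n.+1 w) * pos lam w)
  else 0.

Lemma slope_neq0 w : slope w != 0.
Proof.
case: w => [|x w]; first by rewrite oner_neq0.
by rewrite /slope; case: ifP => _; rewrite ?oppr_eq0 gt_eqF.
Qed.

Lemma exchange_tile (x : X) v t : (n <= size v)%N -> tile (x :: v) t ->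
  exchange t = slope (x :: v) * t + intercept (x :: v).
Proof.
move=> nv Kt; rewrite (exchange_coding (tile_in_coding_interval Kt)).
have tK : pos lam (x :: v) <= t <= pos lam (x :: v) + lam (x :: v).
  by move: Kt; rewrite /tile_of /= in_itv /= => /andP[/ltW -> /ltW ->].
have nv' : (n.+1 <= size (x :: v))%N by [].
rewrite /exchange_branch (rho_distribution_tile toD' mp nv' tK) /slope /intercept.
case: ifP => xF.
  by have := image_position_flipped v xF; set sb := s _; lra.
by have := image_position_unflipped v (negbT xF); set sb := s _; lra.
Qed.

Lemma image_of_tile (x : X) v : (n <= size v)%N ->
  exchange @` tile (x :: v) =
    [set` `]impos x v, impos x v + rho (x :: v)[].
Proof.
move=> nv; have rE : rho (x :: v) = s (take n.+1 (x :: v)) * lam (x :: v).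
  exact: (rho_scale mp).
transitivity ((fun t => slope (x :: v) * t + intercept (x :: v)) @` tile (x :: v)).
  apply/seteqP; split=> [_ [t Kt <-]|_ [t Kt <-]].
    by exists t => //; rewrite (@exchange_tile x v t).
  by exists t => //; rewrite (@exchange_tile x v t).
rewrite affine_image_itvoo ?slope_neq0 // /slope /intercept.
have sb0 := s0 (take n.+1 (x :: v)).
case: (boolP (phi x \in F)) => xF.
  rewrite oppr_lt0 sb0 rE; set sb := s _; set p := pos _ _.
  have -> : - sb * (p + lam (x :: v)) + (impos x v + sb * lam (x :: v) + sb * p) =
    impos x v by ring.
  by have -> : - sb * p + (impos x v + sb * lam (x :: v) + sb * p) =
    impos x v + sb * lam (x :: v) by ring.
rewrite ltNge (ltW sb0) /= rE; set sb := s _; set p := pos _ _.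
have -> : sb * p + (impos x v - sb * p) = impos x v by ring.
by have -> : sb * (p + lam (x :: v)) + (impos x v - sb * p) =
  impos x v + sb * lam (x :: v) by ring.
Qed.

(** One step erases the first letter; with at least [n + 1] letters the tile lies where the exchange
    is affine. *)
Lemma exchange_tile_behead (x : X) v t : (n <= size v)%N -> L' (x :: v) ->
  tile (x :: v) t -> tile v (exchange t).
Proof.
move=> nv Lxv Kt; have [h1 h2] := image_tile_sub lL' oc mp s0 Llam Lxv.
have : (exchange @` tile (x :: v)) (exchange t) by exists t.
rewrite image_of_tile // /tile_of /= !in_itv /= => /andP[t1 t2].
by apply/andP; split; lra.
Qed.

Lemma coding_interval_sub01 e t : coding_interval e t -> 0 <= t <= 1.
Proof.
rewrite /coding_interval /= in_itv /= => /andP[t1 t2].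
have lm0 d : 0 <= letter_mass lam d by exact: letter_mass_ge0.
have h1 : 0 <= below ltD (letter_mass lam) e by exact: below_ge0.
have := below_le_total e toD lm0.
have -> : \sum_e letter_mass lam e = 1.
  rewrite -(lam_nil mp) lamr [RHS](partition_big phi xpredT) //=.
move=> h2; apply/andP; split; lra.
Qed.

Lemma exchange_flip_monotone e :
  flip_monotone (e \in F) (coding_interval e) exchange.
Proof.
move=> t t' Jt Jt' tt'; rewrite !(exchange_coding (e := e)) // /exchange_branch.
have [lo [hi [lo0 _ _ _ h]]] := rho_distribution_lipschitz hF toD' mp s0.
have /andP[t0 _] := coding_interval_sub01 Jt.
have /andP[_ t1] := coding_interval_sub01 Jt'.
have := h t t' t0 (ltW tt') t1.
have : 0 < lo * (t' - t) by rewrite mulr_gt0 // subr_gt0.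
by case: (e \in F) => h1 h2; lra.
Qed.

Lemma exchange_continuous e : {within coding_interval e, continuous exchange}.
Proof.
have oJ : open (coding_interval e) by exact: itv_open.
rewrite continuous_open_subspace // => t; rewrite inE => Jt.
have [lo [hi [_ hi0 up mono _]]] := rho_distribution_lipschitz hF toD' mp s0.
apply/cvgrPdist_lt => eps eps0.
have [d d0 dJ] := itvoo_sub 0 oJ Jt.
apply/nbhs_ballP; exists (Num.min d (eps / hi)) => /=.
  by rewrite lt_min d0 divr_gt0.
move=> t'; rewrite /ball /= lt_min => /andP[td tt'].
have Jt' : coding_interval e t'.
  by apply: dJ; rewrite -ball_itv.
rewrite !(exchange_coding (e := e)) // /exchange_branch.
have : `|H t - H t'| <= hi * `|t - t'|.
  have [le|/ltW le] := leP t t'.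
    have h1 := up _ _ le; have h2 := mono _ _ le.
    by rewrite distrC (distrC t) !ger0_norm // subr_ge0.
  have h1 := up _ _ le; have h2 := mono _ _ le.
  by rewrite !ger0_norm // subr_ge0.
have : hi * `|t - t'| < eps by rewrite mulrC -ltr_pdivlMr.
case: ifP => _ h1 h2.
  rewrite [X in `|X|](_ : _ = H t' - H t); last by ring.
  by rewrite distrC; exact: le_lt_trans h2 h1.
rewrite [X in `|X|](_ : _ = H t - H t'); last by ring.
exact: le_lt_trans h2 h1.
Qed.

(** Slopes depend on [n + 1] letters, so the defining intervals are tiles of words of that length.
    Words outside [L'] have empty tiles and are left out. *)
Definition exchange_alphabet : finType := {b : n.+1.-tuple X | `[< L' b >]}.

Definition block (b : exchange_alphabet) : seq X := tval (val b).

Lemma block_inj : injective block.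
Proof. by move=> b b' h; apply: val_inj; apply: val_inj. Qed.

Lemma block_lang b : L' (block b).
Proof. by apply/asboolP; exact: (valP b). Qed.

Lemma size_block b : size (block b) = n.+1.
Proof. by rewrite /block size_tuple. Qed.

Lemma block_cons b : exists x v, block b = x :: v /\ size v = n.
Proof.
have := size_block b; case: (block b) => // x v [sv].
by exists x, v.
Qed.

Lemma blockP w : size w = n.+1 -> L' w -> exists b, block b = w.
Proof.
move=> sw Lw; have tw : size w == n.+1 by apply/eqP.
have pw : `[< L' (Tuple tw) >] by apply/asboolP.
by exists (exist _ (Tuple tw) pw).
Qed.

Definition block_letter (b : exchange_alphabet) : A := phi (thead (val b)).

Lemma block_letterE b x v : block b = x :: v -> block_letter b = phi x.
Proof.
rewrite /block /block_letter; case: b => /= t _.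
by case/tupleP: t => y t' /= [-> _]; rewrite theadE.
Qed.

Lemma block_partition : interval_partition (fun b => tile (block b)).
Proof.
split.
- move=> b; exists (pos lam (block b)), (pos lam (block b) + lam (block b)).
  by split => //; rewrite ltrDl Llam //; exact: block_lang.
- move=> b b' _ _ [t [Kb Kb']]; apply: block_inj.
  by apply: (tile_trivI toD' lam0 lamr _ Kb Kb'); rewrite !size_block.
- apply/seteqP; split=> [t [b _]|t].
    have lb := Llam (block_lang b).
    rewrite closure_itvoo ?ltrDl //= !in_itv /= => /andP[t1 t2].
    have h1 := position_ge0 hF toD' lam0 lamr (block b).
    have h2 := position_le hF toD' lam0 lamr (block b).
    by rewrite (lam_nil mp) in h2; apply/andP; split; lra.
  rewrite /= in_itv /= => t01.
  have [||v [sv lv tv]] := @tile_cover_words _ _ hF _ toD' lam lam0 lamr [::] t n.+1.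
  - by rewrite (lam_nil mp).
  - by rewrite (lam_nil mp) add0r.
  have [b bv] := blockP sv (lam_support mp lv).
  by exists b => //; rewrite bv closure_itvoo ?ltrDl //= in_itv.
Qed.

Lemma block_image_partition :
  interval_partition (fun b => exchange @` tile (block b)).
Proof.
have imE b : exists x v, [/\ block b = x :: v, size v = n, L' (x :: v) &
    exchange @` tile (block b) = [set` `]impos x v, impos x v + rho (x :: v)[]].
  have [x [v [bE sv]]] := block_cons b; exists x, v.
  have Lb := block_lang b; rewrite bE in Lb.
  by split=> //; rewrite bE image_of_tile // sv.
split.
- move=> b; have [x [v [_ _ Lb ->]]] := imE b.
  exists (impos x v), (impos x v + rho (x :: v)); split=> //.
  by rewrite ltrDl; exact/(rho_gt0 lL' mp s0 Llam).
- move=> b b' _ _ [t []]; have [x [v [bE sv Lb ->]]] := imE b.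
  have [x' [v' [bE' sv' Lb' ->]]] := imE b'.
  rewrite /= !in_itv /= => t1 t2; apply: block_inj; rewrite bE bE'.
  apply: (image_tile_disjoint lL' oc mp s0 Llam Lb Lb' _ t1 t2).
  by rewrite sv sv'.
- apply/seteqP; split=> [t [b _]|t].
    have [x [v [_ _ Lb ->]]] := imE b.
    have rb : 0 < rho (x :: v) by exact/(rho_gt0 lL' mp s0 Llam).
    rewrite closure_itvoo ?ltrDl //= !in_itv /= => /andP[t1 t2].
    have [h1 h2] := image_tile_sub lL' oc mp s0 Llam Lb.
    have h3 := position_ge0 hF toD' lam0 lamr v.
    have h4 := position_le hF toD' lam0 lamr v.
    by rewrite (lam_nil mp) in h4; apply/andP; split; lra.
  rewrite /= in_itv /= => t01.
  have [a [v [sv Lav tav]]] := image_tile_cover lL' oc mp s0 Llam erefl t01.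
  have [|b bE] := blockP _ Lav; first by rewrite /= sv.
  exists b => //; rewrite bE image_of_tile ?sv // closure_itvoo ?ltrDl //.
  exact/(rho_gt0 lL' mp s0 Llam).
Qed.

Definition flipped_blocks : {set exchange_alphabet} :=
  [set b | block_letter b \in F]%SET.

Lemma tile_block_coding b : tile (block b) `<=` coding_interval (block_letter b).
Proof.
have [x [v [bE _]]] := block_cons b.
by rewrite (block_letterE bE) bE; exact: tile_in_coding_interval.
Qed.

Lemma exchange_affine_iet :
  flipped_affine_iet flipped_blocks (fun b => tile (block b)) exchange.
Proof.
split; first split.
- exact: block_partition.
- move=> b; apply: (continuous_subspaceW (@tile_block_coding b)).
  exact: exchange_continuous.
- move=> b t t' Kt Kt'; rewrite inE.
  by apply: exchange_flip_monotone; exact: tile_block_coding.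
- exact: block_image_partition.
move=> b; have [x [v [bE sv]]] := block_cons b.
exists (slope (x :: v)), (intercept (x :: v)) => t.
by rewrite bE; apply: exchange_tile; rewrite sv.
Qed.

(** The suffix [q] leaves at least [n] letters behind the one erased, so that every step takes place
    on a tile where the exchange is affine. *)
Lemma tile_cyl (v q : seq X) t : (n <= size q)%N -> L' (v ++ q) ->
  tile (v ++ q) t -> cyl coding_interval exchange (map phi v) t.
Proof.
move=> nq; elim: v t => //= x v IH t Lv Kt; split.
  exact: tile_in_coding_interval Kt.
apply: IH; first by apply: fL' Lv; apply/infixP; exists [:: x], [::]; rewrite /= cats0.
by apply: exchange_tile_behead Kt => //; rewrite size_cat; lia.
Qed.

Lemma cyl_unique u w t : cyl coding_interval exchange u t ->
  cyl coding_interval exchange w t -> size u = size w -> u = w.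
Proof.
elim: u w t => [|a u IH] [|b w] //= t [Ja cu] [Jb cw] [sz].
rewrite (IH w (exchange t)) //; congr (_ :: _).
by apply: coding_interval_triv => //; exists t.
Qed.

(** A word of [L'], extended by [n + 1] letters, has a nonempty open tile, which contains a full
    orbit. Conversely, the open cylinder of a coded word contains a point off the countable set of
    tile ends, and a long word whose tile contains that point projects to an extension of the coded
    word. *)
Lemma exchange_language : L = coding_language coding_interval exchange.
Proof.
have aT := exchange_affine_iet.
have [[pI _ _ pT] _] := aT.
apply/seteqP; split.
  move=> w; rewrite {1}LE => -[v L'v <-].
  have [q sq Lq] := extend_right lL' n.+1 L'v.
  have lq := Llam Lq.
  have oK : open (tile (v ++ q)) by exact: itv_open.
  have K01 : tile (v ++ q) `<=` [set` `[0 : R, 1]].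
    move=> t; rewrite /tile_of /= !in_itv /= => /andP[t1 t2].
    have h3 := position_ge0 hF toD' lam0 lamr (v ++ q).
    have h4 := position_le hF toD' lam0 lamr (v ++ q).
    by rewrite (lam_nil mp) in h4; apply/andP; split; lra.
  have Kt : tile (v ++ q) (pos lam (v ++ q) + lam (v ++ q) / 2).
    by rewrite /tile_of /= in_itv /=; apply/andP; split; lra.
  have [y fy Ky] := full_orbit_dense pI pT (iet_injective aT) oK K01 Kt.
  have [b tr] := full_orbit_code fy.
  have trJ : trajectory coding_interval exchange y (block_letter \o b).
    by move=> j; have [yS Ib] := tr j; split=> //; exact: tile_block_coding.
  have nq : (n <= size q)%N by rewrite sq.
  have cv := tile_cyl nq Lq Ky.
  exists y, (block_letter \o b), 0, (size (map phi v)); split=> //.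
  exact: cyl_trajectory_eq coding_interval_triv trJ cv.
move=> w [y [x [i [m [tr ->]]]]].
case: m => [|m]; first by have [] := lL.
have cw := trajectory_cyl i m.+1 tr.
have oc' : open (cyl coding_interval exchange (factor_at x i m.+1)).
  apply: cyl_open => e; last exact: exchange_continuous.
  exact: itv_open.
have [e e0 sub] := itvoo_sub 0 oc' cw.
pose C := \bigcup_(v in [set: seq X]) [set pos lam v] `|`
  \bigcup_(v in [set: seq X]) [set pos lam v + lam v].
have cC : countable C.
  rewrite (_ : C = \bigcup_(i in [set: seq X * bool])
      [set if i.2 then pos lam i.1 else pos lam i.1 + lam i.1]).
    by apply: bigcup_countable => // j _; exact: countable1.
  apply/seteqP; split=> [t [[v _ /= ->]|[v _ /= ->]]|t [[v [|]] _ /= ->]].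
  - by exists (v, true).
  - by exists (v, false).
  - by left; exists v.
  - by right; exists v.
have [|t /sub ct nC] := itvoo_avoid (a := y i - e) (b := y i + e) _ cC; first by lra.
have t01 : 0 <= t <= 1.
  by move: ct; rewrite factor_atS => -[/coding_interval_sub01].
have [||v [sv lv tv]] := @tile_cover_words _ _ hF _ toD' lam lam0 lamr [::] t
  (m.+1 + n.+1)%N.
- by rewrite (lam_nil mp).
- by rewrite (lam_nil mp) add0r.
rewrite cat0s in lv tv.
have Lv : L' v by exact: (lam_support mp).
have Kt : tile v t.
  rewrite /tile_of /= in_itv /=; move: tv => /andP[]; rewrite !le_eqVlt.
  move=> /orP[/eqP e1|->].
    by case: nC; left; exists v.
  move=> /orP[/eqP e2|->] //.
  by case: nC; right; exists v.
rewrite -(cat_take_drop m.+1 v) in Lv Kt.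
have nq : (n <= size (drop m.+1 v))%N by rewrite size_drop sv; lia.
have cv := tile_cyl nq Lv Kt.
rewrite LE; exists (take m.+1 v).
  apply: fL' Lv; apply/infixP; exists [::], (drop m.+1 v).
  by rewrite /= cat_take_drop.
apply: cyl_unique cv ct _.
by rewrite size_map size_factor_at size_takel // sv leq_addr.
Qed.

Lemma exchange_grouped_coding :
  flipped_grouped_coding F L (fun b => tile (block b)) exchange.
Proof.
(* [exchange] is its own extension by continuity, being continuous on whole coding intervals. *)
exists coding_interval, block_letter, exchange; split.
- by split; [exact: coding_interval_open|exact: coding_interval_triv].
- by move=> e t [b /= <- Kt]; exact: tile_block_coding.
- move=> e t Jt; have t01 := coding_interval_sub01 Jt.
  have [||v [sv lv tv]] := @tile_cover_words _ _ hF _ toD' lam lam0 lamr [::] t n.+1.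
  + by rewrite (lam_nil mp).
  + by rewrite (lam_nil mp) add0r.
  rewrite cat0s in lv tv.
  have [b bv] := blockP sv (lam_support mp lv).
  exists b; last first.
    by rewrite bv closure_itvoo ?ltrDl //= in_itv.
  have [x [u [bE _]]] := block_cons b; rewrite /= (block_letterE bE).
  symmetry; apply: (coding_interval_unique Jt); apply: (@tile_coding_interval x u).
  by rewrite -bE bv.
- split=> //; first exact: exchange_continuous.
  exact: exchange_flip_monotone.
- exact: exchange_language.
Qed.

End Exchange.

Theorem theorem22 (R : realType) (A : finType) (L : set (seq A))
    (hL : is_language L) (F : {set A}) :
  (exists (B : finType) (G : {set B}) (I : B -> set R) (T : R -> R),
     flipped_affine_iet G I T /\ flipped_grouped_coding F L I T)
  <->
  (exists ltA ltD : rel A,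
     flipped_order_condition F L ltA ltD /\
     exists (k : A -> nat) (L' : set (seq (split_alphabet k))),
       is_splitting F L ltA ltD L' /\
       exists theta : split_alphabet k -> R,
         forall z : int -> split_alphabet k,
           bi_infinite L' z -> ~ recurrent z ->
           (\sum_(0 <= n <oo)
              (expR (\sum_(0 <= j < n.+1) theta (z j%:Z)))%:E < +oo)%E /\
           (\sum_(1 <= n <oo)
              (expR (- \sum_(1 <= j < n.+1) theta (z (- j%:Z))))%:E < +oo)%E).
Proof.
split.
  move=> [B [G [I [T [aff gc]]]]]; exact: grouped_coding_necessary hL aff gc.
move=> [ltA [ltD [[toA toD _] [k [L' [sp [theta thP]]]]]]].
have [lL' LE [hltA [hltD [oc _ uf fl lift]]]] := sp.
have fL' : factorial_lang L' by have [] := lL'.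
have cfL' := order_condition_crossing_free fL' oc.
have [s [n0 [lam [rho [n0_gt0 s0 mp Llam]]]]] := full_mass_pair lL' cfL' thP.
case: n0 n0_gt0 mp => // n _ mp.
exists (exchange_alphabet L' n), (flipped_blocks F L' n).
exists (fun b => tile_of [set x : split_alphabet k | split_letter x \in F]%SET
  hltD lam (block b)).
exists (exchange F ltA ltD hltD s n lam rho); split.
  exact: (exchange_affine_iet toA toD lL' oc uf fl lift mp s0 Llam).
exact: (exchange_grouped_coding hL toA toD lL' LE oc uf fl lift mp s0 Llam).
Qed.
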